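(* Let $G$ be a finite group and $k$ an algebraically closed field such that the characteristic of $k$ does not divide $|G|$. Denote by $\mathrm{Irr}(G)$ the set of (isomorphism classes of) simple left $kG$-modules. Then, for $n\geq 1$, the quiver of $k\Sigma_n^G$ has vertex set the set of $\mathrm{Irr}(G)$-labelled set partitions of $n$, and its arrows are as follows. Let $\{(P_1,V_1),\ldots,(P_r,V_r)\}$ be an $\mathrm{Irr}(G)$-labelled set partition. For $U\in\mathrm{Irr}(G)$ and $1\leq i\neq j\leq r$, there are $\dim_k\mathrm{Hom}_{kG}(U,V_i\otimes_kV_j)$ (i.e., the multiplicity of $U$ as a composition factor of $V_i\otimes_k V_j$) arrows from $\{(P_1,V_1),\ldots,(P_r,V_r)\}$ to $$\{(P_i\cup P_j,U)\}\cup\bigl(\{(P_1,V_1),\ldots,(P_r,V_r)\}\setminus\{(P_i,V_i),(P_j,V_j)\}\bigr),$$ and there are no other arrows starting at $\{(P_1,V_1),\ldots,(P_r,V_r)\}$.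
   Context: Let $[n]=\{1,\dots,n\}$ and let $1_G$ be the identity of $G$. The monoid $\Sigma_n^G$ (Hsiao's monoid) consists of all ordered $G$-partitions of $n$, i.e. sequences $((P_1,g_1),\ldots,(P_r,g_r))$ where $\{P_1,\dots,P_r\}$ is a set partition of $[n]$ (with the $P_i$ distinct nonempty blocks) and $g_1,\dots,g_r\in G$. The product is $$((P_1,g_1),\ldots,(P_r,g_r))((Q_1,h_1),\ldots,(Q_s,h_s))=((P_1\cap Q_1,g_1h_1),(P_1\cap Q_2,g_1h_2),\ldots,(P_r\cap Q_1,g_rh_1),\ldots,(P_r\cap Q_s,g_rh_s)),$$ where empty intersections are omitted. The identity is $(([n],1_G))$. For a set $X$, an $X$-labelled set partition of $n$ is a set $\{(P_1,x_1),\ldots,(P_r,x_r)\}\subseteq 2^{[n]}\times X$ such that $\{P_1,\ldots,P_r\}$ is a set partition of $[n]$ (into $r$ blocks). In this statement one works with finitely generated left $k\Sigma_n^G$-modules: the quiver of $k\Sigma_n^G$ has as vertices the isomorphism classes of simple left $k\Sigma_n^G$-modules, with $\dim_k\mathrm{Ext}^1_{k\Sigma_n^G}(A,B)$ arrows from $A$ to $B$. Simple modules are identified with $\mathrm{Irr}(G)$-labelled set partitions as follows. Two elements of $S=\Sigma_n^G$ generate the same two-sided ideal iff they have the same underlying set partition. For the idempotent $e=((P_1,1_G),\ldots,(P_r,1_G))$ the group of units of $eSe$ is $G_e=\{((P_1,g_1),\ldots,(P_r,g_r)): g_i\in G\}\cong G^r$. The labelled partition $\{(P_1,V_1),\ldots,(P_r,V_r)\}$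 corresponds to the unique simple left $kS$-module $A$ such that $eA\cong V_1\otimes_k\cdots\otimes_kV_r$ as a $kG_e\cong kG^r$-module (with $(g_1,\dots,g_r)$ acting factorwise) and $fA=0$ for every idempotent $f$ with $SfS\subsetneq SeS$. $V_i\otimes_kV_j$ carries the diagonal $G$-action. *)

(* Defs.v *)
From HB Require Import structures.
From mathcomp Require Import all_boot all_order all_algebra all_fingroup.

Set Implicit Arguments.
Unset Strict Implicit.
Unset Printing Implicit Defensive.
Import GRing.Theory.

Local Open Scope ring_scope.

Definition monoid_alg (k : fieldType) (S : finType) (e : S)
  (op : Monoid.law e) := {ffun S -> k^o}.

Section MonoidAlg.
Variables (k : fieldType) (S : finType) (e : S) (op : Monoid.law e).
Local Notation kS := (monoid_alg k op).
Implicit Types (f g h : kS).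

HB.instance Definition _ := GRing.Lmodule.on kS.

Definition ma_mul f g : kS :=
  [ffun s => \sum_a \sum_(b | op a b == s) f a * g b].
Definition ma_elt (s : S) : kS := [ffun t => (t == s)%:R].

Lemma ma_mulE f g s :
  ma_mul f g s = \sum_a \sum_b f a * g b * (op a b == s)%:R.
Proof.
rewrite ffunE; apply: eq_bigr => a _; rewrite big_mkcond /=.
by apply: eq_bigr => b _; case: eqP; rewrite ?mulr1 ?mulr0.
Qed.

Lemma ma_mulA : associative ma_mul.
Proof.
move=> f g h; apply/ffunP => s; rewrite !ma_mulE.
transitivity (\sum_a \sum_b \sum_c f a * g b * h c * (op (op a b) c == s)%:R).
  apply: eq_bigr => a _.
  under eq_bigr => t _.
    rewrite ma_mulE mulr_sumr mulr_suml.
    under eq_bigr => b _ do rewrite mulr_sumr mulr_suml.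
    over.
  rewrite exchange_big /=; apply: eq_bigr => b _.
  rewrite exchange_big /=; apply: eq_bigr => c _.
  rewrite (bigD1 (op b c)) //= eqxx mulr1 big1 ?addr0.
    by rewrite (Monoid.mulmA op) !mulrA.
  by move=> t /negPf; rewrite eq_sym => ->; rewrite !(mulr0, mul0r).
transitivity (\sum_c \sum_a \sum_b f a * g b * h c * (op (op a b) c == s)%:R).
  by rewrite [RHS]exchange_big; apply: eq_bigr => a _; rewrite exchange_big.
rewrite [RHS]exchange_big; apply: eq_bigr => c _ /=.
under [RHS]eq_bigr => t _.
  rewrite ma_mulE !mulr_suml.
  under eq_bigr => a _ do rewrite !mulr_suml.
  over.
rewrite [RHS]exchange_big /=; apply: eq_bigr => a _.
rewrite [RHS]exchange_big /=; apply: eq_bigr => b _.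
rewrite [RHS] (bigD1 (op a b)) //= eqxx mulr1 big1 ?addr0 //.
by move=> t /negPf; rewrite eq_sym => ->; rewrite !(mulr0, mul0r).
Qed.

Lemma ma_mul1 : left_id (ma_elt e) ma_mul.
Proof.
move=> f; apply/ffunP => s; rewrite ma_mulE (bigD1 e) //= [X in _ + X]big1.
  rewrite addr0 (bigD1 s) //= big1 => [|b /negPf bs].
    by rewrite ffunE (Monoid.mul1m op) !eqxx mul1r mulr1 addr0.
  by rewrite (Monoid.mul1m op) bs mulr0.
by move=> a /negPf a1; rewrite big1 // => b _; rewrite ffunE a1 !mul0r.
Qed.

Lemma ma_mulr1 : right_id (ma_elt e) ma_mul.
Proof.
move=> f; apply/ffunP => s; rewrite ma_mulE (bigD1 s) //= [X in _ + X]big1.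
  rewrite addr0 (bigD1 e) //= big1 => [|b /negPf bs].
    by rewrite ffunE (Monoid.mulm1 op) !eqxx !mulr1 addr0.
  by rewrite ffunE bs mulr0 mul0r.
move=> a /negPf a1; rewrite big1 // => b _; rewrite ffunE.
by case: eqP => [->|_]; rewrite ?(Monoid.mulm1 op) ?a1 !(mulr0, mul0r).
Qed.

Lemma ma_mulDl : left_distributive ma_mul +%R.
Proof.
move=> f g h; apply/ffunP => s; rewrite [RHS]ffunE !ma_mulE -big_split /=.
apply: eq_bigr => a _; rewrite -big_split /=; apply: eq_bigr => b _.
by rewrite ffunE !mulrDl.
Qed.

Lemma ma_mulDr : right_distributive ma_mul +%R.
Proof.
move=> f g h; apply/ffunP => s; rewrite [RHS]ffunE !ma_mulE -big_split /=.
apply: eq_bigr => a _; rewrite -big_split /=; apply: eq_bigr => b _.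
by rewrite ffunE mulrDr mulrDl.
Qed.

Lemma ma_1neq0 : ma_elt e != 0.
Proof.
apply/eqP => /ffunP /(_ e); rewrite !ffunE eqxx => /eqP.
by rewrite oner_eq0.
Qed.

HB.instance Definition _ := GRing.Zmodule_isNzRing.Build kS
  ma_mulA ma_mul1 ma_mulr1 ma_mulDl ma_mulDr ma_1neq0.

Lemma ma_scaleAl (c : k) f g : c *: (f * g) = (c *: f) * g.
Proof.
apply/ffunP => s; rewrite [LHS]ffunE !ma_mulE scaler_sumr.
apply: eq_bigr => a _; rewrite scaler_sumr; apply: eq_bigr => b _.
by rewrite ffunE /= /GRing.scale /= !mulrA.
Qed.

HB.instance Definition _ := GRing.Lmodule_isLalgebra.Build k kS ma_scaleAl.

Lemma ma_scaleAr (c : k) f g : c *: (f * g) = f * (c *: g).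
Proof.
apply/ffunP => s; rewrite [LHS]ffunE !ma_mulE scaler_sumr.
apply: eq_bigr => a _; rewrite scaler_sumr; apply: eq_bigr => b _.
by rewrite ffunE /= /GRing.scale /= -!mulrA mulrCA.
Qed.

HB.instance Definition _ := GRing.Lalgebra_isAlgebra.Build k kS ma_scaleAr.

Lemma ma_eltM (s t : S) : ma_elt s * ma_elt t = ma_elt (op s t) :> kS.
Proof.
apply/ffunP => u; rewrite ma_mulE (bigD1 s) //= (bigD1 t) //= !ffunE !eqxx.
rewrite mul1r mul1r eq_sym big1 => [|b /negPf bt]; last first.
  by rewrite !ffunE bt mulr0 mul0r.
rewrite addr0 big1 ?addr0 // => a /negPf as_; rewrite big1 // => b _.
by rewrite !ffunE as_ !mul0r.
Qed.

End MonoidAlg.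
Arguments ma_elt k {S e op} s.

Section OrderedPartitions.
Variable T : finType.
Implicit Types (s : seq {set T}).

Definition ordered_partition s : bool :=
  uniq s && partition [set:: s] [set: T].

Lemma ordered_partitionE s : ordered_partition s =
  (set0 \notin s) && [forall x, count (fun B : {set T} => x \in B) s == 1%N].
Proof.
apply/andP/andP => [[us /and3P[/eqP cs ts s0]]|[s0 /forallP cs]].
  rewrite inE in s0; split=> //; apply/forallP => x; rewrite eqn_leq.
  have /bigcupP[B] : x \in cover [set:: s] by rewrite cs inE.
  rewrite inE => Bs xB; rewrite -has_count; apply/andP; split; last first.
    by apply/hasP; exists B.
  rewrite -[1%N]/(true : nat) -Bs -(count_uniq_mem _ us).
  rewrite (eq_in_count (a2 := pred1 B)) // => C Cs /=.
  apply/idP/eqP => [xC|->//]; apply/eqP/negPn/negP => nCB.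
  have /trivIsetP/(_ C B) := ts; rewrite !inE => /(_ Cs Bs nCB).
  by move=> /pred0P/(_ x) /=; rewrite xC xB.
have cs1 A : A \in s -> count_mem A s = 1%N.
  move=> As; apply/eqP; rewrite eqn_leq -has_count has_pred1 As andbT.
  have /set0Pn[x xA] : A != set0 by apply: contraNneq s0 => <-.
  by rewrite -(eqP (cs x)); apply: sub_count => B /eqP ->.
split.
  apply: count_mem_uniq => A; case: (boolP (A \in s)) => [/cs1->//|/count_memPn->//].
rewrite /partition [_ \in _]inE s0 andbT; apply/andP; split.
  apply/eqP/setP => x; rewrite inE; apply/bigcupP.
  have : has (fun B : {set T} => x \in B) s by rewrite has_count (eqP (cs x)).
  by case/hasP => B Bs xB; exists B; rewrite ?inE.
apply/trivIsetP => A B; rewrite !inE => As Bs AB; apply/pred0P => x /=.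
apply/negP => /andP[xA xB].
have : (count (predU (pred1 A) (pred1 B)) s <= 1)%N.
  rewrite -(eqP (cs x)); apply: sub_count => C /orP[] /eqP -> //.
have := count_predUI (pred1 A) (pred1 B) s; rewrite !cs1 //.
rewrite (eq_count (a1 := predI (pred1 A) (pred1 B)) (a2 := pred0)) ?count_pred0
  ?addn0 => [|C /=]; last first.
  by case: eqP => //= ->; rewrite (negPf AB).
by move=> ->.
Qed.

Lemma size_ordered_partition s : ordered_partition s -> (size s <= #|T|)%N.
Proof.
case/andP=> us /[dup] ps /and3P[_ _ s0].
have -> : size s = #|[set:: s]|.
  by rewrite cardsE; apply/esym/card_uniqP.
rewrite -cardsT (card_partition ps) -sum1_card; apply: leq_sum => A As.
by rewrite card_gt0; apply: contraNneq s0 => <-.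
Qed.

End OrderedPartitions.

Section Hsiao.
Variables (n : nat) (G : finGroupType).

(* [n] is rendered as 'I_n. *)
Record hsiao := Hsiao {
  hsiao_seq :> seq ({set 'I_n} * G);
  _ : ordered_partition (unzip1 hsiao_seq)
}.

HB.instance Definition _ := [isSub for hsiao_seq].
HB.instance Definition _ := [Choice of hsiao by <:].

Lemma size_hsiao (s : hsiao) : (size s <= n)%N.
Proof.
rewrite -(size_map fst); apply: leq_trans (size_ordered_partition (valP s)) _.
by rewrite card_ord.
Qed.

Definition hsiao_bseq (s : hsiao) : n.-bseq ({set 'I_n} * G) :=
  Bseq (size_hsiao s).

Lemma hsiao_bseqK :
  pcancel hsiao_bseq (fun b : n.-bseq ({set 'I_n} * G) => insub (b : seq _)).
Proof. by move=> s; rewrite /= valK. Qed.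

HB.instance Definition _ : isCountable hsiao := PCanIsCountable hsiao_bseqK.
HB.instance Definition _ : isFinite hsiao := PCanIsFinite hsiao_bseqK.

Definition hsiao_mul_seq (s t : seq ({set 'I_n} * G)) :=
  [seq x <- [seq (p.1 :&: q.1, (p.2 * q.2)%g) | p <- s, q <- t]
     | x.1 != set0].

(* For n = 0 the partition of [n] has no block. *)
Definition hsiao_one_seq : seq ({set 'I_n} * G) :=
  [seq x <- [:: ([set: 'I_n], 1%g)] | x.1 != set0].

Let cov (x : 'I_n) := fun p : {set 'I_n} * G => x \in p.1.

Lemma hsiaoE (s : seq ({set 'I_n} * G)) : ordered_partition (unzip1 s) =
  all (fun p => p.1 != set0) s && [forall x, count (cov x) s == 1%N].
Proof.
rewrite ordered_partitionE; congr (_ && _).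
  by elim: s => //= p s <-; rewrite inE negb_or eq_sym.
by apply: eq_forallb => x; rewrite count_map.
Qed.

Lemma count_cov_filter x (s : seq ({set 'I_n} * G)) :
  count (cov x) [seq p <- s | p.1 != set0] = count (cov x) s.
Proof.
rewrite count_filter; apply: eq_count => p /=; rewrite andb_idr //.
by move=> xp; apply/set0Pn; exists x.
Qed.

Lemma count_cov_allpairs x (s t : seq ({set 'I_n} * G)) :
  count (cov x) [seq (p.1 :&: q.1, (p.2 * q.2)%g) | p <- s, q <- t] =
  (count (cov x) s * count (cov x) t)%N.
Proof.
elim: s => //= p s IHs; rewrite count_cat IHs mulnDl; congr addn.
rewrite count_map /cov; case: (boolP (x \in p.1)) => xp.
  by rewrite mul1n; apply: eq_count => q; rewrite /= inE xp.
by rewrite mul0n -(count_pred0 t); apply: eq_count => q; rewrite /= inE (negPf xp).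
Qed.

Lemma hsiao_mul_subproof (s t : hsiao) :
  ordered_partition (unzip1 (hsiao_mul_seq s t)).
Proof.
rewrite hsiaoE filter_all; apply/forallP => x.
have [] := (valP s, valP t); rewrite !hsiaoE => /andP[_ /forallP/(_ x)/eqP cs].
move=> /andP[_ /forallP/(_ x)/eqP ct].
by rewrite count_cov_filter count_cov_allpairs cs ct.
Qed.

Lemma hsiao_one_subproof : ordered_partition (unzip1 hsiao_one_seq).
Proof.
rewrite hsiaoE filter_all; apply/forallP => x.
by rewrite count_cov_filter /= /cov inE.
Qed.

Definition hsiao_mul (s t : hsiao) := Hsiao (hsiao_mul_subproof s t).
Definition hsiao_one := Hsiao hsiao_one_subproof.

Let gmul (p q : {set 'I_n} * G) := (p.1 :&: q.1, (p.2 * q.2)%g).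

Lemma hsiao_mul_seqE s t : hsiao_mul_seq s t =
  [seq x <- [seq gmul p q | p <- s, q <- t] | x.1 != set0].
Proof. by []. Qed.

Lemma filter_gmull p (t : seq ({set 'I_n} * G)) : p.1 = set0 ->
  [seq x <- [seq gmul p q | q <- t] | x.1 != set0] = [::].
Proof. by move=> p0; elim: t => //= q t ->; rewrite p0 set0I eqxx. Qed.

Lemma filter_gmulr p (t : seq ({set 'I_n} * G)) :
  [seq x <- [seq gmul p q | q <- [seq y <- t | y.1 != set0]] | x.1 != set0] =
  [seq x <- [seq gmul p q | q <- t] | x.1 != set0].
Proof.
elim: t => //= q t <-; case: (altP (q.1 =P set0)) => //= ->.
by rewrite setI0 eqxx.
Qed.

Lemma hsiao_mul_seq_filterl s t :
  hsiao_mul_seq [seq x <- s | x.1 != set0] t = hsiao_mul_seq s t.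
Proof.
rewrite !hsiao_mul_seqE; elim: s => //= p s IHs.
case: (altP (p.1 =P set0)) => p0; last by rewrite /= !filter_cat IHs.
by rewrite filter_cat IHs filter_gmull.
Qed.

Lemma hsiao_mul_seq_filterr s t :
  hsiao_mul_seq s [seq x <- t | x.1 != set0] = hsiao_mul_seq s t.
Proof.
rewrite !hsiao_mul_seqE; elim: s => //= p s IHs.
by rewrite !filter_cat IHs filter_gmulr.
Qed.

Lemma gmulA : associative gmul.
Proof. by move=> p q r; rewrite /gmul /= setIA mulgA. Qed.

Lemma hsiao_mulA : associative hsiao_mul.
Proof.
move=> s t u; apply: val_inj => /=.
rewrite hsiao_mul_seq_filterr hsiao_mul_seq_filterl !hsiao_mul_seqE.
congr filter; elim: (val s) => //= p s' ->.
rewrite allpairs_cat; congr cat.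
rewrite map_allpairs allpairs_mapl.
by apply: eq_allpairs => x y; rewrite gmulA.
Qed.

Lemma hsiao_filter_id (s : hsiao) : [seq x <- s | x.1 != set0] = s :> seq _.
Proof.
apply/all_filterP; have := valP s.
by rewrite hsiaoE => /andP[].
Qed.

Lemma hsiao_mul1 : left_id hsiao_one hsiao_mul.
Proof.
move=> s; apply: val_inj => /=; rewrite hsiao_mul_seq_filterl.
rewrite hsiao_mul_seqE /= cats0 -[RHS]hsiao_filter_id; congr filter.
by rewrite -[RHS]map_id; apply: eq_map => -[A g]; rewrite /gmul /= setTI mul1g.
Qed.

Lemma hsiao_mulr1 : right_id hsiao_one hsiao_mul.
Proof.
move=> s; apply: val_inj => /=; rewrite hsiao_mul_seq_filterr.
rewrite hsiao_mul_seqE -[RHS]hsiao_filter_id; congr filter.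
elim: (hsiao_seq s) => //= -[A g] s' ->.
by rewrite /gmul /= setIT mulg1.
Qed.

HB.instance Definition _ :=
  monoid.isMonoid.Build hsiao hsiao_mulA hsiao_mul1 hsiao_mulr1.

End Hsiao.

Section UnitsAt.
Variables (n : nat) (G : finGroupType) (r : nat) (P : 'I_r -> {set 'I_n}).
Hypothesis hP : ordered_partition (codom P).
Implicit Types (g : 'I_r -> G).

Lemma gpart_subproof g :
  ordered_partition (unzip1 [seq (P i, g i) | i <- enum 'I_r]).
Proof. by rewrite /unzip1 -map_comp. Qed.

(* ((P_1, g_1), ..., (P_r, g_r)) *)
Definition gpart g : hsiao n G := Hsiao (gpart_subproof g).

End UnitsAt.

From mathcomp Require Import all_classical.
Local Open Scope classical_set_scope.

Section Algebras.
Variables (k : fieldType) (n : nat) (G : finGroupType).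

Definition group_alg : algType k := monoid_alg k (@mulg G).
Definition group_elt (g : G) : group_alg := ma_elt k g.

Definition hsiao_alg : algType k :=
  monoid_alg k (e := (1%g : hsiao n G)) (@mulg (hsiao n G)).
Definition hsiao_elt (s : hsiao n G) : hsiao_alg := ma_elt k s.

End Algebras.

(* Restriction of scalars along k -> A. *)
Definition restr (k : fieldType) (A : algType k) (M : lmodType A) : Type := M.

Section Restriction.
Variables (k : fieldType) (A : algType k) (M : lmodType A).

HB.instance Definition _ := GRing.Zmodule.on (restr M).

Definition restr_scale (c : k) (v : restr M) : restr M := (c%:A : A) *: (v : M).

Lemma restr_scaleA a b v :
  restr_scale a (restr_scale b v) = restr_scale (a * b) v.
Proof. by rewrite /restr_scale scalerA -scalerAl mul1r scalerA. Qed.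

Lemma restr_scale1 : left_id 1 restr_scale.
Proof. by move=> v; rewrite /restr_scale !scale1r. Qed.

Lemma restr_scaleDr : right_distributive restr_scale +%R.
Proof. by move=> a u v; rewrite /restr_scale scalerDr. Qed.

Lemma restr_scaleDl v : {morph restr_scale^~ v : a b / a + b}.
Proof. by move=> a b; rewrite /restr_scale !scalerDl. Qed.

HB.instance Definition _ := GRing.Zmodule_isLmodule.Build k (restr M)
  restr_scaleA restr_scale1 restr_scaleDr restr_scaleDl.

End Restriction.

(* dim_k (Z / B) = d, for subspaces B <= Z of V: the e_i are representatives of
   a basis of the quotient. *)
Definition subquot_dim (k : fieldType) (V : lmodType k) (Z B : set V)
    (d : nat) : Prop :=
  exists e : 'I_d -> V, (forall i, Z (e i)) /\
    forall z, Z z -> exists! c : 'rV[k]_d, B (z - \sum_i c 0 i *: e i).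

Section Modules.
Variables (k : fieldType) (A : algType k).
Implicit Types (M N P : lmodType A).

Definition simple_module M : Prop :=
  (exists x : M, x != 0) /\
  forall X : {pred M}, GRing.submod_closed X ->
    (forall x, x \in X -> x = 0) \/ (forall x, x \in X).

Definition module_isomorphic M N : Prop := exists f : {linear M -> N}, bijective f.

(* Isomorphism classes of simple left A-modules. *)
Definition Irr :=
  {C : lmodType A -> Prop |
    exists2 M, simple_module M & C = (fun N => module_isomorphic M N)}.

Definition module_hom M N : set (M -> restr N) :=
  [set f | linear (f : M -> N)].
Arguments module_hom : clear implicits.

Definition hom_dim M N (d : nat) : Prop := subquot_dim (module_hom M N) [set 0] d.

Definition projective P : Prop :=
  forall (M N : lmodType A) (p : {linear M -> N}) (f : {linear P -> N}),
    (forall y, exists x, p x = y) ->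
    exists g : {linear P -> M}, forall x, p (g x) = f x.

Record proj_resolution M := ProjResolution {
  res_mod : nat -> lmodType A;
  res_diff : forall i, {linear res_mod i.+1 -> res_mod i};
  res_aug : {linear res_mod 0 -> M};
  res_proj : forall i, projective (res_mod i);
  res_aug_surj : forall m, exists x, res_aug x = m;
  res_exact0 : forall x, res_aug x = 0 <-> exists y, res_diff 0 y = x;
  res_exact : forall i x,
    res_diff i x = 0 <-> exists y, res_diff i.+1 y = x
}.

(* Ext^1_A(M, N) = H^1(Hom_A(P_., N)) for a projective resolution P_. -> M; the
   dimension does not depend on the resolution, and there is one by
   FreeResolution.proj_resolution_exists. *)
Section Ext1.
Variables (M N : lmodType A) (R : proj_resolution M).

Definition ext1_cocycle : set (res_mod R 1 -> restr N) :=
  [set f | module_hom _ _ f /\ forall y, f (res_diff R 1 y) = 0].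

Definition ext1_coboundary : set (res_mod R 1 -> restr N) :=
  [set f | exists2 g : res_mod R 0 -> restr N,
             module_hom _ _ g & f = (fun y => g (res_diff R 0 y))].

End Ext1.

Definition ext1_dim M N (d : nat) : Prop :=
  forall R : proj_resolution M,
    subquot_dim (@ext1_cocycle M N R) (@ext1_coboundary M N R) d.

(* In the quiver of A there are exactly d arrows from x to y. *)
Definition arrows (x y : Irr) (d : nat) : Prop :=
  forall M N, sval x M -> sval y N -> ext1_dim M N d.

End Modules.

From mathcomp.multinomials Require freeg.

Module FreeResolution.
Import freeg.
Section FreeResolution.
Variables (k : fieldType) (A : algType k).

Lemma fglift_is_linear (X : choiceType) (M : lmodType A) (f : X -> M) :
  linear (fglift f : {freeg X / A} -> M).
Proof.
pose F := GRing.isZmodMorphism.Build _ _ _ (lift_is_additive f).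
pose H : {additive {freeg X / A} -> M} := HB.pack (fglift f) F.
have HE D : fglift f D = H D by [].
move=> a D E; rewrite !HE raddfD; congr (_ + _).
rewrite -(freeg_sumE D).
rewrite (big_morph (fun D : {freeg X / A} => a *: D) (scalerDr a) (scaler0 _ a)) !raddf_sum.
apply: eq_bigr => x _ /=.
have -> : a *: << coeff x D *g x >> = << a * coeff x D *g x >> :> {freeg X / A}.
  by apply/eqP/freeg_eqP => y; rewrite coeffZ !coeffU mulrA.
by rewrite !liftU scalerA.
Qed.

HB.instance Definition _ (X : choiceType) (M : lmodType A) (f : X -> M) :=
  GRing.isLinear.Build A {freeg X / A} M _ (fglift f) (fglift_is_linear f).

Lemma free_projective (X : choiceType) : projective ({freeg X / A} : lmodType A).
Proof.
move=> M N p f ps.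
have /choice[g pg] : forall x : X, exists m, p m = f << x >>.
  by move=> x; exact: ps.
exists (fglift g : {linear {freeg X / A} -> M}) => D.
rewrite -(freeg_sumE D) !linear_sum /=; apply: eq_bigr => x _.
have -> : << coeff x D *g x >> = coeff x D *: << x >> :> {freeg X / A}.
  by apply/eqP/freeg_eqP => y; rewrite coeffZ !coeffU mulrA mulr1.
by rewrite !linearZ /= liftU scale1r pg.
Qed.

Definition free_cover (M : lmodType A) : lmodType A := {freeg M / A}.
Definition cover_map (M : lmodType A) : {linear free_cover M -> M} :=
  fglift (id : M -> M).

Section Kernel.
Variables (M N : lmodType A) (f : {linear M -> N}).
Definition in_ker : {pred M} := fun x => f x == 0.
Lemma in_ker_submod : GRing.submod_closed in_ker.
Proof.
split=> [|a x y]; rewrite !unfold_in; first by rewrite linear0.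
by rewrite /in_ker linearP => /eqP -> /eqP ->; rewrite scaler0 addr0.
Qed.
HB.instance Definition _ := GRing.isSubmodClosed.Build A M in_ker in_ker_submod.
Record kernel := Kernel {ker_val : M; _ : ker_val \in in_ker}.
HB.instance Definition _ := [isSub for ker_val].
HB.instance Definition _ := [Choice of kernel by <:].
HB.instance Definition _ := [SubChoice_isSubLmodule of kernel by <:].
End Kernel.

Fixpoint syzygy (M : lmodType A) (i : nat) : lmodType A :=
  if i is j.+1 then kernel (cover_map (syzygy M j)) else M.

Lemma proj_resolution_exists (M : lmodType A) : inhabited (proj_resolution M).
Proof.
have cs (N : lmodType A) m : exists x, cover_map N x = m.
  by exists << m >>; rewrite /= liftU scale1r.
pose d i : {linear free_cover (syzygy M i.+1) -> free_cover (syzygy M i)} :=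
  (\val : kernel (cover_map (syzygy M i)) -> _) \o cover_map (syzygy M i.+1).
have ex (i : nat) x : cover_map (syzygy M i) x = 0 <-> exists y, d i y = x.
  split=> [x0|[y <-]]; last by apply/eqP; exact: valP (cover_map _ y).
  have xk : x \in in_ker (cover_map (syzygy M i)) by apply/eqP.
  have [y ye] := cs (syzygy M i.+1) (Kernel xk).
  by exists y; rewrite /d /= -[LHS]/(val (cover_map (syzygy M i.+1) y)) ye.
constructor; exists (fun i => free_cover (syzygy M i)) d (cover_map M).
- by move=> i; exact: free_projective.
- exact: cs.
- exact: ex 0.
- move=> i x; rewrite -ex; split=> [|x0]; last by rewrite /d /= x0.
  by move=> h; apply: val_inj.
Qed.

End FreeResolution.
End FreeResolution.

Section Tensor.
Variables (k : fieldType) (I : finType).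

Definition multilinear (V : I -> lmodType k) (T : lmodType k)
    (tau : (forall i, V i) -> T) : Prop :=
  forall (v : forall i, V i) (i : I) (a : k) (x y : V i),
    tau (eqtype.dfwith v (a *: x + y)) =
      a *: tau (eqtype.dfwith v x) + tau (eqtype.dfwith v y).

Definition is_tensor (V : I -> lmodType k) (T : lmodType k)
    (tau : (forall i, V i) -> T) : Prop :=
  multilinear tau /\
  forall (Z : lmodType k) (beta : (forall i, V i) -> Z), multilinear beta ->
    (exists h : {linear T -> Z}, forall v, h (tau v) = beta v) /\
    (forall h h' : {linear T -> Z},
       (forall v, h (tau v) = beta v) -> (forall v, h' (tau v) = beta v) ->
       forall t, h t = h' t).

(* T is the tensor product over k of the kG-modules V i, on which h in H acts
   on the i-th factor through pr i h. *)
Definition is_tensor_module (G H : finGroupType) (pr : I -> H -> G)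
    (V : I -> lmodType (group_alg k G)) (T : lmodType (group_alg k H)) : Prop :=
  exists tau : (forall i, restr (V i)) -> restr T,
    is_tensor tau /\
    forall (h : H) (v : forall i, V i),
      group_elt k h *: (tau v : T) =
      tau (fun i => group_elt k (pr i h) *: v i).

End Tensor.

(* dim_k Hom_kG(U, V (x) W) = d, with the diagonal action on V (x) W *)
Definition hom_tensor_dim (k : fieldType) (G : finGroupType)
    (u v w : Irr (group_alg k G)) (d : nat) : Prop :=
  forall U V W, sval u U -> sval v V -> sval w W ->
    exists2 T : lmodType (group_alg k G),
      is_tensor_module (fun (b : bool) (g : G) => g)
        (fun b => if b then V else W) T
      & hom_dim U T d.

Section LabelledPartitions.
Variables (n : nat) (X : Type).

(* L P x means that (P, x) belongs to the labelled partition L. *)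
Definition is_labelled_partition (L : {set 'I_n} -> X -> Prop) : Prop :=
  finset.partition [set P : {set 'I_n} | `[< exists x, L P x >]]%SET
    [set: 'I_n]%SET /\
  forall P x y, L P x -> L P y -> x = y.

Definition labelled_partition :=
  {L : {set 'I_n} -> X -> Prop | is_labelled_partition L}.

(* {(P :|: Q, u)} U (L \ {(P, v), (Q, w)}) *)
Definition merge_blocks (L : {set 'I_n} -> X -> Prop) (P : {set 'I_n}) (v : X)
    (Q : {set 'I_n}) (w : X) (u : X) : {set 'I_n} -> X -> Prop :=
  fun R y => (R = P :|: Q /\ y = u) \/
             (L R y /\ ~ (R = P /\ y = v) /\ ~ (R = Q /\ y = w)).

Lemma merge_blocksP (L : {set 'I_n} -> X -> Prop) P v Q w u :
  is_labelled_partition L -> L P v -> L Q w -> P != Q ->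
  is_labelled_partition (merge_blocks L P v Q w u).
Proof.
move=> [pL uL] LP LQ PQ.
have [/eqP cL tL L0] := and3P pL.
set B := [set P | _]%SET in pL cL tL L0.
have BE R : (R \in B) <-> exists x, L R x by rewrite inE; split => /asboolP.
have BP : P \in B by apply/BE; exists v.
have BQ : Q \in B by apply/BE; exists w.
have dB R R' i : R \in B -> R' \in B -> i \in R -> i \in R' -> R = R'.
  move=> BR BR' iR iR'; apply/eqP; apply: contraT => RR'.
  by have /finset.trivIsetP/(_ R R' BR BR' RR')/pred0P/(_ i) := tL; rewrite /= iR iR'.
have nB : P :|: Q \notin B.
  apply/negP => BPQ.
  have /set0Pn[i iP] : P != finset.set0 by apply: contraNneq L0 => <-.
  have /set0Pn[j jQ] : Q != finset.set0 by apply: contraNneq L0 => <-.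
  have eP := dB _ _ i BP BPQ iP; have eQ := dB _ _ j BQ BPQ jQ.
  have {}eP : P = P :|: Q by apply: eP; rewrite inE iP.
  have {}eQ : Q = P :|: Q by apply: eQ; rewrite inE jQ orbT.
  by case/eqP: PQ; rewrite {1}eP {2}eQ.
have BmE R : (exists x, merge_blocks L P v Q w u R x) <->
    R = P :|: Q \/ [/\ R \in B, R != P & R != Q].
  split=> [[x [[-> _]|[LR [nP nQ]]]]|[->|[/BE[x LR] nP nQ]]]; first by left.
  - right; split; first by apply/BE; exists x.
      by apply/eqP => RP; apply: nP; split=> //; apply: (uL P) => //; rewrite -RP.
    by apply/eqP => RQ; apply: nQ; split=> //; apply: (uL Q) => //; rewrite -RQ.
  - by exists u; left.
  - by exists x; right; split=> //; split=> -[eR _]; rewrite eR eqxx in nP nQ.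
have BmP R : (R \in [set R | `[< exists x, merge_blocks L P v Q w u R x >]]%SET)
    <-> R = P :|: Q \/ [/\ R \in B, R != P & R != Q].
  by rewrite inE; split=> [/asboolP/BmE|/BmE/asboolP].
split; last first.
  move=> R x y [[-> ->]|[LR _]] [[eR ->]|[LR' _]] //.
  - by case/negP: nB; apply/BE; exists y.
  - by case/negP: nB; rewrite -eR; apply/BE; exists x.
  - exact: uL LR LR'.
apply/and3P; split.
- apply/eqP/setP => i; rewrite [RHS]inE; apply/finset.bigcupP.
  have : i \in finset.cover B by rewrite cL inE.
  case/finset.bigcupP => R BR iR.
  have [eR|nP] := eqVneq R P.
    exists (P :|: Q); last by rewrite inE -eR iR.
    by apply/BmP; left.
  have [eR|nQ] := eqVneq R Q.
    exists (P :|: Q); last by rewrite inE -eR iR orbT.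
    by apply/BmP; left.
  by exists R => //; apply/BmP; right.
- apply/finset.trivIsetP => R R' /BmP hR /BmP hR' nR.
  apply/pred0P => i /=; apply/negP => /andP[].
  case: hR hR' nR => [->|[BR nP nQ]] [->|[BR' nP' nQ']]; rewrite ?eqxx //.
  + move=> _ /setUP[] iS iR.
      by case/eqP: nP'; apply: dB iR iS.
    by case/eqP: nQ'; apply: dB iR iS.
  + move=> _ iR /setUP[] iS.
      by case/eqP: nP; apply: dB iR iS.
    by case/eqP: nQ; apply: dB iR iS.
  + by move=> /eqP RR' iR iR'; apply: RR'; apply: dB iR iR'.
- apply/negP => /BmP[/esym/eqP|[]].
    by rewrite finset.setU_eq0 => /andP[/eqP P0 _]; move: L0; rewrite -P0 BP.
  by rewrite (negPf L0).
Qed.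

End LabelledPartitions.

Definition two_sided_ideal (n : nat) (G : finGroupType) (x : hsiao n G) :
    {set hsiao n G} :=
  [set (a * x * b)%g | a : hsiao n G, b : hsiao n G]%SET.

Section Simples.
Variables (k : fieldType) (n : nat) (G : finGroupType).
Local Notation kG := (group_alg k G).
Local Notation S := (hsiao n G).
Local Notation kS := (hsiao_alg k n G).

(* For L = {(P_i, x_i)}, with V_i in the class x_i, and e = ((P_1, 1), ...,
   (P_r, 1)): iota is an isomorphism of k-spaces from T, the tensor product of
   the V_i with factorwise action of G^r, onto eA, which carries the action of
   g in G^r to that of ((P_1, g_1), ..., (P_r, g_r)) in G_e. *)
Definition affords (L : labelled_partition n (Irr kG)) (A : lmodType kS) :
    Prop :=
  exists (r : nat) (P : 'I_r -> {set 'I_n})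
    (hP : ordered_partition (codom P)) (x : 'I_r -> Irr kG)
    (V : 'I_r -> lmodType kG),
  let e : S := gpart hP (fun=> 1%g) in
  [/\ forall Q y, sval L Q y <-> exists i, Q = P i /\ y = x i,
      forall i, sval (x i) (V i),
      exists2 T : lmodType (group_alg k {dffun forall _ : 'I_r, G}),
        is_tensor_module
          (fun (i : 'I_r) (g : {dffun forall _ : 'I_r, G}) => g i) V T
        & exists iota : {linear restr T -> restr A},
          [/\ injective iota,
              forall y : A, (exists t, iota t = y) <->
                (exists z : A, y = hsiao_elt k e *: z)
            & forall (g : {dffun forall _ : 'I_r, G}) (t : T),
                iota (group_elt k g *: t) =
                hsiao_elt k (gpart hP g) *: (iota t : A)]
    & forall (f : S) (y : A), (f * f)%g = f ->
        two_sided_ideal f \proper two_sided_ideal e ->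
        hsiao_elt k f *: y = 0].

Definition corresponds (L : labelled_partition n (Irr kG)) (x : Irr kS) :
    Prop :=
  forall A, sval x A -> affords L A.

End Simples.

(* Main.v *)
Require Import Defs.
From HB Require Import structures.
From mathcomp Require Import all_boot all_order all_algebra all_fingroup.
From mathcomp Require Import all_classical.
From mathcomp Require Import mxrepresentation.

Set Implicit Arguments.
Unset Strict Implicit.
Unset Printing Implicit Defensive.
Import GRing.Theory.

Local Open Scope ring_scope.
Local Notation dfwith := eqtype.dfwith.

(* An element s of Hsiao's monoid S is a weak order on [n], given by the order of
   its blocks, together with a G-label constant on blocks; in a product the weak
   orders are combined lexicographically and the labels are multiplied.  An
   idempotent e satisfies e s e = e s, so ker e is a submodule of every left
   module and e acts on a simple module as 0 or 1.  Hence a simple module has an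
   apex, the finest set partition whose idempotents act as 1, and is a simple
   module of the group G^r attached to it, that is an outer tensor product of
   simple kG-modules.

   Ext^1(A, B) is the space of derivations S -> Hom_k(A, B) modulo the inner ones.
   Let e and f be idempotents at the apexes of A and B.  If f is not coarser than
   e, a derivation D is the inner one defined by D f; if e and f have the same
   blocks, one averages over the group of units.  Suppose f is strictly coarser.
   For a union X of blocks of e that is not a union of blocks of f, the idempotent
   (X, ~X) acts as 1 on A and as 0 on B, and D (X, ~X) = D (Y, ~Y) when X is
   contained in Y.  It follows that D is governed by its values on the (P, ~P), P
   a block of e that is not a block of f, and that these coincide unless f merges
   exactly two blocks P and Q of e.  In that case D is inner if and only if the
   difference D (P, ~P) - D (Q, ~Q) vanishes, and the differences that occur are
   exactly the maps A -> B commuting with all elements of S whose blocks are unions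
   of blocks of f.  By Schur's lemma these maps form a space isomorphic to
   Hom_kG (V_P (x) V_Q, U) if the other labels agree, and vanish otherwise. *)

(** * Restriction of scalars and monoid algebras *)

(** An element whose blocks are unions of blocks of f carries a single label on the merged block,
    hence the same label on P and on Q: this is where the diagonal action on V_P (x) V_Q comes from.
    The computation yields Hom_kG (V_P (x) V_Q, U), whereas the arrows are counted by Hom_kG (U, V_P
    (x) V_Q); the two dimensions agree because |G| is invertible, and are compared as ranks of two
    averaging projectors that are transposes of each other. Ext^1 is given by an arbitrary
    projective resolution, so derivations are matched with its cocycles by means of a k-linear
    section of the augmentation. Modules carry no dimension bound: a simple module is spanned by the
    finite set S v for any nonzero v, and all bases derive from this. Algebraic closure enters
    through matrix units, which make outer tensor products of simple modules simple and cut
    one-dimensional slices out of tensor factors. A labelled partition does not order its blocks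
    while an idempotent does; modules are therefore typed through the preorder [hge], which ignores
    that order. *)

Lemma linear_bundle (R : pzRingType) (M N : lmodType R) (f : M -> N) :
  linear f -> exists g : {linear M -> N}, forall x, g x = f x.
Proof.
move=> lf; pose g' := GRing.isLinear.Build R M N _ f lf.
pose g : {linear M -> N} := HB.pack f g'.
by exists g.
Qed.

Section RestrTheory.
Variables (k : fieldType) (A : algType k).
Implicit Types M N : lmodType A.

Lemma restrZE M (c : k) (v : M) : (c *: (v : restr M)) = (c%:A *: v : M).
Proof. by []. Qed.

Lemma restrZA M (c : k) (a : A) (v : M) :
  c *: (a *: v : restr M) = ((c *: a) *: v : M).
Proof. by rewrite restrZE scalerA -scalerAl mul1r. Qed.

Lemma restrZC M (c : k) (a : A) (v : M) :
  c *: (a *: v : restr M) = (a *: (c *: (v : restr M) : M) : M).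
Proof. by rewrite restrZA restrZE scalerA -scalerAr mulr1. Qed.

Lemma restr_linear M N (f : {linear M -> N}) :
  linear (f : restr M -> restr N).
Proof. by move=> c x y; rewrite !restrZE linearP. Qed.

Lemma act_linear M (a : A) : linear ((fun v => a *: (v : M)) : restr M -> restr M).
Proof. by move=> c x y; rewrite scalerDr -restrZC. Qed.

Lemma actP M (a : A) (c : k) (x y : restr M) :
  a *: (c *: x + y : M) = c *: (a *: (x : M) : restr M) + a *: (y : M) :> M.
Proof. exact: act_linear. Qed.

End RestrTheory.

(** The [algType] carried by [monoid_alg]; [group_alg] and [hsiao_alg] are instances of it up to
    conversion, so what is proved for it applies to both. *)
Definition malg (k : fieldType) (S : finType) (e : S) (op : Monoid.law e) :
  algType k := monoid_alg k op.

Section MonoidAlgTheory.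
Variables (k : fieldType) (S : finType) (e : S) (op : Monoid.law e).
Local Notation kS := (malg k op).
Implicit Types M N : lmodType kS.

Lemma ma_sum (a : kS) : a = \sum_s (a s : k) *: (ma_elt k s : kS).
Proof.
apply/ffunP => t; rewrite sum_ffunE (bigD1 t) //= big1 => [|s /negPf st].
  by rewrite !ffunE eqxx addr0 /GRing.scale /= mulr1.
by rewrite !ffunE eq_sym st scaler0.
Qed.

Lemma ma_act_sum M (a : kS) (v : M) :
  a *: v = \sum_s (a s : k) *: ((ma_elt k s : kS) *: v : restr M) :> restr M.
Proof.
rewrite {1}[a]ma_sum scaler_suml; apply: eq_bigr => s _.
by rewrite restrZA.
Qed.

Lemma ma_elt_act M (s t : S) (v : M) :
  (ma_elt k s : kS) *: ((ma_elt k t : kS) *: v) = (ma_elt k (op s t) : kS) *: v.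
Proof. by rewrite scalerA ma_eltM. Qed.

Lemma ma_elt1_act M (v : M) : (ma_elt k e : kS) *: v = v.
Proof. exact: scale1r. Qed.

(** The elements of S span kS over k, so kS-linearity has only to be tested on k and on S. *)
Lemma ma_linear M N (f : restr M -> restr N) :
    linear f ->
    (forall s (v : M), f ((ma_elt k s : kS) *: v) = (ma_elt k s : kS) *: (f v : N)) ->
  linear (f : M -> N).
Proof.
move=> lf fs; have [g gf] := linear_bundle lf.
move=> a x y; rewrite -!gf linearD !gf; congr (_ + _).
rewrite !ma_act_sum -gf linear_sum; apply: eq_bigr => s _.
by rewrite linearZ /= !gf fs.
Qed.

Section ActMod.
Variable W : lmodType k.

(** The converse passage: a k-linear action of S on W determines a kS-module. Tensor products,
    restrictions to a factor, inflations and extensions are all built in this way. *)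
Record maction := MAction {
  mact :> S -> W -> W;
  mact_linear : forall s, linear (mact s);
  mact1 : forall w, mact e w = w;
  mactM : forall s t w, mact (op s t) w = mact s (mact t w)
}.

Definition actmod (r : maction) : Type := W.

Section Instances.
Variable r : maction.
HB.instance Definition _ := GRing.Zmodule.on (actmod r).

Definition actmod_scale (a : kS) (v : actmod r) : actmod r :=
  \sum_s (a s : k) *: (r s v : W).

Lemma actmod_scaleA a b v :
  actmod_scale a (actmod_scale b v) = actmod_scale (a * b) v.
Proof.
rewrite /actmod_scale.
transitivity (\sum_s \sum_t (a s * b t : k) *: (r (op s t) v : W)).
  apply: eq_bigr => s _; have [g gf] := linear_bundle (mact_linear r s).
  rewrite -gf linear_sum scaler_sumr; apply: eq_bigr => t _.
  by rewrite linearZ /= scalerA gf mactM.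
transitivity (\sum_u \sum_s \sum_(t | op s t == u) (a s * b t : k) *: (r (op s t) v : W)).
  rewrite [RHS]exchange_big /=; apply: eq_bigr => s _.
  by rewrite (partition_big (op s) xpredT).
apply: eq_bigr => u _.
have -> : ((a * b) u : k) = \sum_s \sum_(t | op s t == u) (a s * b t : k).
  by rewrite [LHS]ffunE.
rewrite scaler_suml; apply: eq_bigr => s _; rewrite scaler_suml.
by apply: eq_bigr => t /eqP ->.
Qed.

Lemma actmod_scale_elt s v : actmod_scale (ma_elt k s) v = r s v.
Proof.
rewrite /actmod_scale (bigD1 s) //= big1 => [|t /negPf st].
  by rewrite ffunE eqxx scale1r addr0.
by rewrite ffunE st scale0r.
Qed.

Lemma actmod_scale1 : left_id 1 actmod_scale.
Proof. by move=> v; rewrite [LHS]actmod_scale_elt mact1. Qed.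

Lemma actmod_scaleDr : right_distributive actmod_scale +%R.
Proof.
move=> a u v; rewrite /actmod_scale -big_split; apply: eq_bigr => s _ /=.
have [g gf] := linear_bundle (mact_linear r s).
by rewrite -!gf linearD scalerDr.
Qed.

Lemma actmod_scaleDl v : {morph actmod_scale^~ v : a b / a + b}.
Proof.
move=> a b; rewrite /actmod_scale -big_split; apply: eq_bigr => s _ /=.
by rewrite ffunE scalerDl.
Qed.

HB.instance Definition _ := GRing.Zmodule_isLmodule.Build kS (actmod r)
  actmod_scaleA actmod_scale1 actmod_scaleDr actmod_scaleDl.

Lemma actmod_elt s (v : actmod r) : (ma_elt k s : kS) *: v = r s v.
Proof. exact: actmod_scale_elt. Qed.

Lemma actmod_restrZ (c : k) (v : actmod r) :
  c *: (v : restr (actmod r)) = c *: (v : W).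
Proof.
have cE t : ((c *: 1 : kS) t : k) = c * (t == e)%:R by rewrite !ffunE.
rewrite restrZE /GRing.scale /= /actmod_scale (bigD1 e) //= big1 => [|t /negPf te].
  by rewrite cE eqxx mulr1 mact1 addr0.
by rewrite cE te mulr0 scale0r.
Qed.

End Instances.
End ActMod.
End MonoidAlgTheory.

(** * Bases, simple modules and Schur's lemma *)

Section Submodule.
Variables (R : pzRingType) (M : lmodType R) (X : {pred M}).

Definition submod_pred (hX : GRing.submod_closed X) : {pred M} := X.

Variable hX : GRing.submod_closed X.
HB.instance Definition _ :=
  GRing.isSubmodClosed.Build R M (submod_pred hX) hX.
Record submod := Submod {submod_val : M; _ : submod_val \in submod_pred hX}.
HB.instance Definition _ := [isSub for submod_val].
HB.instance Definition _ := [Choice of submod by <:].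
HB.instance Definition _ := [SubChoice_isSubLmodule of submod by <:].
End Submodule.

Section Bases.
Variables (k : fieldType) (W : lmodType k).

Definition is_basis d (b : 'I_d -> W) (c : 'I_d -> W -> k) :=
  [/\ forall j, scalar (c j), forall w, w = \sum_j c j w *: b j
    & forall j l, c j (b l) = (j == l)%:R].

(** A spanning family of minimal length is free: a relation with a nonzero coefficient at j would
    allow the j-th vector to be dropped. *)
Lemma spanned_basis (J : finType) (u : J -> W) :
    (forall w, exists a : J -> k, w = \sum_j a j *: u j) ->
  exists d (b : 'I_d -> W) c, is_basis b c.
Proof.
move=> uP.
pose sp d := `[< exists b : 'I_d -> W,
  forall w, exists a : 'I_d -> k, w = \sum_j a j *: b j >].
have exd : exists d, sp d.
  exists #|J|; apply/asboolP; exists (fun i => u (enum_val i)) => w.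
  have [a ->] := uP w; exists (fun i => a (enum_val i)).
  by rewrite (reindex (@enum_val J J)) //; exact: (onW_bij _ (@enum_val_bij J)).
case: (ex_minnP exd) => d /asboolP[b bP] dmin.
have free a : \sum_j a j *: b j = 0 -> forall j, a j = 0.
  move=> a0 j; apply/eqP/negPn/negP => aj.
  case: d b bP dmin a a0 j aj => [|d] b bP dmin a a0 j aj; first by case: j aj.
  suff : sp d by move=> /dmin; rewrite ltnn.
  apply/asboolP; exists (fun i => b (lift j i)) => w.
  have [a' ->] := bP w.
  exists (fun i => a' (lift j i) - a' j / a j * a (lift j i)).
  have -> : \sum_i a' i *: b i =
      \sum_i a' i *: b i - (a' j / a j) *: \sum_i a i *: b i.
    by rewrite a0 scaler0 subr0.
  rewrite scaler_sumr -sumrB (bigD1_ord j) //= scalerA divfK // subrr add0r.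
  by apply: eq_bigr => i _; rewrite scalerA scalerBl.
have /choice[a aP] := bP.
have uniq w a' : w = \sum_j a' j *: b j -> forall j, a w j = a' j.
  move=> wE j; apply/eqP; rewrite -subr_eq0; apply/eqP.
  apply: (free (fun j => a w j - a' j)).
  by under eq_bigr do rewrite scalerBl; rewrite sumrB -aP -wE subrr.
exists d, b, (fun j w => a w j); split => [j x w w'|w|j l].
- apply: (uniq _ (fun j => x * a w j + a w' j)).
  rewrite {1}[w]aP {1}[w']aP scaler_sumr -big_split.
  by apply: eq_bigr => i _; rewrite scalerDl scalerA.
- exact: aP.
- apply: (uniq _ (fun j => (j == l)%:R)); rewrite (bigD1 l) //= eqxx scale1r.
  by rewrite big1 ?addr0 // => i /negPf ->; rewrite scale0r.
Qed.

End Bases.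

Section SimpleModules.
Variables (k : fieldType) (A : algType k).
Implicit Types M N : lmodType A.

Lemma iso_refl M : module_isomorphic M M.
Proof. by exists idfun; exists idfun. Qed.

Lemma iso_sym M N : module_isomorphic M N -> module_isomorphic N M.
Proof.
case=> f [g fK gK]; have lg : linear g.
  by move=> a x y; apply: (can_inj fK); rewrite linearP !gK.
have [h hg] := linear_bundle lg; exists h; exists f => x; rewrite ?hg //.
Qed.

Lemma iso_trans M N P :
  module_isomorphic M N -> module_isomorphic N P -> module_isomorphic M P.
Proof. by move=> [f bf] [g bg]; exists (g \o f); exact: bij_comp bg bf. Qed.

Lemma simple_iso M N : module_isomorphic M N -> simple_module M -> simple_module N.
Proof.
case=> f [g fK gK] [[x x0] sM]; split.
  exists (f x); apply: contra_neq x0 => fx0.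
  by rewrite -(fK x) fx0 -(linear0 f) fK.
move=> X [X0 XP]; case: (sM [pred m | f m \in X]) => [|h|h].
- split=> [|a u v]; rewrite !inE /=; first by rewrite linear0.
  by move=> fu fv; rewrite linearP; exact: XP.
- left=> y yX; rewrite -(gK y) (h (g y)) ?linear0 // inE /= gK //.
- by right=> y; have := h (g y); rewrite inE /= gK.
Qed.

Lemma hom_iso M N (f : {linear M -> N}) x : simple_module M -> simple_module N ->
  f x != 0 -> bijective f.
Proof.
move=> [_ sM] [_ sN] fx.
have finj y : f y = 0 -> y = 0.
  move=> fy; case: (sM [pred m | f m == 0]) => [|h|h].
  - split=> [|a u v]; rewrite !inE /=; first by rewrite linear0.
    by move=> /eqP fu /eqP fv; rewrite linearP fu fv scaler0 addr0.
  - by apply: h; rewrite inE /= fy.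
  - by have := h x; rewrite inE /= (negPf fx).
have fsurj y : exists x, f x = y.
  case: (sN [pred n | `[< exists x, f x = n >]]) => [|h|h].
  - split=> [|a u v]; rewrite !inE /=; first by exists 0; rewrite linear0.
    by move=> [u' <-] [v' <-]; exists (a *: u' + v'); rewrite linearP.
  - by case/eqP: fx; apply: h; rewrite inE /=; exists x.
  - by have := h y; rewrite inE /=.
have /choice[g gK] := fsurj; exists g => // y.
by apply/eqP; rewrite -subr_eq0; apply/eqP/finj; rewrite linearB gK subrr.
Qed.

Lemma irr_simple (x : Irr A) M : sval x M -> simple_module M.
Proof. by case: x => C [N sN CE] /=; rewrite CE => NM; exact: simple_iso NM sN. Qed.

Lemma irr_iso (x : Irr A) M N : sval x M -> sval x N -> module_isomorphic M N.
Proof.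
by case: x => C [P sP CE] /=; rewrite CE => PM PN; apply: iso_trans PN; exact: iso_sym.
Qed.

Lemma irr_closed (x : Irr A) M N : sval x M -> module_isomorphic M N -> sval x N.
Proof. by case: x => C [P sP CE] /=; rewrite CE => PM MN; exact: iso_trans MN. Qed.

Lemma irr_ex (x : Irr A) : exists M, sval x M.
Proof. by case: x => C [P sP CE] /=; rewrite CE; exists P; exact: iso_refl. Qed.

Lemma irr_of M : simple_module M -> exists x : Irr A, sval x M.
Proof.
move=> sM; pose P := exist _ _ (ex_intro2 _ _ M sM erefl) : Irr A.
by exists P; exact: iso_refl.
Qed.

Lemma irr_eq (x y : Irr A) M : sval x M -> sval y M -> x = y.
Proof.
case: x y => C [P sP CE] [D [Q sQ DE]] /= CM DM; apply: eq_exist.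
rewrite CE in CM *; rewrite DE in DM *.
apply/funext => N; apply/propext; split => h.
  by apply: iso_trans DM _; apply: iso_trans h; exact: iso_sym.
by apply: iso_trans CM _; apply: iso_trans h; exact: iso_sym.
Qed.

Lemma simple_cyclic M (v w : M) : simple_module M -> v != 0 -> exists a : A, w = a *: v.
Proof.
move=> [_ sM] v0; case: (sM [pred u | `[< exists a : A, u = a *: v >]]) => [|h|h].
- split=> [|a x y]; rewrite !inE /=; first by exists 0; rewrite scale0r.
  by move=> [b ->] [c ->]; exists (a * b + c); rewrite scalerDl scalerA.
- by case/eqP: v0; apply: h; rewrite inE /=; exists 1; rewrite scale1r.
- by have := h w; rewrite inE /=.
Qed.

End SimpleModules.

Section SimpleMonoidModules.
Variables (k : fieldType) (S : finType) (e : S) (op : Monoid.law e).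
Local Notation kS := (malg k op).

Lemma ma_submod (M : lmodType kS) (X : {pred M}) :
    (0 : M) \in X ->
    (forall c (x y : restr M), x \in X -> y \in X -> c *: x + y \in X) ->
    (forall s x, x \in X -> (ma_elt k s : kS) *: x \in X) ->
  GRing.submod_closed X.
Proof.
move=> X0 XD XS; split=> // a x y xX yX.
rewrite (ma_act_sum a x : a *: x = _ :> M).
elim: (index_enum S) => [|s r IHr]; first by rewrite big_nil add0r.
by rewrite big_cons -addrA; apply: XD => //; exact: XS.
Qed.

(** A nonzero v generates the module, so the finitely many s v span it over k. *)
Lemma simple_fd (M : lmodType kS) : simple_module M ->
  exists d (b : 'I_d -> restr M) c, is_basis b c.
Proof.
move=> sM; have [[v v0] _] := sM.
apply: (spanned_basis (u := fun s => (ma_elt k s : kS) *: v : restr M)) => w.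
have [a ->] := simple_cyclic (w : M) sM v0.
by exists a; exact: ma_act_sum.
Qed.

End SimpleMonoidModules.

Lemma is_basis_lin (k : fieldType) (W : lmodType k) d (b : 'I_d -> W) c :
  is_basis b c -> exists c' : 'I_d -> {scalar W}, forall j w, c' j w = c j w.
Proof.
case=> lc _ _; suff /choice[c' c'E] : forall j, exists f : {scalar W}, forall w, f w = c j w.
  by exists c'.
move=> j; pose g := GRing.isLinear.Build k W k _ (c j) (lc j).
pose f : {scalar W} := HB.pack (c j) g.
by exists f.
Qed.

(* Burnside's theorem, in the form of matrix units. *)
Lemma simple_matrix_units (k : closedFieldType) (G : finGroupType)
    (M : lmodType (group_alg k G)) d (b : 'I_d -> restr M) c :
    simple_module M -> is_basis b c ->
  exists E : 'I_d -> 'I_d -> group_alg k G,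
    forall i j l, E i j *: (b l : M) = if j == l then b i else 0.
Proof.
move=> sM bc; have [c' cE] := is_basis_lin bc; have [_ bE cb] := bc.
(* MathComp representations act on the right of row vectors, whence the inverse. *)
pose R (h : G) : 'M[k]_d := \matrix_(i, j) c j (group_elt k h^-1%g *: (b i : M)).
pose toM (v : 'rV[k]_d) : restr M := \sum_i v 0 i *: b i.
pose co (w : restr M) : 'rV[k]_d := \row_j c j w.
have coK w : toM (co w) = w.
  by rewrite [RHS]bE; apply: eq_bigr => i _; rewrite mxE.
have co_lin a w w' : co (a *: w + w') = a *: co w + co w'.
  by apply/rowP => j; rewrite !mxE -!cE linearP.
have toMK v : co (toM v) = v.
  apply/rowP => j; rewrite mxE -cE linear_sum (bigD1 j) //= big1 => [|i /negPf ij].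
    by rewrite linearZ /= cE cb eqxx addr0 mulr1.
  by rewrite linearZ /= cE cb eq_sym ij mulr0.
have coR h w : co (group_elt k h^-1%g *: (w : M)) = co w *m R h.
  apply/rowP => j; rewrite !mxE {1}[w]bE -cE.
  have /linear_bundle[f fE] := @act_linear k _ M (group_elt k h^-1%g).
  rewrite -fE !linear_sum /=; apply: eq_bigr => i _.
  by rewrite !linearZ /= fE !mxE cE.
have reprR : mx_repr [set: G] R.
  split=> [|g h _ _]; apply/row_matrixP => i.
    rewrite row1 rowE -(toMK (delta_mx 0 i)) -coR invg1; congr co.
    exact: ma_elt1_act.
  rewrite !rowE -(toMK (delta_mx 0 i)) mulmxA -!coR; congr co.
  by rewrite invMg /group_elt ma_elt_act.
pose rG := MxRepresentation reprR.
have irrG : mx_irreducible rG.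
  have [[v v0] sM'] := sM.
  apply/mx_irrP; split.
    rewrite lt0n; apply: contraNneq v0 => d0.
    rewrite -(coK v) /toM big1 // => i _.
    by have := ltn_ord i; rewrite {2}d0.
  move=> U mU U0.
  case: (sM' [pred w | (co w <= U)%MS]) => [|h|h].
  - apply: ma_submod => [|a x y|s x]; rewrite !inE /=.
    + have -> : co 0 = 0 by rewrite -(addr0 0) -{1}(scaler0 _ 0) co_lin scale0r add0r;
      apply/rowP => j; rewrite !mxE -cE linear0.
      exact: sub0mx.
    + by move=> xU yU; rewrite co_lin addmx_sub ?scalemx_sub.
    + move=> xU; rewrite (_ : co _ = co x *m R s^-1%g); last by rewrite -coR invgK.
      by apply: submx_trans (submxMr _ xU) _; have /mxmoduleP/(_ s^-1%g) := mU; apply;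
        rewrite inE.
  - case/negP: U0; apply/eqP/row_matrixP => i; rewrite row0 -(toMK (row i U)).
    rewrite (h (toM (row i U))) ?inE /= ?toMK ?row_sub //.
    by apply/rowP => j; rewrite !mxE -cE linear0.
  - rewrite -sub1mx; apply/row_subP => i; rewrite -(toMK (row i _)).
    by have := h (toM (row i 1%:M)); rewrite inE.
(* Over an algebraically closed field irreducibility is absolute, so the [rG x] span all square
   matrices, with coefficients [a x]. The indices of [delta_mx j i] are swapped because matrices act
   on rows. *)
have /mx_abs_irrP[_ [a aP]] := group_closure_closed_field irrG.
exists (fun i j => \sum_x a x (delta_mx j i) *: group_elt k x^-1%g) => i j l.
rewrite scaler_suml.
have -> : \sum_x (a x (delta_mx j i) *: group_elt k x^-1%g) *: (b l : M) =
    toM (row l (\sum_(x in [set: G]) a x (delta_mx j i) *: rG x)).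
  rewrite linear_sum /= /toM.
  under [RHS]eq_bigr => m _ do rewrite summxE scaler_suml.
  rewrite exchange_big /=; apply: eq_big => [x|x _]; first by rewrite inE.
  rewrite -restrZA [X in _ *: X]bE scaler_sumr; apply: eq_bigr => m _.
  by rewrite !mxE scalerA.
rewrite -aP /toM; case: eqP => [->|/eqP/negPf jl].
  rewrite (bigD1 i) //= big1 ?addr0 => [|m /negPf mi]; rewrite !mxE !eqxx ?scale1r //.
  by rewrite mi scale0r.
by rewrite big1 // => m _; rewrite !mxE eq_sym jl scale0r.
Qed.

Lemma card_neq0 (k : fieldType) (G : finGroupType) :
  (forall p : nat, p \in [pchar k] -> ~~ (p %| #|G|)%N) -> (#|G|%:R : k) != 0.
Proof.
move=> hk; apply/negP => G0.
have [|p pc] := natf0_pchar _ G0; first by apply/card_gt0P; exists 1%g.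
by case/negP: (hk p pc); rewrite (dvdn_pcharf pc).
Qed.

(** * Tensor products *)

Section DfWith.
Variables (I : eqType) (V : I -> Type).
Implicit Types v : forall i, V i.

Lemma dfwith_id v i : dfwith v (v i) = v.
Proof.
apply: functional_extensionality_dep => j; case: (eqVneq i j) => [<-|ij].
  by rewrite dfwith_in.
by rewrite dfwith_out.
Qed.

Lemma dfwith_comm v i j (x : V i) (y : V j) : i != j ->
  dfwith (dfwith v x) y = dfwith (dfwith v y) x.
Proof.
move=> ij; apply: functional_extensionality_dep => l.
case: (eqVneq j l) => [<-|jl].
  by rewrite dfwith_in dfwith_out // dfwith_in.
rewrite [LHS]dfwith_out //; case: (eqVneq i l) => [<-|il].
  by rewrite !dfwith_in.
by rewrite !dfwith_out.
Qed.

Lemma dfwith_map (U : I -> Type) (f : forall i, V i -> U i) v i (x : V i) :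
  (fun j => f j (dfwith v x j)) = dfwith (fun j => f j (v j)) (f i x).
Proof.
apply: functional_extensionality_dep => j; case: (eqVneq i j) => [<-|ij].
  by rewrite !dfwith_in.
by rewrite !dfwith_out.
Qed.

End DfWith.

Section Multilinear.
Variables (k : fieldType) (I : finType).
Implicit Types (V : I -> lmodType k) (Z : lmodType k).

(** Spanning, stated as the induction principle in which it is used. *)
Definition spans (W : lmodType k) (S : W -> Prop) := forall X : W -> Prop,
  X 0 -> (forall a x y, S x -> X y -> X (a *: x + y)) -> forall w, X w.

Lemma spans_sum (W : lmodType k) (J : finType) (u : J -> W) (c : J -> W -> k) :
  (forall w, w = \sum_j c j w *: u j) -> spans (fun w => exists j, w = u j).
Proof.
move=> cE X X0 XD w; rewrite [w]cE; elim: (index_enum J) => [|j r IHr].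
  by rewrite big_nil.
by rewrite big_cons; apply: XD => //; exists j.
Qed.

Lemma multilinear0 V Z (tau : (forall i, V i) -> Z) v i :
  multilinear tau -> tau (dfwith v (0 : V i)) = 0.
Proof.
move=> ml; have := ml v i 1 0 0; rewrite scaler0 addr0 scale1r => /eqP.
by rewrite -subr_eq0 opprD addNKr oppr_eq0 => /eqP.
Qed.

Lemma multilinear_lin V Z (tau : (forall i, V i) -> Z) v i :
  multilinear tau -> linear (fun x : V i => tau (dfwith v x)).
Proof. by move=> ml a x y; rewrite ml. Qed.

Lemma multilinear_eq0 V Z (tau : (forall i, V i) -> Z) v i :
  multilinear tau -> v i = 0 -> tau v = 0.
Proof. by move=> ml vi; rewrite -(dfwith_id v i) vi multilinear0. Qed.

(** The slots are released one at a time: outside the list r the components still lie in the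
    spanning sets, inside it they are arbitrary. *)
Lemma multilinear_ext V Z (tau tau' : (forall i, V i) -> Z)
    (S : forall i, V i -> Prop) : (forall i, spans (S i)) ->
    multilinear tau -> multilinear tau' ->
    (forall v, (forall i, S i (v i)) -> tau v = tau' v) ->
  forall v, tau v = tau' v.
Proof.
move=> spS ml ml' eqS v.
suff IH (r : seq I) : forall w, (forall i, i \notin r -> S i (w i)) -> tau w = tau' w.
  by apply: (IH (enum I)) => i; rewrite mem_enum.
elim: r => [|i r IHr] w wS; first by apply: eqS => i; exact: wS.
rewrite -(dfwith_id w i); move: (w i) => x; move: x.
apply: (spS i) => [|a x y Sx IHy]; first by rewrite !multilinear0.
rewrite ml ml' IHy IHr // => j jr; case: (eqVneq i j) => [ij|ij].
  by subst j; rewrite dfwith_in.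
by rewrite dfwith_out //; apply: wS; rewrite inE eq_sym (negPf ij).
Qed.

Lemma multilinear_comp V Z Z' (tau : (forall i, V i) -> Z) (f : Z -> Z') :
  linear f -> multilinear tau -> multilinear (f \o tau).
Proof. by move=> lf ml v i a x y; rewrite /= ml lf. Qed.

Lemma multilinear_pre V V' Z (tau : (forall i, V' i) -> Z)
    (f : forall i, V i -> V' i) :
  (forall i, linear (f i)) -> multilinear tau ->
  multilinear (fun v => tau (fun i => f i (v i))).
Proof.
by move=> lf ml v i a x y; rewrite !(dfwith_map f) lf ml.
Qed.

Lemma prod_dfwith V (f : forall i, V i -> k) (P : pred I) v i (x : V i) : P i ->
  \prod_(j | P j) f j (dfwith v x j) = f i x * \prod_(j | P j && (j != i)) f j (v j).
Proof.
move=> Pi; rewrite (bigD1 i) //= dfwith_in; congr (_ * _).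
by apply: eq_bigr => j /andP[_ ji]; rewrite dfwith_out 1?eq_sym.
Qed.

Lemma multilinear_prod V (f : forall i, V i -> k) :
  (forall i, scalar (f i)) -> multilinear (fun v => \prod_i f i (v i) : k^o).
Proof.
move=> lf v i a x y.
by rewrite !(prod_dfwith f (P := xpredT)) // lf mulrDl -[RHS]/(_ * _ + _) mulrA.
Qed.

(** Lifted to the tensor product, this contracts every slot but [i0] against the functionals f; it
    serves to project a tensor product onto one factor. *)
Lemma multilinear_contract V (i0 : I) (f : forall i, V i -> k) :
  (forall i, scalar (f i)) ->
  multilinear (fun v => (\prod_(i | i != i0) f i (v i)) *: v i0).
Proof.
move=> lf v i a x y; case: (eqVneq i i0) => [ii0|ii0].
  subst i0; rewrite !dfwith_in.
  have out (z : V i) : \prod_(j | j != i) f j (dfwith v z j) = \prod_(j | j != i) f j (v j).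
    by apply: eq_bigr => j ji; rewrite dfwith_out // eq_sym.
  by rewrite !out scalerDr !scalerA mulrC.
rewrite ![dfwith _ _ i0]dfwith_out // !(prod_dfwith f (P := fun j => j != i0)) //.
by rewrite lf mulrDl scalerDl scalerA mulrA.
Qed.

Section TensorTheory.
Variables (V : I -> lmodType k) (T : lmodType k) (tau : (forall i, V i) -> T).
Hypothesis tT : is_tensor tau.

Lemma tensor_lift Z (beta : (forall i, V i) -> Z) : multilinear beta ->
  exists h : {linear T -> Z}, forall v, h (tau v) = beta v.
Proof. by case: tT => _ /(_ Z beta) h /h[]. Qed.

Lemma tensor_ext Z (h h' : {linear T -> Z}) :
  (forall v, h (tau v) = h' (tau v)) -> forall t, h t = h' t.
Proof.
case: tT => ml /(_ Z (h' \o tau)) H hh'.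
have [|_] := H; last by apply.
by apply: multilinear_comp => //; exact: linearP.
Qed.

Lemma tensor_extf Z (h h' : T -> Z) : linear h -> linear h' ->
  (forall v, h (tau v) = h' (tau v)) -> forall t, h t = h' t.
Proof.
move=> /linear_bundle[f fE] /linear_bundle[f' fE'] hh' t; rewrite -fE -fE'.
by apply: tensor_ext => v; rewrite fE fE'.
Qed.

Lemma is_tensor_iso Z (f : {linear T -> Z}) : bijective f -> is_tensor (f \o tau).
Proof.
case=> g fK gK; case: tT => ml _.
have /linear_bundle[g' gE] : linear g.
  by move=> a x y; apply: (can_inj fK); rewrite linearP !gK.
split; first by apply: multilinear_comp => //; exact: linearP.
move=> Z' beta mb; split=> [|h h' hb hb' t].
  have [h hE] := tensor_lift mb; exists (h \o g') => v.
  by rewrite /= gE fK hE.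
rewrite -(gK t); have := @tensor_ext _ (h \o f) (h' \o f); apply => v /=.
by rewrite hb hb'.
Qed.

Variables (d : I -> nat) (b : forall i, 'I_(d i) -> V i) (c : forall i, 'I_(d i) -> V i -> k).
Hypothesis bc : forall i, is_basis (@b i) (@c i).

Lemma basis_prod (x y : {dffun forall i, 'I_(d i)}) :
  \prod_i c (x i) (b (y i)) = (x == y)%:R.
Proof.
case: eqP => [->|xy]; first by rewrite big1 // => i _; case: (bc i) => _ _ ->; rewrite eqxx.
have [i xyi] : exists i, x i != y i.
  apply/existsP; rewrite -negb_forall; apply/forallP => h; apply: xy.
  by apply/ffunP => i; exact/eqP.
by rewrite (bigD1 i) //=; case: (bc i) => _ _ ->; rewrite (negPf xyi) mul0r.
Qed.

(** A product of coordinate functionals is multilinear, hence factors through T; the functionals so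
    obtained are dual to the tensors of basis vectors. *)
Lemma tensor_coords :
  exists2 g : {dffun forall i, 'I_(d i)} -> {linear T -> k^o},
    forall x v, g x (tau v) = \prod_i c (x i) (v i)
  & forall t, t = \sum_x g x t *: tau (fun i => b (x i)).
Proof.
have /choice[g gE] : forall x : {dffun forall i, 'I_(d i)}, exists h : {linear T -> k^o},
    forall v, h (tau v) = \prod_i c (x i) (v i).
  move=> x; apply: tensor_lift; apply: (multilinear_prod (f := fun i => c (x i))) => i.
  by case: (bc i) => + _ _; apply.
exists g => //; apply: (@tensor_extf _ idfun) => [|a t u|v].
- exact: linearP.
- rewrite scaler_sumr -big_split; apply: eq_bigr => x _ /=.
  by rewrite linearP scalerDl scalerA.
have ml := tT.1; under eq_bigr do rewrite gE.
move: v; apply: (multilinear_ext (S := fun i w => exists j, w = b j)) => //.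
- by move=> i; apply: (spans_sum (c := @c i)); case: (bc i).
- move=> v i a x y; rewrite scaler_sumr -big_split; apply: eq_bigr => z _ /=.
  rewrite scalerA -scalerDl; congr (_ *: _).
  by apply: (multilinear_prod (f := fun i => c (z i))) => j; case: (bc j) => + _ _; apply.
- move=> v /fin_all_exists[x0 vE]; pose x : {dffun forall i, 'I_(d i)} := [ffun i => x0 i].
  have -> : v = fun i => b (x i).
    by apply: functional_extensionality_dep => i; rewrite ffunE.
  rewrite (bigD1 x) //= basis_prod eqxx scale1r big1 ?addr0 // => y yx.
  by rewrite basis_prod (negPf yx) scale0r.
Qed.

End TensorTheory.

(** The model is the space of functions on multi-indices, whence the bases of the factors. *)
Lemma tensor_exists (V : I -> lmodType k) (d : I -> nat)
    (b : forall i, 'I_(d i) -> V i) (c : forall i, 'I_(d i) -> V i -> k) :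
    (forall i, is_basis (@b i) (@c i)) ->
  exists (T : lmodType k) (tau : (forall i, V i) -> T), is_tensor tau.
Proof.
move=> bc; pose Ix := {dffun forall i, 'I_(d i)}.
exists {ffun Ix -> k^o}, (fun v => [ffun x : Ix => \prod_i c i (x i) (v i)]).
have ml : multilinear (fun v => [ffun x : Ix => \prod_i c i (x i) (v i)] : {ffun Ix -> k^o}).
  move=> v i a x y; apply/ffunP => z; rewrite !ffunE.
  apply: (multilinear_prod (f := fun i => c i (z i))) => j.
  by case: (bc j) => + _ _; apply.
have tauE (y : Ix) : [ffun x : Ix => \prod_i c i (x i) (b i (y i))] =
    [ffun x => (x == y)%:R] :> {ffun Ix -> k^o}.
  by apply/ffunP => x; rewrite !ffunE (basis_prod bc).
have expand (t : {ffun Ix -> k^o}) :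
    t = \sum_y (t y : k) *: ([ffun x : Ix => \prod_i c i (x i) (b i (y i))] : {ffun Ix -> k^o}).
  apply/ffunP => x; rewrite sum_ffunE (bigD1 x) //= big1 => [|y /negPf xy].
    by rewrite tauE !ffunE eqxx addr0 [_ *: _]mulr1.
  by rewrite tauE !ffunE eq_sym xy [_ *: _]mulr0.
split=> // Z beta mb; split=> [|h h' hb hb' t]; last first.
  by rewrite [t]expand !linear_sum; apply: eq_bigr => y _; rewrite !linearZ /= hb hb'.
have /linear_bundle[h hE] : linear (fun t : {ffun Ix -> k^o} =>
    \sum_y (t y : k) *: beta (fun i => b i (y i))).
  move=> a t u; rewrite scaler_sumr -big_split; apply: eq_bigr => y _ /=.
  by rewrite !ffunE scalerDl scalerA.
exists h.
apply: (multilinear_ext (S := fun i w => exists j, w = b i j)) => //.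
- by move=> i; apply: (spans_sum (c := @c i)); case: (bc i).
- by move=> v i a x y; rewrite ml linearP.
- move=> v /fin_all_exists[x0 vE]; pose x : Ix := [ffun i => x0 i].
  have -> : v = fun i => b i (x i).
    by apply: functional_extensionality_dep => i; rewrite ffunE.
  rewrite tauE hE (bigD1 x) //= ffunE eqxx scale1r big1 ?addr0 // => y yx.
  by rewrite ffunE (negPf yx) scale0r.
Qed.

End Multilinear.

(** * Tensor products of group modules *)

Section TensorModules.
Variables (k : fieldType) (I : finType) (G H : finGroupType) (pr : I -> H -> G).
Implicit Types (V : I -> lmodType (group_alg k G)) (T : lmodType (group_alg k H)).
Local Notation rV V := (fun i => restr (V i) : lmodType k).

Lemma multilinear_act V (Z : lmodType k) (tau : (forall i, rV V i) -> Z)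
    (a : I -> group_alg k G) :
  multilinear tau -> multilinear (fun v : forall i, rV V i => tau (fun i => a i *: (v i :
    V i))).
Proof.
by apply: (multilinear_pre (f := fun i (w : rV V i) => a i *: (w : V i) : rV V i)) => i;
  exact: act_linear.
Qed.

Lemma tensor_module_ex V (d : I -> nat) (b : forall i, 'I_(d i) -> rV V i) c :
    (forall i, pr i 1%g = 1%g) -> (forall i g h, pr i (g * h)%g = (pr i g * pr i h)%g) ->
    (forall i, is_basis (@b i) (@c i)) ->
  exists T, is_tensor_module pr V T.
Proof.
move=> pr1 prM bc; have [W [tau tW]] := tensor_exists bc.
have ml := tW.1.
have /choice[r rE] : forall h : H, exists r : {linear W -> W},
    forall v, r (tau v) = tau (fun i => group_elt k (pr i h) *: (v i : V i)).
  by move=> h; apply: (tensor_lift tW); exact: multilinear_act.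
have rl h : linear (r h) by exact: linearP.
have r1 w : r 1%g w = w.
  apply: (tensor_extf tW (h' := idfun)) => // v; rewrite rE; congr (tau _).
  by apply: functional_extensionality_dep => i; rewrite pr1; exact: ma_elt1_act.
have rM g h w : r (g * h)%g w = r g (r h w).
  apply: (tensor_ext tW (h' := r g \o r h)) => v /=; rewrite !rE; congr (tau _).
  apply: functional_extensionality_dep => i; rewrite prM.
  by rewrite /group_elt -[in LHS]ma_elt_act.
pose act := @MAction k H 1%g (@mulg H) W (fun h => r h) rl r1 rM.
pose T : lmodType (group_alg k H) := actmod act.
have /linear_bundle[f fE] : linear ((fun w => w) : W -> restr T).
  by move=> a x y; rewrite actmod_restrZ.
exists T, (f \o tau); split.
  by apply: is_tensor_iso => //; exists (fun w => w) => w; rewrite fE.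
by move=> h v; rewrite /= !fE; rewrite [LHS]actmod_elt /=.
Qed.

Lemma tensor_module_isol V V' T : (forall i, module_isomorphic (V i) (V' i)) ->
  is_tensor_module pr V T -> is_tensor_module pr V' T.
Proof.
move=> VV' [tau [tT tE]].
have /fin_all_exists[f fb] : forall i, exists f : {linear V' i -> V i}, bijective f.
  by move=> i; apply: iso_sym.
have /fin_all_exists[g fgK] : forall i, exists g : {linear V i ->
  V' i}, cancel (f i) g /\ cancel g (f i).
  move=> i; have [g fK gK] := fb i.
  have /linear_bundle[g' gE] : linear g by move=> a x y; apply: (can_inj fK);
    rewrite linearP !gK.
  by exists g'; split=> x; rewrite gE.
exists (fun v => tau (fun i => f i (v i))); split; last first.
  move=> h v; rewrite tE; congr (tau _).
  by apply: functional_extensionality_dep => i; rewrite linearZ.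
split.
  apply: (multilinear_pre (f := fun i => f i : rV V' i -> rV V i)) tT.1 => i.
  exact: restr_linear.
move=> Z beta mb; split=> [|h h' hb hb' t].
  have mb' : multilinear (fun v : forall i, rV V i => beta (fun i => g i (v i))).
    by apply: (multilinear_pre (f := fun i => g i : rV V i -> rV V' i)) => // i;
      exact: restr_linear.
  have [h hE] := tensor_lift tT mb'; exists h => v; rewrite hE; congr (beta _).
  by apply: functional_extensionality_dep => i; case: (fgK i).
apply: (tensor_ext tT) => v.
have -> : v = fun i => f i (g i (v i)).
  by apply: functional_extensionality_dep => i; case: (fgK i).
by rewrite hb hb'.
Qed.

Lemma tensor_module_hom V T T' (tau : (forall i, rV V i) -> restr T)
    (beta : (forall i, rV V i) -> restr T') :
    is_tensor tau -> (forall (h : H) v, group_elt k h *: (tau v :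
      T) = tau (fun i => group_elt k (pr i h) *: (v i : V i))) ->
    multilinear beta -> (forall (h : H) v, group_elt k h *: (beta v :
      T') = beta (fun i => group_elt k (pr i h) *: (v i : V i))) ->
  exists f : {linear T -> T'}, forall v, f (tau v) = beta v.
Proof.
move=> tT tE mb bE; have [f fE] := tensor_lift tT mb.
have /linear_bundle[g gE] : linear (f : T -> T').
  apply: ma_linear => [|s v]; first exact: linearP.
  have /linear_bundle[l lE] := @act_linear k _ T (group_elt k s).
  have /linear_bundle[l' lE'] := @act_linear k _ T' (group_elt k s).
  rewrite -[LHS]/(f (group_elt k s *: v)) -lE.
  rewrite -[RHS]/(group_elt k s *: f v) -lE'; apply: (tensor_ext tT (h := f \o l) (h' :=
    l' \o f)) => w /=.
  by rewrite lE lE' tE !fE bE.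
by exists g => v; rewrite gE fE.
Qed.

Lemma tensor_module_unique V T T' :
  is_tensor_module pr V T -> is_tensor_module pr V T' -> module_isomorphic T T'.
Proof.
move=> [tau [tT tE]] [tau' [tT' tE']].
have [f fE] := tensor_module_hom tT tE tT'.1 tE'.
have [g gE] := tensor_module_hom tT' tE' tT.1 tE.
exists f; exists g.
  apply: (tensor_extf tT (h := g \o f : restr T -> restr T) (h' := idfun)) => // [|v].
    exact: (restr_linear (g \o f)).
  by rewrite /= fE gE.
apply: (tensor_extf tT' (h := f \o g : restr T' -> restr T') (h' := idfun)) => // [|v].
  exact: (restr_linear (f \o g)).
by rewrite /= gE fE.
Qed.

Lemma tensor_module_isor V T T' : module_isomorphic T T' ->
  is_tensor_module pr V T -> is_tensor_module pr V T'.
Proof.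
move=> [f fb] [tau [tT tE]].
have /linear_bundle[f' fE] := restr_linear f.
exists (f' \o tau); split.
  by apply: is_tensor_iso => //; case: fb => g fK gK; exists g => x; rewrite fE.
by move=> h v; rewrite /= !fE -tE linearZ.
Qed.

End TensorModules.

Lemma group_elt_mulE (k : fieldType) (G : finGroupType) (g : G)
    (f : group_alg k G) (s : G) :
  (group_elt k g * f) s = f (g^-1 * s)%g.
Proof.
rewrite -[group_elt k g * f]/(ma_mul _ _) ma_mulE (bigD1 g) //= (bigD1 (g^-1 * s)%g) //=.
rewrite ffunE eqxx mul1r mulKVg eqxx mulr1 big1 => [|h hs]; last first.
  case: eqP => [ghs|]; last by rewrite mulr0.
  by rewrite -ghs mulKg eqxx in hs.
rewrite addr0 big1 ?addr0 // => h /negPf hg; rewrite big1 // => h' _.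
by rewrite ffunE hg !mul0r.
Qed.

(** * Elementary tensors in the group algebra of a power of G *)

Section PureTensors.
Variables (k : fieldType) (I : finType) (G : finGroupType).
Local Notation H := {dffun forall _ : I, G}.
Local Notation kG := (group_alg k G).
Local Notation kH := (group_alg k H).

(** The image of the tensor of the [a i] under the identification of a tensor power of kG with
    k[G^I]. It lets elements of kG, matrix units in particular, act in all slots at once. *)
Definition pure_tensor (a : I -> kG) : kH := [ffun h : H => \prod_i (a i (h i) : k)].

Lemma kG_spans : @spans k kG (fun a => exists g, a = group_elt k g).
Proof. exact: (spans_sum (c := fun g (a : kG) => a g : k) (@ma_sum _ _ _ _)). Qed.

Lemma pure_tensor_multilinear :
  @multilinear k I (fun=> (kG : lmodType k)) (kH : lmodType k) pure_tensor.
Proof.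
move=> v i a x y; apply/ffunP => h; rewrite !ffunE.
apply: (@multilinear_prod k I (fun=> (kG : lmodType k)) (fun i b => b (h i))) => j c u w.
by rewrite !ffunE.
Qed.

Lemma pure_tensor_elt (g : I -> G) :
  pure_tensor (fun i => group_elt k (g i)) = group_elt k ([ffun i => g i] : H).
Proof.
apply/ffunP => h; rewrite !ffunE; case: eqP => [->|hg].
  by rewrite big1 // => i _; rewrite !ffunE eqxx.
have [i hgi] : exists i, h i != g i.
  apply/existsP; rewrite -negb_forall; apply/forallP => hgi; apply: hg.
  by apply/ffunP => i; rewrite ffunE; exact/eqP.
by rewrite (bigD1 i) //= !ffunE (negPf hgi) mul0r.
Qed.

Lemma group_elt_pure_tensor (h : H) (a : I -> kG) :
  group_elt k h * pure_tensor a = pure_tensor (fun i => group_elt k (h i) * a i).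
Proof.
apply/ffunP => s; rewrite group_elt_mulE !ffunE.
by apply: eq_bigr => i _; rewrite group_elt_mulE !ffunE.
Qed.

Lemma pure_tensor_act (V : I -> lmodType kG) (T : lmodType kH)
    (tau : (forall i, restr (V i) : lmodType k) -> restr T) (a : I -> kG)
    (v : forall i, V i) :
    multilinear tau ->
    (forall (h : H) v, group_elt k h *: (tau v :
      T) = tau (fun i => group_elt k (h i) *: (v i : V i))) ->
  pure_tensor a *: (tau v : T) = tau (fun i => a i *: v i).
Proof.
move=> ml tE; pose U := fun _ : I => (kG : lmodType k).
apply: (@multilinear_ext k I U (restr T) (fun a : forall i, U i => pure_tensor a *: (tau v : T))
  (fun a : forall i, U i => tau (fun i => (a i :
    kG) *: v i)) (fun _ a => exists g, a = group_elt k g)).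
- by move=> i; exact: kG_spans.
- move=> w i c x y; rewrite pure_tensor_multilinear scalerDl.
  by rewrite -restrZA.
- apply: (@multilinear_pre k I U (fun i => restr (V i) : lmodType k) _ tau (fun i (b :
  kG) => b *: v i)) => //.
  by move=> i c x y; rewrite scalerDl -restrZA.
move=> w /fin_all_exists[g wE]; have -> : w = fun i => group_elt k (g i).
  exact: functional_extensionality_dep.
rewrite pure_tensor_elt tE; congr (tau _).
by apply: functional_extensionality_dep => i; rewrite ffunE.
Qed.

Definition single (i : I) (g : G) : H := [ffun j => if i == j then g else 1%g].

Lemma single1 i : single i 1%g = 1%g.
Proof. by apply/ffunP => j; rewrite !ffunE; case: eqP. Qed.

Lemma singleM i g h : single i (g * h)%g = (single i g * single i h)%g.
Proof. by apply/ffunP => j; rewrite !ffunE; case: eqP; rewrite ?mulg1. Qed.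

Lemma singleC i j g h : i != j ->
  (single i g * single j h = single j h * single i g)%g.
Proof.
move=> ij; apply/ffunP => l; rewrite !ffunE.
by case: (eqVneq i l) => [<-|_]; rewrite ?(negPf ij) 1?eq_sym ?(negPf ij) ?mulg1 ?mul1g.
Qed.

(** The restriction of T along the i-th embedding of G into G^I. *)
Definition factor_action (T : lmodType kH) (i : I) : maction (@mulg G) (restr T).
Proof.
apply: (@MAction k G 1%g (@mulg G) (restr T) (fun g t => group_elt k (single i g) *: (t : T))).
- by move=> g; exact: act_linear.
- by move=> t; rewrite single1; exact: ma_elt1_act.
- by move=> g h t; rewrite singleM; symmetry; exact: ma_elt_act.
Defined.

Definition factor_module (T : lmodType kH) (i : I) : lmodType kG := actmod (factor_action T i).

Lemma factorE (T : lmodType kH) i g (t : factor_module T i) :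
  group_elt k g *: t = group_elt k (single i g) *: (t : T).
Proof. exact: actmod_elt. Qed.

Lemma factorZ (T : lmodType kH) i (c : k) (t : restr (factor_module T i)) :
  c *: t = c *: (t : restr T).
Proof. exact: actmod_restrZ. Qed.

Lemma factor_act_linear (T : lmodType kH) i (a : kG) :
  linear ((fun t : restr T => a *: (t : factor_module T i)) : restr T -> restr T).
Proof.
by move=> c x y; have := act_linear (M := factor_module T i) a c x y; rewrite !factorZ.
Qed.

Lemma factorC (T : lmodType kH) i j (a b : kG) (t : T) : i != j ->
  a *: (b *: (t : factor_module T j) : factor_module T i) = b *: (a *: (t :
    factor_module T i) : factor_module T j).
Proof.
move=> ij.
have com1 g (c : kG) (u : T) : c *: (group_elt k (single i g) *: u : factor_module T j) =
    group_elt k (single i g) *: (c *: (u : factor_module T j) : T).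
  have /linear_bundle[f fE] : linear ((fun u => group_elt k (single i g) *: (u : T))
      : factor_module T j -> factor_module T j).
    apply: (ma_linear (M := factor_module T j) (N := factor_module T j)) => [c' x y|h x].
      by rewrite !factorZ; exact: (@act_linear k _ T _ c' x y).
    rewrite -[ma_elt k h]/(group_elt k h) !factorE /group_elt !ma_elt_act.
    exact: (congr1 (fun s => (ma_elt k s : kH) *: (x : T)) (singleC g h ij)).
  by rewrite -!fE linearZ.
have /linear_bundle[f fE] : linear ((fun u : factor_module T i => b *: (u : factor_module T j))
      : factor_module T i -> factor_module T i).
  apply: (ma_linear (M := factor_module T i) (N := factor_module T i)) => [c' x y|h x].
    by rewrite !factorZ; exact: (@factor_act_linear T j b c' x y).
  by rewrite -[ma_elt k h]/(group_elt k h) !factorE com1.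
by rewrite -!fE linearZ.
Qed.

Local Notation upd a i x := (@eqtype.dfwith I (fun=> kG : Type) a i x).

(** Splitting off slot i shows that the left side depends on x only through its effect on t in the
    i-th action. Both sides are linear in x, so x may be taken in G. *)
Lemma pure_tensor_factor (T : lmodType kH) (i : I) (a : I -> kG) (x : kG) (t : T) :
  pure_tensor (upd a i x) *: t =
  pure_tensor (upd a i (group_elt k 1%g)) *: (x *: (t : factor_module T i) : T).
Proof.
have /linear_bundle[f fE] := @act_linear k _ T (pure_tensor (upd a i (group_elt k 1%g : kG))).
rewrite -[RHS]fE; move: x.
apply: kG_spans => [|c _ y [g ->] IH].
  have -> : pure_tensor (upd a i (0 : kG)) = 0.
    exact: (@multilinear0 k I (fun=> kG : lmodType k) (kH :
      lmodType k) _ a i pure_tensor_multilinear).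
  by rewrite !scale0r linear0.
have -> : pure_tensor (upd a i (c *: group_elt k g + y)) =
    c *: pure_tensor (upd a i (group_elt k g)) + pure_tensor (upd a i y).
  exact: pure_tensor_multilinear.
rewrite !scalerDl IH linearD; congr (_ + _).
have -> : ((c *: group_elt k g) *: (t : factor_module T i) : T) =
    c *: (group_elt k g *: (t : factor_module T i) : restr T) by rewrite -factorZ restrZA.
rewrite -restrZA linearZ /= fE; congr (_ *: _).
rewrite factorE scalerA; congr (_ *: _).
apply/ffunP => h; rewrite -[pure_tensor _ * _]/(ma_mul _ _) ma_mulE.
rewrite (bigD1 (h * (single i g)^-1)%g) //= (bigD1 (single i g)) //=.
rewrite !ffunE eqxx mulr1 -mulgA mulVg mulg1 eqxx mulr1 [X in _ + X]big1 => [|h' h'E];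
  last first.
  rewrite big1 // => s _; rewrite !ffunE; case: eqP => [->|]; last by rewrite mulr0 mul0r.
  case: eqP => [h'g|]; last by rewrite mulr0.
  by rewrite -h'g mulgK eqxx in h'E.
rewrite addr0 [X in _ + X]big1 => [|s /negPf sg]; last by rewrite !ffunE sg mulr0 mul0r.
rewrite addr0 (bigD1 i) //= [RHS](bigD1 i) //= !dfwith_in !ffunE eqxx.
congr (_ * _).
  by rewrite eq_mulgV1.
apply: eq_bigr => j /negPf ji; rewrite !dfwith_out 1?eq_sym ?ji //.
by rewrite !ffunE eq_sym ji invg1 mulg1.
Qed.

End PureTensors.

(** * Simple modules over a power of a group *)

Section CyclicSubmodules.
Variables (k : fieldType) (G : finGroupType).
Local Notation kG := (group_alg k G).

(* The cyclic submodule generated by [t] is simple. *)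
Definition minimal_vector (M : lmodType kG) (t : M) :=
  t != 0 /\ forall y : kG, y *: t != 0 -> exists z : kG, z *: (y *: t) = t.

Lemma minimal_vector_ex (M : lmodType kG) d (b : 'I_d -> restr M) c (t : M) :
  is_basis b c -> t != 0 -> exists x : kG, minimal_vector (x *: t).
Proof.
move=> bc t0; have [c' cE] := is_basis_lin bc; have [_ bE _] := bc.
pose co (w : restr M) : 'rV[k]_d := \row_j c j w.
(* The row space of [Mat w] is the coordinate image of kG w, which turns inclusions of cyclic
   submodules into comparisons of ranks. *)
pose Mat (w : M) : 'M[k]_(#|G|, d) := \matrix_(i, j) c j (group_elt k (enum_val i) *: w).
have co_inj u w : co u = co w -> u = w.
  move=> /rowP uw; rewrite [u]bE [w]bE; apply: eq_bigr => j _.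
  by have := uw j; rewrite !mxE => ->.
have co_lin a w w' : co (a *: w + w') = a *: co w + co w'.
  by apply/rowP => j; rewrite !mxE -!cE linearP.
have MatP (u w : M) : (co u <= Mat w)%MS <-> exists z : kG, u = z *: w.
  split=> [/submxP[D uD]|[z ->]].
    exists (\sum_i D 0 i *: group_elt k (enum_val i)).
    apply: co_inj; rewrite uD; apply/rowP => j; rewrite !mxE.
    rewrite scaler_suml -[RHS]cE linear_sum; apply: eq_bigr => i _.
    by rewrite !mxE -restrZA linearZ /= cE.
  pose D : 'rV[k]_(#|G|) := \row_i z (enum_val i).
  apply/submxP; exists D; apply/rowP => j; rewrite !mxE ma_act_sum -cE linear_sum.
  rewrite (reindex (@enum_val G G)) /=; last exact: (onW_bij _ (@enum_val_bij G)).
  by apply: eq_bigr => i _; rewrite linearZ /= cE !mxE.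
have MatS (y : kG) (w : M) : (Mat (y *: w) <= Mat w)%MS.
  apply/row_subP => i.
  have -> : row i (Mat (y *: w)) = co (group_elt k (enum_val i) *: (y *: w)).
    by apply/rowP => j; rewrite !mxE.
  by apply/MatP; exists (group_elt k (enum_val i) * y); rewrite scalerA.
pose P r := `[< exists2 x : kG, x *: t != 0 & \rank (Mat (x *: t)) = r >].
have exP : exists r, P r.
  by exists (\rank (Mat t)); apply/asboolP; exists 1; rewrite scale1r.
case: (ex_minnP exP) => r /asboolP[x xt rx] rmin.
(* x t generates a cyclic submodule of minimal dimension. *)
exists x; split=> // y yx.
have [z zE] : exists z : kG, x *: t = z *: (y *: (x *: t)).
  apply/MatP; apply: submx_trans (_ : co (x *: t) <= Mat (x *: t))%MS _.
    by apply/MatP; exists 1; rewrite scale1r.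
  rewrite -(geq_leqif (mxrank_leqif_sup (MatS y (x *: t)))) rx.
  by apply: rmin; apply/asboolP; exists (y * x); rewrite -scalerA.
by exists z.
Qed.

Definition cyclic_pred (M : lmodType kG) (t : M) : {pred M} :=
  fun w => `[< exists a : kG, w = a *: t >].

Lemma cyclic_submod (M : lmodType kG) (t : M) : GRing.submod_closed (cyclic_pred t).
Proof.
split=> [|a u v]; rewrite !unfold_in; first by apply/asboolP; exists 0; rewrite scale0r.
move=> /asboolP[b ->] /asboolP[c ->]; apply/asboolP; exists (a * b + c).
by rewrite scalerDl scalerA.
Qed.

Definition cyclic_module (M : lmodType kG) (t : M) : lmodType kG :=
  submod (cyclic_submod t).

Lemma cyclic_moduleP (M : lmodType kG) (t : M) (v : cyclic_module t) :
  exists a : kG, \val v = a *: t.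
Proof. by have := valP v; rewrite unfold_in => /asboolP. Qed.

Lemma cyclic_module_of (M : lmodType kG) (t : M) (a : kG) :
  exists v : cyclic_module t, \val v = a *: t.
Proof.
have h : a *: t \in submod_pred (cyclic_submod t).
  by rewrite unfold_in; apply/asboolP; exists a.
by exists (Submod h).
Qed.

Lemma cyclic_module_simple (M : lmodType kG) (t : M) :
  minimal_vector t -> simple_module (cyclic_module t).
Proof.
move=> [t0 tmin]; have [v0 v0E] := cyclic_module_of t 1; rewrite scale1r in v0E.
split.
  by exists v0; apply: contra_neq t0 => v00; rewrite -v0E v00 raddf0.
move=> X [X0 XP]; case: (pselect (exists2 x, x \in X & x != 0)) => [[x xX x0]|nx]; last first.
  by left=> x xX; apply/eqP/negPn/negP => x0; apply: nx; exists x.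
right=> w; have [a aE] := cyclic_moduleP x; have [b bE] := cyclic_moduleP w.
have at0 : a *: t != 0.
  by apply: contra_neq x0 => a0; apply: val_inj; rewrite aE a0 raddf0.
have [z zE] := tmin a at0.
have -> : w = (b * z) *: x + 0.
  apply: val_inj; rewrite addr0 bE linearZ /= aE.
  by rewrite -scalerA zE.
exact: XP.
Qed.

End CyclicSubmodules.

Section OuterTensor.
Variables (k : closedFieldType) (I : finType) (G : finGroupType).
Local Notation H := {dffun forall _ : I, G}.
Local Notation kG := (group_alg k G).
Local Notation kH := (group_alg k H).
Local Notation pr := (fun (i : I) (h : H) => h i).
Implicit Types (V : I -> lmodType kG) (T : lmodType kH).
Local Notation upd a i x := (@eqtype.dfwith I (fun=> kG : Type) a i x).

Lemma simple_bases V : (forall i, simple_module (V i)) ->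
  exists (d : I -> nat) (b : forall i, 'I_(d i) -> restr (V i)) c,
    forall i, is_basis (b i) (c i).
Proof.
move=> sV.
have /fin_all_exists[d dP] : forall i, exists d, exists (b : 'I_d ->
  restr (V i)) c, is_basis b c.
  by move=> i; exact: simple_fd.
have /fin_all_exists[b bP] := dP; have /fin_all_exists[c cP] := bP.
by exists d, b, c.
Qed.

Lemma simple_basis_gt0 (M : lmodType kG) d (b : 'I_d -> restr M) c :
  simple_module M -> is_basis b c -> (0 < d)%N.
Proof.
move=> [[v v0] _] [_ bE _]; rewrite lt0n; apply: contra_neq v0 => d0.
by rewrite [v]bE big1 // => i _; have := ltn_ord i; rewrite {2}d0.
Qed.

(** If t has a nonzero coordinate at the multi-index x, the tensor of the matrix units
    [E i (y i) (x i)] sends t to a nonzero multiple of the basis tensor at y. A nonzero submodule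
    thus contains all basis tensors. *)
Lemma tensor_simple V T : (forall i, simple_module (V i)) ->
  is_tensor_module pr V T -> simple_module T.
Proof.
move=> sV [tau [tT tE]]; have [d [b [c bc]]] := simple_bases sV.
have [g gE gT] := tensor_coords tT bc.
have /fin_all_exists[E EE] : forall i, exists E : 'I_(d i) -> 'I_(d i) -> kG,
    forall j j' l, E j j' *: (b i l : V i) = if j' == l then b i j else 0.
  by move=> i; exact: simple_matrix_units (sV i) (bc i).
have d0 i : (0 < d i)%N by exact: simple_basis_gt0 (sV i) (bc i).
pose Ix := {dffun forall i, 'I_(d i)}.
pose x0 : Ix := [ffun i => Ordinal (d0 i)].
split.
  exists (tau (fun i => b i (x0 i))); apply/eqP => t0.
  have := gE x0 (fun i => b i (x0 i)); rewrite t0 linear0 (basis_prod bc) eqxx.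
  by move/eqP; rewrite eq_sym oner_eq0.
move=> X [X0 XP]; case: (pselect (exists2 x, x \in X & x != 0)) => [[t tX t0]|nx]; last first.
  by left=> x xX; apply/eqP/negPn/negP => x0'; apply: nx; exists x.
have [x gx] : exists x, g x t != 0.
  apply/existsP; rewrite -negb_forall; apply: contra_neqN t0 => /forallP gt.
  by rewrite [t]gT big1 // => x _; have /eqP -> := gt x; rewrite scale0r.
have Xb (y : Ix) : (tau (fun i => b i (y i)) : T) \in X.
  suff -> : tau (fun i => b i (y i)) =
      ((g x t)^-1 *: pure_tensor (fun i => E i (y i) (x i))) *: (t : T) + 0.
    exact: XP.
  rewrite addr0 -restrZA; have /linear_bundle[f fE] :=
    @act_linear k _ T (pure_tensor (fun i => E i (y i) (x i))).
  rewrite -fE {2}[t]gT linear_sum (bigD1 x) //= big1 => [|z zx].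
    rewrite linearZ /= fE (pure_tensor_act _ _ tT.1 tE) addr0 scalerA mulVf // scale1r.
    by congr (tau _); apply: functional_extensionality_dep => i; rewrite EE eqxx.
  have [i zxi] : exists i, x i != z i.
    apply/existsP; rewrite -negb_forall; apply: contra_neqN zx => /forallP xz.
    by apply/ffunP => i; have /eqP -> := xz i.
  rewrite linearZ /= fE (pure_tensor_act _ _ tT.1 tE).
  by rewrite (multilinear_eq0 (i := i) tT.1) ?scaler0 // EE (negPf zxi).
right=> u; rewrite [u]gT.
elim: (index_enum _) => [|y r IHr]; first by rewrite big_nil.
by rewrite big_cons restrZE; exact: XP.
Qed.

Lemma tensor_module_simple_ex V : (forall i, simple_module (V i)) ->
  exists2 T, is_tensor_module pr V T & simple_module T.
Proof.
move=> sV; have [d [b [c bc]]] := simple_bases sV.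
have [||T tT] := tensor_module_ex (pr := pr) _ _ bc.
- by move=> i; rewrite ffunE.
- by move=> i g h; rewrite ffunE.
by exists T => //; exact: tensor_simple tT.
Qed.

(** Contracting the other slots against coordinate functionals, chosen so that [f w] has a nonzero
    coordinate, gives a kG-map from the i-th factor module to [V i] that does not kill [f w].
    Schur's lemma applies to its composite with f. *)
Lemma tensor_factor_iso V T (i : I) (W : lmodType kG) (f : {linear W -> factor_module T i}) w :
  (forall i, simple_module (V i)) -> is_tensor_module pr V T ->
  simple_module W -> f w != 0 -> module_isomorphic W (V i).
Proof.
move=> sV [tau [tT tE]] sW fw; have [d [b [c bc]]] := simple_bases sV.
have [g gE gT] := tensor_coords tT bc.
have [x gx] : exists x, g x (f w) != 0.
  apply/existsP; rewrite -negb_forall; apply: contra_neqN fw => /forallP gt.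
  by rewrite [f w]gT big1 // => x _; have /eqP -> := gt x; rewrite scale0r.
have cl j y : scalar (c j y) by case: (bc j).
have [p pE] := tensor_lift tT (multilinear_contract i (fun j => cl j (x j))).
have [c' c'E] := is_basis_lin (bc i).
have gp t : g x t = c i (x i) (p t).
  have cpl : linear (fun t => c i (x i) (p t) : k^o).
    by move=> a u v; rewrite linearP; exact: cl.
  apply: (tensor_extf tT) cpl _ t => [|v]; first exact: linearP.
  rewrite gE pE -c'E linearZ /= c'E (bigD1 i) //= mulrC; congr (_ * _).
have pl : linear (p : factor_module T i -> V i).
  apply: ma_linear => [a u v|h t]; first by rewrite factorZ linearP.
  rewrite -[ma_elt k h]/(group_elt k h) factorE.
  have /linear_bundle[l lE] := @act_linear k _ T (group_elt k (single i h)).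
  have /linear_bundle[l' lE'] := @act_linear k _ (V i) (group_elt k h).
  rewrite -lE -lE'; apply: (tensor_ext tT (h := p \o l) (h' := l' \o p)) => v /=.
  rewrite lE lE' tE !pE -restrZC; congr (_ *: _); last by rewrite ffunE eqxx.
  apply: eq_bigr => j ji; rewrite ffunE eq_sym (negPf ji).
  by congr (c _ _ _); exact: ma_elt1_act.
have [q qE] := linear_bundle pl.
exists (q \o f); apply: (hom_iso (x := w)) => //=.
rewrite qE; apply: contra_neq gx => pw; rewrite gp [p _]pw.
by rewrite -c'E linear0.
Qed.

(** The factors are treated one after the other. Replacing t by x t in the i-th action keeps the
    minimality already reached for j, because the two actions commute. *)
Lemma minimal_vector_factors T d (b : 'I_d -> restr T) c :
  is_basis b c -> simple_module T ->
  exists t : T, t != 0 /\ forall i, minimal_vector (t : factor_module T i).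
Proof.
move=> bc [[t0 t0n] _].
have bci i : is_basis (b : 'I_d -> restr (factor_module T i)) c.
  case: bc => cl bE cb; split=> // [j a u v|w]; first by rewrite factorZ; exact: cl.
  by rewrite {1}[w]bE; apply: eq_bigr => j _; rewrite factorZ.
suff [t [tn tm]] : exists t : T, t != 0 /\ forall i, i \in enum I ->
  minimal_vector (t : factor_module T i).
  by exists t; split=> // i; apply: tm; rewrite mem_enum.
elim: (enum I) => [|i r [t [tn tm]]]; first by exists t0.
have [x [xn xm]] := minimal_vector_ex (bci i) tn.
exists (x *: (t : factor_module T i)); split=> // j; rewrite inE.
case: eqVneq => [-> _|ji /= jr]; first by split.
have [_ tmj] := tm j jr; split=> // y yx.
have ij : j != i by [].
have yt : y *: (t : factor_module T j) != 0.
  apply: contra_neq yx => yt; rewrite (factorC y x t ij) yt.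
  exact: (@scaler0 _ (factor_module T i)).
have [z zE] := tmj y yt; exists z.
rewrite (factorC y x t ij) (factorC z x _ ij).
exact: (congr1 (fun u => x *: (u : factor_module T i)) zE).
Qed.

(** [V i] is the simple module generated by t under the i-th action. Evaluation at t maps the tensor
    product of the [V i] to T; this map is nonzero and both ends are simple. *)
Lemma simple_is_tensor T : simple_module T ->
  exists2 V, forall i, simple_module (V i) & is_tensor_module pr V T.
Proof.
move=> sT; have [d [b [c bc]]] := simple_fd sT.
have [t [tn tm]] := minimal_vector_factors bc sT.
pose V i := cyclic_module (t : factor_module T i).
have sV i : simple_module (V i) by exact: cyclic_module_simple.
have one_indep (a : I -> kG) i (x x' : kG) :
    x *: (t : factor_module T i) = x' *: (t : factor_module T i) ->
    pure_tensor (upd a i x) *: t = pure_tensor (upd a i x') *: t.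
  by move=> xx'; rewrite [LHS]pure_tensor_factor [RHS]pure_tensor_factor xx'.
have indep (a a' : I -> kG) : (forall i, a i *: (t : factor_module T i) = a' i *: (t :
  factor_module T i)) ->
    pure_tensor a *: t = pure_tensor a' *: t.
  move=> aa'; suff IH (r : seq I) :
      pure_tensor (fun i => if i \in r then a i else a' i) *: t = pure_tensor a' *: t.
    rewrite -(IH (enum I)); congr (pure_tensor _ *: _); apply/funext => i.
    by rewrite mem_enum.
  elim: r => [|i r IHr]; first by [].
  rewrite -{}IHr; set a1 := (X in _ = pure_tensor X *: _).
  rewrite -(dfwith_id (V := fun=> kG : Type) a1 i).
  have -> : (fun j => if j \in i :: r then a j else a' j) = upd a1 i (a i).
    apply/funext => j; rewrite inE; case: (eqVneq j i) => [->|ji].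
      by rewrite dfwith_in.
    by rewrite dfwith_out // eq_sym.
  apply: one_indep; rewrite /a1; case: ifP => // _.
have chP i (v : V i) : exists a : kG, \val v = a *: (t :
  factor_module T i) by exact: cyclic_moduleP.
(* The coefficient of v with respect to t is an arbitrary choice, with no linearity in v; by [indep]
   the choice does not affect [beta]. *)
pose ch i (v : V i) : kG := projT1 (cid (chP i v)).
have chE i (v : V i) : \val v = ch i v *: (t : factor_module T i) by exact: projT2 (cid
  (chP i v)).
(* beta (a_i t) = (a_1 (x) ... (x) a_r) t, which only depends on the a_i t. *)
pose beta (v : forall i, restr (V i) : lmodType k) : restr T :=
  pure_tensor (fun i => ch i (v i)) *: t.
have mb : multilinear beta.
  move=> v i a x y; rewrite /beta.
  pose a0 := fun i => ch i (v i).
  have split_upd (z : V i) : (fun j => ch j (dfwith v z j)) = upd a0 i (ch i z).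
    exact: (dfwith_map (V := fun i => V i : Type) (U := fun=> kG : Type) ch).
  rewrite !split_upd.
  have -> : pure_tensor (upd a0 i (ch i (a *: x + y))) *: t =
      pure_tensor (upd a0 i (a *: ch i x + ch i y)) *: t.
    apply: one_indep; rewrite -chE scalerDl -restrZA -!chE.
    exact: (linearP (\val : {linear V i -> factor_module T i}) (a%:A) x y).
  have -> : pure_tensor (upd a0 i (a *: ch i x + ch i y)) =
     a *: pure_tensor (upd a0 i (ch i x)) + pure_tensor (upd a0 i (ch i y)).
    exact: pure_tensor_multilinear.
  by rewrite scalerDl -restrZA.
have bE (h : H) v : group_elt k h *: (beta v : T) =
  beta (fun i => group_elt k (h i) *: (v i : V i)).
  rewrite /beta scalerA group_elt_pure_tensor; apply: indep => i.
  by rewrite -chE -scalerA -chE linearZ.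
have [T' [tau [tT' tE']] sT'] := tensor_module_simple_ex sV.
have [f fE] := tensor_module_hom tT' tE' mb bE.
have /fin_all_exists[v vE] : forall i, exists v : V i, \val v = 1 *: (t : factor_module T i).
  by move=> i; exact: cyclic_module_of.
exists V => //; apply: tensor_module_isor (_ : is_tensor_module pr V T'); last by exists tau.
exists f; apply: (hom_iso (x := tau v)) => //; rewrite fE /beta.
rewrite (indep _ (fun=> group_elt k 1%g)) => [|i]; last by rewrite -chE vE.
rewrite (pure_tensor_elt k (fun=> 1%g)).
rewrite (_ : [ffun=> 1%g] = 1%g :> H); last by apply/ffunP => i; rewrite !ffunE.
by rewrite (ma_elt1_act (t : T)).
Qed.

End OuterTensor.

(** * Hsiao's monoid as weak orders with labels *)

Section HsiaoOrder.
Variables (n : nat) (G : finGroupType).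
Implicit Types (s t e f : hsiao n G) (i j l : 'I_n) (r : seq ({set 'I_n} * G)).

Definition covers r i := has (fun p : {set 'I_n} * G => i \in p.1) r.

Fixpoint seq_le r i j : bool :=
  if r is p :: r' then (i \in p.1) || (j \notin p.1) && seq_le r' i j else true.

Fixpoint seq_lab r i : G :=
  if r is p :: r' then if i \in p.1 then p.2 else seq_lab r' i else 1%g.

(* An ordered G-partition is encoded by the weak order "the block of i comes
   no later than the block of j" and by the label of the block of each i. *)
Definition hle s i j := seq_le s i j.
Definition hlab s i := seq_lab s i.
Definition heq s i j := hle s i j && hle s j i.

Lemma hle_refl s i : hle s i i.
Proof.
by rewrite /hle; elim: (hsiao_seq s) => //= p r ->; rewrite andbT orbN.
Qed.

Lemma hle_trans s i j l : hle s i j -> hle s j l -> hle s i l.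
Proof.
rewrite /hle; elim: (hsiao_seq s) => //= p r IHr.
case: (i \in p.1) => //=; case: (j \in p.1) => //= ij.
by case: (l \in p.1) => //=; exact: IHr.
Qed.

Lemma hle_total s i j : hle s i j || hle s j i.
Proof.
by rewrite /hle; elim: (hsiao_seq s) => //= p r; case: (i \in _); case: (j \in _).
Qed.

Lemma heq_refl s i : heq s i i.
Proof. by rewrite /heq hle_refl. Qed.

Lemma heq_sym s i j : heq s i j = heq s j i.
Proof. by rewrite /heq andbC. Qed.

Lemma heq_trans s i j l : heq s i j -> heq s j l -> heq s i l.
Proof.
move=> /andP[ij ji] /andP[jl lj]; apply/andP; split.
  exact: hle_trans jl.
exact: hle_trans ji.
Qed.

Lemma hle_eql s i i' j : heq s i i' -> hle s i j = hle s i' j.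
Proof.
by case/andP=> ii' i'i; apply/idP/idP; apply: hle_trans.
Qed.

Lemma hsiao_nonempty s : all (fun p : {set 'I_n} * G => p.1 != finset.set0) s.
Proof. by have := valP s; rewrite hsiaoE => /andP[]. Qed.

Lemma hsiao_count s i : count (fun p : {set 'I_n} * G => i \in p.1) s = 1%N.
Proof. by have := valP s; rewrite hsiaoE => /andP[_ /forallP/(_ i)/eqP]. Qed.

Lemma hsiao_covers s i : covers s i.
Proof. by rewrite /covers has_count hsiao_count. Qed.

Lemma seq_le_filter r i j : seq_le [seq p <- r | p.1 != finset.set0] i j = seq_le r i j.
Proof.
elim: r => //= p r IHr; case: eqP => [->|_] /=; rewrite IHr //.
by rewrite !inE.
Qed.

Lemma seq_lab_filter r i : seq_lab [seq p <- r | p.1 != finset.set0] i = seq_lab r i.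
Proof.
elim: r => //= p r IHr; case: eqP => [->|_] /=; rewrite IHr //.
by rewrite !inE.
Qed.

Lemma covers_map_setI (p : {set 'I_n} * G) r i : covers r i ->
  covers [seq (p.1 :&: q.1, (p.2 * q.2)%g) | q <- r] i = (i \in p.1).
Proof.
rewrite /covers has_map => /hasP[q qr iq]; apply/hasP/idP => [[q' _]|ip].
  by rewrite /= inE => /andP[].
by exists q => //=; rewrite inE ip.
Qed.

Lemma seq_le_cat r r' i j : seq_le (r ++ r') i j =
  if covers r i then covers r j ==> seq_le r i j
  else ~~ covers r j && seq_le r' i j.
Proof.
elim: r => //= p r ->; case: (i \in p.1) => //=; first by rewrite implybT.
by case: (j \in p.1); case: (covers r i).
Qed.

Lemma seq_lab_cat r r' i :
  seq_lab (r ++ r') i = if covers r i then seq_lab r i else seq_lab r' i.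
Proof. by elim: r => //= p r ->; case: (i \in p.1). Qed.

Lemma seq_le_map_setI (p : {set 'I_n} * G) r i j : i \in p.1 -> j \in p.1 ->
  seq_le [seq (p.1 :&: q.1, (p.2 * q.2)%g) | q <- r] i j = seq_le r i j.
Proof. by move=> ip jp; elim: r => //= q r ->; rewrite !inE ip jp. Qed.

Lemma seq_lab_map_setI (p : {set 'I_n} * G) r i : i \in p.1 -> covers r i ->
  seq_lab [seq (p.1 :&: q.1, (p.2 * q.2)%g) | q <- r] i = (p.2 * seq_lab r i)%g.
Proof. by move=> ip; elim: r => //= q r IHr; rewrite inE ip /=; case: ifP. Qed.

Lemma hleM s t i j : hle (s * t)%g i j = hle s i j && (hle s j i ==> hle t i j).
Proof.
rewrite /hle seq_le_filter; have := hsiao_covers s i.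
elim: (hsiao_seq s) => //= p r IHr; rewrite seq_le_cat !covers_map_setI ?hsiao_covers //.
by case ip : (i \in p.1); case jp: (j \in p.1) => //=; rewrite seq_le_map_setI.
Qed.

Lemma hlabM s t i : hlab (s * t)%g i = (hlab s i * hlab t i)%g.
Proof.
rewrite /hlab seq_lab_filter; have := hsiao_covers s i.
elim: (hsiao_seq s) => //= p r IHr; rewrite seq_lab_cat covers_map_setI ?hsiao_covers //.
by case ip : (i \in p.1) => /=; [rewrite seq_lab_map_setI ?hsiao_covers | move/IHr].
Qed.

(** Stated for lists that may cover only part of [n] and meet each point at most once, so that the
    induction can remove the first block. That block is recovered from the weak order as the set of
    its least elements. *)
Lemma seq_ext r r' :
    all (fun p : {set 'I_n} * G => p.1 != finset.set0) r ->
    all (fun p : {set 'I_n} * G => p.1 != finset.set0) r' ->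
    (forall i, (count (fun p : {set 'I_n} * G => i \in p.1) r <= 1)%N) ->
    (forall i, (count (fun p : {set 'I_n} * G => i \in p.1) r' <= 1)%N) ->
    covers r =1 covers r' ->
    (forall i j, covers r i -> covers r j -> seq_le r i j = seq_le r' i j) ->
    (forall i, covers r i -> seq_lab r i = seq_lab r' i) ->
  r = r'.
Proof.
elim: r r' => [|p r IHr] [|q r'] //=.
- move=> _ /andP[/finset.set0Pn[x xq] _] _ _ /(_ x) /=.
  by rewrite xq.
- move=> /andP[/finset.set0Pn[x xp] _] _ _ _ /(_ x) /=.
  by rewrite xp.
move=> /andP[/finset.set0Pn[x xp] nr] /andP[/finset.set0Pn[y yq] nr'] cr cr' ce' le lab.
have ce z : (z \in p.1) || covers r z = (z \in q.1) || covers r' z := ce' z.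
have pq : p.1 = q.1.
  apply/finset.setP => z; apply/idP/idP => zq.
    have := le z y; rewrite (ce y) zq yq /= => /(_ isT isT) /esym.
    by case: (z \in q.1).
  have := le z x; rewrite (ce z) zq xp /= => /(_ isT isT).
  by case: (z \in p.1).
have pq2 : p.2 = q.2 by have := lab x; rewrite -pq xp => /(_ isT).
have -> : p = q by rewrite (surjective_pairing p) pq pq2 -surjective_pairing.
have cov0 z (u : {set 'I_n} * G) r0 : ((z \in u.1) +
    count (fun p : {set 'I_n} * G => z \in p.1) r0 <= 1)%N -> z \in u.1 -> covers r0 z = false.
  by move=> + zu; rewrite zu /covers has_count; case: (count _ _).
have out z : covers r z -> z \in p.1 = false.
  by move=> rz; apply/negP => zp; rewrite (cov0 z p r) in rz.
congr (_ :: _); apply: IHr => //.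
- by move=> z; apply: leq_trans (cr z); rewrite leq_addl.
- by move=> z; apply: leq_trans (cr' z); rewrite leq_addl.
- move=> z; case zp : (z \in p.1); last first.
    by have := ce z; rewrite -pq zp.
  by rewrite (cov0 z p r) // (cov0 z q r') // -pq.
- move=> z w rz rw; have := le z w; rewrite rz rw !orbT -pq (out z) // (out w) //=.
  by apply.
- by move=> z rz; have := lab z; rewrite rz orbT -pq (out z) //; apply.
Qed.

(** Identities in the monoid thereby reduce to Boolean computations with two points i and j and to
    identities in G. *)
Lemma hsiao_ext s t : (forall i j, hle s i j = hle t i j) ->
  (forall i, hlab s i = hlab t i) -> s = t.
Proof.
move=> le lab; apply: val_inj; apply: seq_ext => //.
- exact: hsiao_nonempty.
- exact: hsiao_nonempty.
- by move=> i; rewrite hsiao_count.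
- by move=> i; rewrite hsiao_count.
- by move=> i; rewrite !hsiao_covers.
- by move=> i j _ _; exact: le.
- by move=> i _; exact: lab.
Qed.

Lemma hle1 i j : hle (1%g : hsiao n G) i j.
Proof. by rewrite /hle seq_le_filter /= !inE. Qed.

Lemma hlab1 i : hlab (1%g : hsiao n G) i = 1%g.
Proof. by rewrite /hlab seq_lab_filter /= !inE. Qed.

Lemma seq_le_unzip1 r r' i j : unzip1 r = unzip1 r' -> seq_le r i j = seq_le r' i j.
Proof. by elim: r r' => [|p r IHr] [|p' r'] //= [-> /IHr ->]. Qed.

Lemma cut_subproof (X : {set 'I_n}) (g : G) :
  ordered_partition (unzip1 [seq p <- [:: (X, g); (~: X, 1%g)] | p.1 != finset.set0]).
Proof.
rewrite hsiaoE filter_all; apply/forallP => x.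
rewrite count_cov_filter /= !inE; by case: (x \in X).
Qed.

(** With g = 1, these are the idempotents at which derivations are evaluated; with X a block, they
    give the action of G on the factor at X. *)
Definition cut (X : {set 'I_n}) (g : G) : hsiao n G := Hsiao (cut_subproof X g).

Lemma hle_cut X g i j : hle (cut X g) i j = (i \in X) || (j \notin X).
Proof.
rewrite /hle seq_le_filter /= !inE.
by case: (i \in X) => //=; case: (j \in X).
Qed.

Lemma hlab_cut X g i : hlab (cut X g) i = if i \in X then g else 1%g.
Proof. by rewrite /hlab seq_lab_filter /= !inE; case: (i \in X). Qed.

Lemma heq_cut X g i j : heq (cut X g) i j = ((i \in X) == (j \in X)).
Proof. by rewrite /heq !hle_cut; case: (i \in X); case: (j \in X). Qed.

Lemma hidem_subproof s : ordered_partition (unzip1 [seq (p.1, 1%g : G) | p <- s]).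
Proof. by rewrite /unzip1 -map_comp; exact: (valP s). Qed.

(** The idempotent with the ordered blocks of s. By [hidem_mull], s acts as 0 on a module as soon as
    this idempotent does. *)
Definition hidem s : hsiao n G := Hsiao (hidem_subproof s).

Lemma hle_hidem s i j : hle (hidem s) i j = hle s i j.
Proof. by apply: seq_le_unzip1; rewrite /= /unzip1 -map_comp. Qed.

Lemma hlab_hidem s i : hlab (hidem s) i = 1%g.
Proof. by rewrite /hlab /=; elim: (hsiao_seq s) => //= p r ->; case: ifP. Qed.

(** These are exactly the idempotents: a label g with g g = g is 1. *)
Definition htriv e := [forall i, hlab e i == 1%g].
Lemma htrivP e : reflect (forall i, hlab e i = 1%g) (htriv e).
Proof. by apply: (iffP forallP) => h i; apply/eqP. Qed.

(** Only a preorder, as the order of the blocks is ignored. It is the inclusion of principal ideals: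
    SeS is contained in SsS exactly in this case. *)
Definition hge s e := [forall i, forall j, heq e i j ==> heq s i j].

Lemma hgeP s e : reflect (forall i j, heq e i j -> heq s i j) (hge s e).
Proof.
apply: (iffP forallP) => h i.
  by move=> j; have /forallP/(_ j)/implyP := h i.
by apply/forallP => j; apply/implyP; exact: h.
Qed.

Lemma heqM s t i j : heq (s * t)%g i j = heq s i j && heq t i j.
Proof.
rewrite /heq !hleM; case: (hle s i j) => //=; case: (hle s j i) => //=.
Qed.

Lemma heq_hidem s i j : heq (hidem s) i j = heq s i j.
Proof. by rewrite /heq !hle_hidem. Qed.

Lemma hge_refl s : hge s s.
Proof. exact/hgeP. Qed.

Lemma hge_trans s t e : hge s t -> hge t e -> hge s e.
Proof. by move=> /hgeP st /hgeP te; apply/hgeP => i j /te/st. Qed.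

Lemma hgeM s t e : hge (s * t)%g e = hge s e && hge t e.
Proof.
apply/hgeP/andP => [h|[/hgeP hs /hgeP ht] i j ij]; last by rewrite heqM hs ?ht.
by split; apply/hgeP => i j /h; rewrite heqM => /andP[].
Qed.

Lemma hge_hidem s e : hge (hidem s) e = hge s e.
Proof. by apply: eq_forallb => i; apply: eq_forallb => j; rewrite heq_hidem. Qed.

Lemma hge1 e : hge 1%g e.
Proof. by apply/hgeP => i j _; rewrite /heq !hle1. Qed.

Lemma htriv_hidem s : htriv (hidem s).
Proof. by apply/htrivP => i; rewrite hlab_hidem. Qed.

Lemma htriv1 : htriv 1%g.
Proof. by apply/htrivP => i; rewrite hlab1. Qed.

Lemma htriv_cut X : htriv (cut X 1%g).
Proof. by apply/htrivP => i; rewrite hlab_cut if_same. Qed.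

Lemma htrivM s t : htriv s -> htriv t -> htriv (s * t)%g.
Proof.
by move=> /htrivP hs /htrivP ht; apply/htrivP => i; rewrite hlabM hs ht mulg1.
Qed.

Lemma hge_cut X g e : hge (cut X g) e <-> (forall i j, heq e i j -> (i \in X) = (j \in X)).
Proof.
split=> [/hgeP h i j /h|h]; first by rewrite heq_cut => /eqP.
by apply/hgeP => i j /h ij; rewrite heq_cut ij.
Qed.

(** In a lexicographic product the last factor only breaks ties, and the first factor e has already
    broken all those that e can. *)
Lemma triv_mulK e s : htriv e -> (e * s * e)%g = (e * s)%g.
Proof.
move=> /htrivP te; apply: hsiao_ext => [i j|i]; last by rewrite !hlabM te mulg1.
by rewrite !hleM; case: (hle e i j) => //=; rewrite implybT andbT.
Qed.

Lemma triv_idem e : htriv e -> (e * e)%g = e.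
Proof. by move=> te; have := triv_mulK 1%g te; rewrite mulg1. Qed.

Lemma hidem_mull s : (hidem s * s)%g = s.
Proof.
apply: hsiao_ext => [i j|i]; last by rewrite hlabM hlab_hidem mul1g.
by rewrite !hleM !hle_hidem; case: (hle s i j); rewrite ?implybT.
Qed.

Lemma mul_ge e f : htriv f -> hge f e -> (e * f)%g = e.
Proof.
move=> /htrivP tf /hgeP fe; apply: hsiao_ext => [i j|i]; last by rewrite hlabM tf mulg1.
rewrite hleM; case ij : (hle e i j) => //=; case ji : (hle e j i) => //=.
by have /fe/andP[-> _] : heq e i j by rewrite /heq ij ji.
Qed.

Definition hblock e i := [set j | heq e i j].

Lemma seq_block r i p : (forall j, (count (fun p : {set 'I_n} * G => j \in p.1) r <= 1)%N) ->
  p \in r -> i \in p.1 -> p.1 = [set j | seq_le r i j && seq_le r j i] /\ seq_lab r i = p.2.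
Proof.
elim: r => //= q r IHr cnt.
have out j p' : p' \in r -> j \in p'.1 -> j \in q.1 = false.
  move=> pr jp; apply/negP => jq; have := cnt j; rewrite jq add1n ltnS leqn0 => /eqP.
  by move=> c0; have : has (fun p : {set 'I_n} * G => j \in p.1) r;
    [apply/hasP; exists p' | rewrite has_count c0].
rewrite inE => /predU1P[->|pr] ip.
  by split; [apply/finset.setP => j; rewrite inE ip orbF | rewrite ip].
have [|pE <-] := IHr _ pr ip.
  by move=> j; apply: leq_trans (cnt j); rewrite leq_addl.
rewrite (out i p) //=; split=> //; apply/finset.setP => j; rewrite inE.
case jq : (j \in q.1) => /=; first by apply/negP => /(out j p pr); rewrite jq.
by rewrite {1}pE inE.
Qed.

Lemma hsiao_seqP s i (p : {set 'I_n} * G) : p \in hsiao_seq s -> i \in p.1 ->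
  p.1 = hblock s i /\ hlab s i = p.2.
Proof. by apply: seq_block => j; rewrite hsiao_count. Qed.

Lemma hlab_heq s i j : heq s i j -> hlab s i = hlab s j.
Proof.
move=> ij; have /hasP[p ps ip] := hsiao_covers s i.
have [pE ->] := hsiao_seqP ps ip.
by have [|_ ->] := hsiao_seqP (i := j) ps _; rewrite ?pE ?inE.
Qed.

Section Gpart.
Variables (r : nat) (P : 'I_r -> {set 'I_n}) (hP : ordered_partition (codom P)).
Implicit Types g : 'I_r -> G.

Lemma gpart_block_ex i : exists a, i \in P a.
Proof.
have /hasP[p] := hsiao_covers (gpart hP (fun=> 1%g)) i.
by case/mapP => a _ -> /= ia; exists a.
Qed.

Lemma hle_gpart g g' i j : hle (gpart hP g) i j = hle (gpart hP g') i j.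
Proof. by apply: seq_le_unzip1; rewrite /= /unzip1 -!map_comp. Qed.

Lemma gpart_mem g a : (P a, g a) \in hsiao_seq (gpart hP g).
Proof. by apply/mapP; exists a => //; rewrite mem_enum. Qed.

Lemma hlab_gpart g a i : i \in P a -> hlab (gpart hP g) i = g a.
Proof. by move=> ia; have [_ ->] := hsiao_seqP (gpart_mem g a) ia. Qed.

Lemma gpart_block g a i : i \in P a -> P a = hblock (gpart hP g) i.
Proof. by move=> ia; have [] := hsiao_seqP (gpart_mem g a) ia. Qed.

Lemma gpart_heq g a i j : i \in P a -> j \in P a -> heq (gpart hP g) i j.
Proof. by move=> ia; rewrite (gpart_block g ia) inE. Qed.

Lemma gpart_heq_mem g a i j : i \in P a -> heq (gpart hP g) i j -> j \in P a.
Proof. by move=> ia ij; rewrite (gpart_block g ia) inE. Qed.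

Lemma gpart_nonempty a : exists i, i \in P a.
Proof.
have /allP/(_ _ (gpart_mem (fun=> 1%g) a))/finset.set0Pn[i ip] :=
  hsiao_nonempty (gpart hP (fun=> 1%g)).
by exists i.
Qed.

Lemma gpart_inj : injective P.
Proof.
have := hP; case/andP => u _; apply/injectiveP.
by rewrite /injectiveb /dinjectiveb.
Qed.

Lemma htriv_gpart1 : htriv (gpart hP (fun=> 1%g)).
Proof. by apply/htrivP => i; have [a ia] := gpart_block_ex i; rewrite (hlab_gpart _ ia). Qed.

Lemma gpart_disjoint a b i : i \in P a -> i \in P b -> a = b.
Proof.
move=> ia ib; apply: gpart_inj.
by rewrite (gpart_block (fun=> 1%g) ia) (gpart_block (fun=> 1%g) ib).
Qed.

Lemma gpartM g g' : (gpart hP g * gpart hP g')%g = gpart hP (fun a => g a * g' a)%g.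
Proof.
apply: hsiao_ext => [i j|i].
  rewrite hleM (hle_gpart g' g) (hle_gpart (fun a => g a * g' a)%g g).
  by case: (hle _ i j); rewrite ?implybT.
have [a ia] := gpart_block_ex i.
by rewrite hlabM !(hlab_gpart _ ia).
Qed.

Lemma gpart_mulr g s : hge s (gpart hP (fun=> 1%g)) ->
    forall h : 'I_r -> G, (forall a i, i \in P a -> hlab s i = h a) ->
  (gpart hP g * s)%g = gpart hP (fun a => g a * h a)%g.
Proof.
move=> /hgeP se h sh; apply: hsiao_ext => [i j|i].
  rewrite hleM (hle_gpart (fun a => g a * h a)%g (fun=> 1%g)) !(hle_gpart g (fun=> 1%g)).
  case ij : (hle _ i j) => //=; case ji : (hle _ j i) => //=.
  by have /se/andP[-> _] : heq (gpart hP (fun=> 1%g)) i j by rewrite /heq ij ji.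
have [a ia] := gpart_block_ex i.
by rewrite hlabM !(hlab_gpart _ ia) (sh a).
Qed.

End Gpart.

Lemma hsiao_gpart e : htriv e -> exists (r : nat) (P : 'I_r -> {set 'I_n})
  (hP : ordered_partition (codom P)), e = gpart hP (fun=> 1%g).
Proof.
move=> te; pose P (a : 'I_(size e)) := (nth (finset.set0, 1%g) e a).1.
have PE : codom P = unzip1 e.
  rewrite /unzip1 -[in RHS](mkseq_nth (finset.set0, 1%g) e) /mkseq -val_enum_ord.
  by rewrite -!map_comp /codom /image_mem enumT; apply: eq_map.
have hP : ordered_partition (codom P) by rewrite PE (valP e).
exists _, P, hP; apply: hsiao_ext => [i j|i]; last first.
  by rewrite (htrivP _ (htriv_gpart1 hP)) (htrivP _ te).
by apply: seq_le_unzip1; rewrite -PE /= /unzip1 -map_comp.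
Qed.

(** If f is coarser than e, then e = e f h with h carrying the inverse labels, so that e lies in the
    ideal of f. *)
Lemma tsi_proper_ge f e : htriv e ->
  two_sided_ideal f \proper two_sided_ideal e -> ~~ hge f e.
Proof.
move=> /hsiao_gpart[r [P [hP ->]]] /properP[_ [x /imset2P[a b _ _ ->] nx]].
apply/negP => fe; case/imset2P: nx.
have [h hE] : exists h : 'I_r -> G, forall a i, i \in P a -> hlab f i = h a.
  have /fin_all_exists[c cP] := gpart_nonempty hP.
  exists (fun a => hlab f (c a)) => a' i ia; apply: hlab_heq.
  by apply: (hgeP _ _ fe); exact: gpart_heq ia (cP a').
have fE := gpart_mulr (fun=> 1%g) fe hE.
exists (a * gpart hP (fun=> 1%g))%g (gpart hP (fun a => (h a)^-1) * b)%g => //.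
have {1}-> : gpart hP (fun=> 1%g) =
    (gpart hP (fun=> 1%g) * f * gpart hP (fun a => (h a)^-1))%g.
  by rewrite fE gpartM; congr gpart; apply/funext => c; rewrite mul1g mulgV.
by rewrite !mulgA.
Qed.

(** The blocks of an element of S e f S lie inside blocks of f, so if e were such an element f would
    be coarser than e. *)
Lemma tsi_mul_proper e f : ~~ hge f e ->
  two_sided_ideal (e * f)%g \proper two_sided_ideal e.
Proof.
move=> fe; apply/properP; split.
  apply/fintype.subsetP => x /imset2P[a b _ _ ->]; apply/imset2P.
  by exists a (f * b)%g => //; rewrite !mulgA.
exists e; first by apply/imset2P; exists 1%g 1%g => //; rewrite mul1g mulg1.
apply/negP => /imset2P[a b _ _ eE]; case/negP: fe.
by have := hge_refl e; rewrite {1}eE !hgeM => /andP[/andP[_ /andP[]]].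
Qed.

End HsiaoOrder.

Section Blocks.
Variables (n : nat) (G : finGroupType).
Implicit Types (e f s : hsiao n G) (R : {set 'I_n}).

Definition block e R := [exists i, R == hblock e i].

Lemma blockP e R : reflect (exists i, R = hblock e i) (block e R).
Proof. by apply: (iffP existsP) => -[i Ri]; exists i; apply/eqP. Qed.

Lemma block_hblock e i : block e (hblock e i).
Proof. by apply/blockP; exists i. Qed.

(** The label is read at some point of R, which is harmless when R is a block of a partition finer
    than s; 1 is the default on the empty set. *)
Definition blab s R : G := if [pick i in R] is Some i then hlab s i else 1%g.

Lemma mem_hblock e i : i \in hblock e i.
Proof. by rewrite inE heq_refl. Qed.

Lemma hblock_eq e i j : heq e i j -> hblock e i = hblock e j.
Proof.
move=> ij; apply/finset.setP => l; rewrite !inE.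
by apply/idP/idP; apply: heq_trans; rewrite // heq_sym.
Qed.

Lemma block_mem e R i : block e R -> i \in R -> R = hblock e i.
Proof. by case/blockP => j ->; rewrite inE => /hblock_eq ->. Qed.

Lemma blabE s e R i : hge s e -> block e R -> i \in R -> blab s R = hlab s i.
Proof.
move=> se bR iR; rewrite /blab; case: pickP => [j jR|/(_ i)]; last by rewrite iR.
apply: hlab_heq; apply: (hgeP _ _ se).
by have := jR; rewrite (block_mem bR iR) inE heq_sym.
Qed.

Lemma block_nonempty e R : block e R -> exists i, i \in R.
Proof. by case/blockP => i ->; exists i; exact: mem_hblock. Qed.

Lemma hge_cut_of_block e R g : block e R -> hge (cut R g) e.
Proof.
case/blockP => i ->; apply/hge_cut => a b ab; rewrite !inE.
by apply/idP/idP => h; apply: heq_trans h _; rewrite // heq_sym.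
Qed.

Lemma blab_cut e R R' g : hge (cut R g) e -> block e R' ->
  blab (cut R g) R' = if R' \subset R then g else 1%g.
Proof.
move=> ce bR'; have [i iR'] := block_nonempty bR'.
rewrite (blabE ce bR' iR') hlab_cut; congr (if _ then _ else _).
apply/idP/idP => [iR|/fintype.subsetP/(_ i iR')//].
apply/fintype.subsetP => j; rewrite (block_mem bR' iR') inE.
by move: ce => /hge_cut h /h <-.
Qed.

Lemma block_subset e R R' : block e R -> block e R' -> (R' \subset R) = (R' == R).
Proof.
move=> bR bR'; apply/idP/eqP => [|->//].
have [i iR'] := block_nonempty bR'; move/fintype.subsetP/(_ i iR') => iR.
by rewrite (block_mem bR' iR') (block_mem bR iR).
Qed.

End Blocks.

(** * Modules with a given apex *)

Section HsiaoModules.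
Variables (k : fieldType) (n : nat) (G : finGroupType).
Local Notation S := (hsiao n G).
Local Notation kS := (hsiao_alg k n G).
Local Notation kG := (group_alg k G).
Implicit Types (A B : lmodType kS) (s t e f : S).

Lemma hsiao_actM A s t (y : A) :
  hsiao_elt k s *: (hsiao_elt k t *: y) = hsiao_elt k (s * t)%g *: y.
Proof. exact: ma_elt_act. Qed.

Lemma hsiao_act1 A (y : A) : hsiao_elt k 1%g *: y = y.
Proof. exact: ma_elt1_act. Qed.

(* The simple modules of apex e: every idempotent acts as 0 or as the identity,
   the latter exactly when its blocks are unions of blocks of e. *)
Definition typed e A := htriv e /\ forall s (y : A),
  (hge s e -> htriv s -> hsiao_elt k s *: y = y) /\
  (~~ hge s e -> hsiao_elt k s *: y = 0).

Lemma typed_triv e A : typed e A -> htriv e.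
Proof. by case. Qed.

Lemma typed_id e A s (y : A) : typed e A -> hge s e -> htriv s -> hsiao_elt k s *: y = y.
Proof. by case=> _ /(_ s y)[]. Qed.

Lemma typed_0 e A s (y : A) : typed e A -> ~~ hge s e -> hsiao_elt k s *: y = 0.
Proof. by case=> _ /(_ s y)[]. Qed.

Lemma typed_e e A (y : A) : typed e A -> hsiao_elt k e *: y = y.
Proof. by move=> hA; apply: (typed_id _ hA) (typed_triv hA); exact: hge_refl. Qed.

Lemma typed_eqv e e' A : typed e A -> htriv e' -> hge e e' -> hge e' e -> typed e' A.
Proof.
move=> [te hA] te' ee' e'e; split=> // s y; have [h1 h2] := hA s y.
split=> [se'|se']; first by apply: h1; exact: hge_trans e'e.
by apply: h2; apply: contra se' => se; exact: hge_trans ee'.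
Qed.

Lemma typed_hge e e' A : typed e A -> typed e' A -> (exists y : A, y != 0) -> hge e e'.
Proof.
move=> hA hA' [y y0]; apply: contraNT y0 => ee'.
by rewrite -(typed_e y hA) (typed_0 y hA' ee').
Qed.

Lemma typed_gpart r (P : 'I_r -> {set 'I_n}) (hP : ordered_partition (codom P))
    A s (y : A) (h : 'I_r -> G) :
    typed (gpart hP (fun=> 1%g)) A -> hge s (gpart hP (fun=> 1%g)) ->
    (forall a i, i \in P a -> hlab s i = h a) ->
  hsiao_elt k s *: y = hsiao_elt k (gpart hP h) *: y.
Proof.
move=> hA se hE; rewrite -[LHS](typed_e _ hA) hsiao_actM (gpart_mulr _ se hE).
by congr (hsiao_elt k (gpart hP _) *: y); apply/funext => c; rewrite mul1g.
Qed.

Lemma simple_triv A e : simple_module A -> htriv e ->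
  (forall y : A, hsiao_elt k e *: y = y) \/ (forall y : A, hsiao_elt k e *: y = 0).
Proof.
move=> [_ sA] te; case: (sA [pred y | hsiao_elt k e *: y == 0]) => [|h|h].
- apply: ma_submod => [|a x y|s x]; rewrite !inE /=; first by rewrite scaler0.
    move=> /eqP ex /eqP ey; have := act_linear (hsiao_elt k e) a x y.
    by rewrite ex ey scaler0 addr0 => ->.
  move=> /eqP ex; rewrite -[ma_elt k s]/(hsiao_elt k s) hsiao_actM -(triv_mulK s te).
  by rewrite -hsiao_actM ex scaler0.
- left=> y; apply/eqP; rewrite -subr_eq0; apply/eqP/h.
  by rewrite inE /= scalerBr hsiao_actM triv_idem // subrr.
- by right=> y; have := h y; rewrite inE => /eqP.
Qed.

Lemma simple_typed A : simple_module A -> exists e, typed e A.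
Proof.
move=> sA; have [[y0 y00] _] := sA.
pose idA e := htriv e && `[< forall y : A, hsiao_elt k e *: y = y >].
have tri e : htriv e -> ~~ idA e -> forall y : A, hsiao_elt k e *: y = 0.
  by move=> te; rewrite /idA te /=; case: (simple_triv sA te) => // h /asboolP.
suff [e [/andP[te /asboolP ey] emin]] : exists e, idA e /\ forall s, idA s -> hge s e.
  exists e; split=> // s y; split=> [se ts|se].
    have -> : hsiao_elt k s *: y = hsiao_elt k (e * s)%g *: y by rewrite -hsiao_actM ey.
    by rewrite mul_ge // ey.
  have ns : ~~ idA (hidem s) by apply: contra se => /emin; rewrite hge_hidem.
  by rewrite -[s]hidem_mull -hsiao_actM (tri _ (htriv_hidem s) ns).
(* The apex is the product of all idempotents acting as the identity, accumulated along an
   enumeration of the monoid. *)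
suff [e [ide emin]] : exists e, idA e /\ forall s, s \in enum {: S} -> idA s -> hge s e.
  by exists e; split=> // s; apply: emin; rewrite mem_enum.
elim: (enum {: S}) => [|s r [e [/andP[te /asboolP ey] emin]]].
  exists 1%g; split=> //; rewrite /idA htriv1; apply/asboolP => y.
  exact: hsiao_act1.
case ids : (idA s); last first.
  exists e; split=> [|t]; first by rewrite /idA te; apply/asboolP.
  by rewrite inE => /predU1P[->|]; [rewrite ids | exact: emin].
have /andP[ts /asboolP sy] := ids.
exists (e * s)%g; split.
  rewrite /idA htrivM //; apply/asboolP => y.
  by rewrite -hsiao_actM sy ey.
have /andP[ge_e ge_s] : hge e (e * s)%g && hge s (e * s)%g.
  by rewrite -hgeM hge_refl.
move=> t; rewrite inE => /predU1P[-> _|tr idt] //.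
exact: hge_trans (emin t tr idt) ge_e.
Qed.

(** * Modules of apex e as modules over the group of units of eSe *)

Section BlockModules.
Variables (r : nat) (P : 'I_r -> {set 'I_n}) (hP : ordered_partition (codom P)).
Local Notation H := {dffun forall _ : 'I_r, G}.
Local Notation kH := (group_alg k H).
Local Notation e := (gpart hP (fun=> 1%g)).

(** As e acts as the identity, eA is all of A, so that G_e, here G^r, acts on the whole of A. *)
Definition block_action A (hA : typed e A) : maction (@mulg H) (restr A).
Proof.
apply: (@MAction k H 1%g (@mulg H) (restr A) (fun g y => hsiao_elt k (gpart hP g) *: (y : A))).
- by move=> g; exact: act_linear.
- move=> y; rewrite -[RHS](typed_e y hA); congr (hsiao_elt k (gpart hP _) *: _).
  by apply/funext => i; rewrite ffunE.
- move=> g h y; rewrite hsiao_actM gpartM; congr (hsiao_elt k (gpart hP _) *: _).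
  by apply/funext => i; rewrite ffunE.
Defined.

Definition block_module A (hA : typed e A) : lmodType kH := actmod (block_action hA).

Lemma block_moduleE A (hA : typed e A) (g : H) (y : block_module hA) :
  group_elt k g *: y = hsiao_elt k (gpart hP g) *: (y : A).
Proof. exact: actmod_elt. Qed.

Lemma block_moduleZ A (hA : typed e A) (c : k) (y : restr (block_module hA)) :
  c *: y = c *: (y : restr A).
Proof. exact: actmod_restrZ. Qed.

Lemma typed_act A (hA : typed e A) s (y : A) : hge s e ->
  exists h : H, hsiao_elt k s *: y = hsiao_elt k (gpart hP h) *: y.
Proof.
move=> se; have /fin_all_exists[c cP] := gpart_nonempty G hP.
exists [ffun a => hlab s (c a)]; apply: (typed_gpart _ hA se) => a i ia.
rewrite ffunE; apply: hlab_heq; apply: (hgeP _ _ se).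
exact: gpart_heq ia (cP a).
Qed.

Lemma block_linear A B (hA : typed e A) (hB : typed e B) (f : {linear block_module hA ->
  block_module hB}) :
  linear (f : A -> B).
Proof.
apply: ma_linear => [a x y|s y].
  have := linearP f (a%:A) x y; rewrite -!restrZE.
  by rewrite (block_moduleZ (hA := hA)) (block_moduleZ (hA := hB)).
rewrite -[ma_elt k s]/(hsiao_elt k s); case: (boolP (hge s e)) => se; last first.
  by rewrite !(typed_0 _ _ se) // raddf0.
have /fin_all_exists[c cP] := gpart_nonempty G hP.
pose h : H := [ffun a => hlab s (c a)].
have hE a i : i \in P a -> hlab s i = h a.
  move=> ia; rewrite ffunE; apply: hlab_heq; apply: (hgeP _ _ se).
  exact: gpart_heq ia (cP a).
rewrite (typed_gpart _ hA se hE) (typed_gpart _ hB se hE).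
by rewrite -(block_moduleE (hA := hA)) linearZ /= (block_moduleE (hA := hB)).
Qed.

(** By [typed_act] every s acts either as 0 or as an element of G_e, so a submodule for k[G^r] is a
    submodule for kS. *)
Lemma block_simple A (hA : typed e A) : simple_module A -> simple_module (block_module hA).
Proof.
move=> [nA sA]; split=> // X [X0 XP]; apply: sA.
apply: ma_submod => // [a x y xX yX|s x xX].
  by have := XP a%:A x y xX yX; rewrite -restrZE block_moduleZ.
rewrite -[ma_elt k s]/(hsiao_elt k s); case: (boolP (hge s e)) => se; last first.
  by rewrite (typed_0 _ hA).
have [h ->] := typed_act hA x se.
rewrite -(block_moduleE (hA := hA)) -[_ *: _]addr0; exact: XP.
Qed.

Definition inflate_lab s (a : 'I_r) : G :=
  if [pick i in P a] is Some i then hlab s i else 1%g.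

Lemma inflate_labE s a i : hge s e -> i \in P a -> hlab s i = inflate_lab s a.
Proof.
move=> se ia; rewrite /inflate_lab; case: pickP => [j ja|/(_ i)]; last by rewrite ia.
apply: hlab_heq; apply: (hgeP _ _ se).
exact: gpart_heq ia ja.
Qed.

Lemma inflate_labM s t a : inflate_lab (s * t)%g a = (inflate_lab s a * inflate_lab t a)%g.
Proof.
rewrite /inflate_lab; case: pickP => [i _|]; last by rewrite mulg1.
by rewrite hlabM.
Qed.

(** The inverse of [block_module]: elements not coarser than e act as 0. This is an action because a
    product is coarser than e if and only if both factors are ([hgeM]). *)
Definition inflate_action (T : lmodType kH) : @maction k S (1%g : S) (@mulg S) (restr T).
Proof.
apply: (@MAction k S (1%g : S) (@mulg S) (restr T) (fun s y =>
  if hge s e then group_elt k ([ffun a => inflate_lab s a] : H) *: (y : T) else 0)).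
- move=> s; case: (hge s _); first exact: act_linear.
  by move=> a x y; rewrite scaler0 addr0.
- move=> y; rewrite hge1 (_ : [ffun a => inflate_lab 1%g a] = 1%g :> H).
    exact: ma_elt1_act.
  apply/ffunP => a; rewrite !ffunE /inflate_lab; case: pickP => // i _.
  by rewrite hlab1.
- move=> s t y; rewrite hgeM; case: ifP => [/andP[-> ->]|].
    rewrite /group_elt ma_elt_act; congr (ma_elt k _ *: _).
    by apply/ffunP => a; rewrite !ffunE inflate_labM.
  by case: (hge s e) => //= ->; rewrite scaler0.
Defined.

Definition inflate (T : lmodType kH) : lmodType kS := actmod (inflate_action T).

Lemma inflateE (T : lmodType kH) s (y : inflate T) : hsiao_elt k s *: y =
  if hge s e then group_elt k ([ffun a => inflate_lab s a] : H) *: (y : T) else 0.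
Proof. exact: actmod_elt. Qed.

Lemma inflateZ (T : lmodType kH) (c : k) (y : restr (inflate T)) :
  c *: y = c *: (y : restr T).
Proof. exact: actmod_restrZ. Qed.

Lemma inflate_typed (T : lmodType kH) : typed e (inflate T).
Proof.
split=> [|s y]; first exact: htriv_gpart1.
split=> [se /htrivP ts|/negPf se]; rewrite inflateE se //.
rewrite (_ : [ffun a => inflate_lab s a] = 1%g :> H); first exact: (ma_elt1_act (y : T)).
apply/ffunP => a; rewrite !ffunE /inflate_lab; case: pickP => // i _.
Qed.

Lemma inflate_block (T : lmodType kH) :
  module_isomorphic T (block_module (inflate_typed T)).
Proof.
have /linear_bundle[f fE] : linear ((fun y => y) : T -> block_module (inflate_typed T)).
  apply: ma_linear => [a x y|g y].
    by rewrite block_moduleZ inflateZ.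
  rewrite -[ma_elt k g]/(group_elt k g) block_moduleE inflateE.
  rewrite (_ : hge _ _ = true); last first.
    by apply/hgeP => i j; rewrite /heq !(hle_gpart hP g (fun=> 1%g)).
  rewrite (_ : [ffun a => _] = g) //; apply/ffunP => a; rewrite ffunE.
  rewrite /inflate_lab; case: pickP => [i ia|].
    by rewrite (hlab_gpart hP g ia).
  by have [i ia] := gpart_nonempty G hP a => /(_ i); rewrite ia.
by exists f; exists (fun y => y) => y; rewrite fE.
Qed.

Lemma inflate_simple (T : lmodType kH) : simple_module T -> simple_module (inflate T).
Proof.
move=> /(simple_iso (inflate_block T))[nT sT]; split=> // X [X0 XP]; apply: sT.
apply: ma_submod => // [a x y xX yX|g x xX].
  by rewrite block_moduleZ; exact: (XP a%:A x y xX yX).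
rewrite -[ma_elt k g]/(group_elt k g) block_moduleE -[_ *: _]addr0.
exact: XP.
Qed.

End BlockModules.

End HsiaoModules.

(** * Classification of the simple modules *)

Section Affords.
Variables (k : closedFieldType) (n : nat) (G : finGroupType).
Local Notation S := (hsiao n G).
Local Notation kS := (hsiao_alg k n G).
Local Notation kG := (group_alg k G).
Local Notation LP := (labelled_partition n (Irr kG)).
Implicit Types (A B : lmodType kS) (e f : S) (L M : LP).
Local Notation pr r := (fun (i : 'I_r) (h : {dffun forall _ : 'I_r, G}) => h i).

(** An enumeration of the blocks of L and their labels, with a representative of each label: the
    choice that [affords] hides behind an existential. *)
Definition ordering L r (P : 'I_r -> {set 'I_n}) (x : 'I_r -> Irr kG)
    (V : 'I_r -> lmodType kG) :=
  (forall Q y, sval L Q y <-> exists i, Q = P i /\ y = x i) /\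
  forall i, sval (x i) (V i).

Lemma ordering_simple L r (P : 'I_r -> {set 'I_n}) x V :
  ordering L P x V -> forall i, simple_module (V i).
Proof. by move=> [_ xV] i; exact: irr_simple (xV i). Qed.

Lemma affordsI L A r (P : 'I_r -> {set 'I_n}) (hP : ordered_partition (codom P)) x V
    (hA : typed (gpart hP (fun=> 1%g)) A) :
    ordering L P x V -> is_tensor_module (pr r) V (block_module hA) ->
  affords L A.
Proof.
move=> [LP xV] tA; exists r, P, hP, x, V; split=> //.
  exists (block_module hA) => //.
  have /linear_bundle[f fE] : linear ((fun y => y) : restr (block_module hA) -> restr A).
    by move=> a u v; rewrite block_moduleZ.
  exists f; split=> [u v|y|g t]; rewrite ?fE //.
    split=> [[t <-]|[z ->]]; last by exists (z : A); rewrite fE (typed_e _ hA).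
    by exists (t : A); rewrite fE (typed_e _ hA).
  exact: block_moduleE.
move=> f y _ /(tsi_proper_ge (htriv_gpart1 G hP)); exact: typed_0.
Qed.

Lemma affordsE L A : simple_module A -> affords L A ->
  exists (r : nat) (P : 'I_r -> {set 'I_n}) (hP : ordered_partition (codom P)) x V
    (hA : typed (gpart hP (fun=> 1%g)) A),
    ordering L P x V /\ is_tensor_module (pr r) V (block_module hA).
Proof.
move=> sA [r [P [hP [x [V [LP xV [T tT [iota [iinj iim iE]]] f0]]]]]].
set e := gpart hP _ in iim f0.
have sT : simple_module T by apply: tensor_simple tT => i; exact: irr_simple (xV i).
have te : htriv e by exact: htriv_gpart1.
have [t t0] : exists t : T, t != 0 by case: sT.
have it0 : iota t != 0 by apply: contra_neq t0 => it; apply: iinj; rewrite it linear0.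
have eid (y : A) : hsiao_elt k e *: y = y.
  case: (simple_triv sA te) => // e0; case/eqP: it0.
  by have [/(_ (ex_intro _ t erefl))[z ->] _] := iim (iota t); rewrite e0.
have [e' hA'] := simple_typed sA.
have te' := typed_triv hA'.
(* The apex e' has the same blocks as e. Otherwise either e e' generates a smaller ideal than e and
   acts as 0, although both factors act as 1, or e itself acts as 0. *)
have hA : typed e A.
  apply: (typed_eqv hA' te).
    apply: contraT => e'e; case/eqP: it0.
    have := f0 (e * e')%g (iota t) (triv_idem (htrivM te te')) (tsi_mul_proper e'e).
    by rewrite -hsiao_actM (typed_e _ hA') eid.
  by apply: contraT => ee'; case/eqP: it0; rewrite -(eid (iota t)) (typed_0 _ hA').
exists r, P, hP, x, V, hA; split=> //; apply: tensor_module_isor tT.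
have /linear_bundle[f fE] : linear (iota : T -> block_module hA).
  apply: ma_linear => [a u v|g v]; first by rewrite block_moduleZ linearP.
  by rewrite -[ma_elt k g]/(group_elt k g) block_moduleE iE.
exists f; apply: (hom_iso (x := t)) => //; last by rewrite fE.
exact: block_simple.
Qed.

Lemma gpart_hge r (P : 'I_r -> {set 'I_n}) (hP : ordered_partition (codom P))
    r' (P' : 'I_r' -> {set 'I_n}) (hP' : ordered_partition (codom P')) :
  (forall i, exists i', P i = P' i') ->
  hge (gpart hP' (fun=> 1%g : G)) (gpart hP (fun=> 1%g)).
Proof.
move=> PP'; apply/hgeP => i j ij.
have [a ia] := gpart_block_ex G hP i; have [a' aa'] := PP' a.
apply: (gpart_heq hP' _ (a := a')); rewrite -aa' //.
exact: gpart_heq_mem ia ij.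
Qed.

Lemma gpart_same_blocks r (P : 'I_r -> {set 'I_n}) (hP : ordered_partition (codom P))
    r' (P' : 'I_r' -> {set 'I_n}) (hP' : ordered_partition (codom P')) :
  hge (gpart hP (fun=> 1%g : G)) (gpart hP' (fun=> 1%g)) ->
  hge (gpart hP' (fun=> 1%g : G)) (gpart hP (fun=> 1%g)) ->
  forall i, exists i', P i = P' i'.
Proof.
move=> /hgeP h1 /hgeP h2 a; have [i ia] := gpart_nonempty G hP a.
have [a' ia'] := gpart_block_ex G hP' i; exists a'.
rewrite (gpart_block hP (fun=> 1%g : G) ia) (gpart_block hP' (fun=> 1%g : G) ia').
by apply/finset.setP => j; rewrite !inE; apply/idP/idP; [exact: h2 | exact: h1].
Qed.

Lemma cut_single A r (P : 'I_r -> {set 'I_n}) (hP : ordered_partition (codom P))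
    (a : 'I_r) (g : G) (z : A) : typed (gpart hP (fun=> 1%g)) A ->
  hsiao_elt k (gpart hP (single a g)) *: z = hsiao_elt k (cut (P a) g) *: z.
Proof.
move=> hA; have [i0 i0a] := gpart_nonempty G hP a.
have bP : block (gpart hP (fun=> 1%g : G)) (P a).
  by apply/blockP; exists i0; exact: gpart_block.
apply/esym/typed_gpart => //; first exact: hge_cut_of_block.
move=> b i ib; rewrite hlab_cut ffunE; case: eqVneq => [->|ab]; first by rewrite ib.
by case: ifP => // ia; case/eqP: ab; exact: (gpart_disjoint G hP ia ib).
Qed.

(** Varying slot a alone in a pure tensor that Delta does not kill yields a nonzero kG-map from
    [V a] to the factor of B at the same block. With Delta the identity this makes labels unique;
    with Delta equivariant it shows that the label of an unmerged block cannot change. *)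
Lemma label_iso A B r (P : 'I_r -> {set 'I_n}) (hP : ordered_partition (codom P))
    r' (P' : 'I_r' -> {set 'I_n}) (hP' : ordered_partition (codom P')) V V'
    (hA : typed (gpart hP (fun=> 1%g)) A) (hB : typed (gpart hP' (fun=> 1%g)) B)
    (a : 'I_r) (a' : 'I_r') (Delta : restr A -> restr B) y :
    (forall i, simple_module (V i)) -> (forall i, simple_module (V' i)) ->
    is_tensor_module (pr r) V (block_module hA) ->
    is_tensor_module (pr r') V' (block_module hB) -> P a = P' a' ->
    linear Delta ->
    (forall g (z : A), Delta (hsiao_elt k (cut (P a) g) *: z) =
      hsiao_elt k (cut (P a) g) *: (Delta z : B)) ->
    Delta y != 0 -> module_isomorphic (V a) (V' a').
Proof.
move=> sV sV' [tau [tT tE]] tB aa' lD eD Dy.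
have [v0 v0n] : exists v0, Delta (tau v0) != 0.
  apply/not_existsP => h; case/eqP: Dy.
  apply: (tensor_extf tT (h := Delta) (h' := fun=> 0)) => [c u w|c u w|v].
  - by rewrite block_moduleZ lD.
  - by rewrite scaler0 addr0.
  - by apply/eqP/negPn/negP => /h.
have /linear_bundle[f fE] : linear ((fun v => Delta (tau (dfwith v0 v))) :
    V a -> factor_module (block_module hB) a').
  apply: (ma_linear (M := V a) (N := factor_module (block_module hB) a')) => [c u w|g v].
    by rewrite factorZ block_moduleZ (multilinear_lin v0 tT.1) block_moduleZ lD.
  rewrite -[ma_elt k g]/(group_elt k g) factorE block_moduleE (cut_single _ _ _ hB) -aa' -eD.
  have := tE (single a g) (dfwith v0 v); rewrite block_moduleE (cut_single _ _ _ hA) => ->.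
  congr (Delta (tau _)); apply: functional_extensionality_dep => i; rewrite ffunE.
  case: (eqVneq a i) => [<-|ai]; first by rewrite !dfwith_in.
  by rewrite !dfwith_out //; apply/esym; exact: ma_elt1_act.
have fv : f (v0 a) != 0 by rewrite fE dfwith_id.
exact: tensor_factor_iso sV' tB (sV a) fv.
Qed.

Lemma affords_sub L M A : simple_module A -> affords L A -> affords M A ->
  forall Q y, sval L Q y -> sval M Q y.
Proof.
move=> sA /(affordsE sA)[r [P [hP [x [V [hA [ordL tL]]]]]]].
move=> /(affordsE sA)[r' [P' [hP' [x' [V' [hA' [ordM tM]]]]]]] Q y.
have [LP xV] := ordL; have [MP xV'] := ordM.
have nA : exists y : A, y != 0 by case: sA.
case/LP => a [-> ->].
have [a' aa'] := gpart_same_blocks (typed_hge hA hA' nA) (typed_hge hA' hA nA) a.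
apply/MP; exists a'; split=> //; have [y0 y0n] := nA.
have iso := label_iso (Delta := idfun) (ordering_simple ordL) (ordering_simple ordM) tL tM aa'.
by apply: irr_eq (irr_closed (xV a) (iso y0 _ _ y0n)) (xV' a').
Qed.

Lemma affords_unique L M A : simple_module A -> affords L A -> affords M A -> L = M.
Proof.
move=> sA aL aM; have h1 := affords_sub sA aL aM; have h2 := affords_sub sA aM aL.
case: L M {aL aM} h1 h2 => [L hL] [M hM] /= h1 h2; apply: eq_exist.
by apply/funext => Q; apply/funext => y; apply/propext; split; [exact: h1 | exact: h2].
Qed.

Lemma ordering_of r (P : 'I_r -> {set 'I_n}) (hP : ordered_partition (codom P))
    (V : 'I_r -> lmodType kG) : (forall i, simple_module (V i)) ->
  exists L x, ordering L P x V.
Proof.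
move=> sV; have /fin_all_exists[x xV] : forall i, exists x : Irr kG, sval x (V i).
  by move=> i; exact: irr_of.
suff hL : is_labelled_partition (fun Q y => exists i, Q = P i /\ y = x i).
  by exists (exist _ _ hL), x.
split=> [|Q y z [i [-> ->]] [j [ij ->]]]; last by rewrite (gpart_inj hP ij).
have [_ pP] := andP hP.
rewrite (_ : [set Q | _]%SET = [set:: codom P]%SET) //; apply/finset.setP => Q.
rewrite !inE; apply/asboolP/idP => [[y [i [-> _]]]|/codomP[i ->]].
  exact: codom_f.
by exists (x i), i.
Qed.

Lemma affords_via A r (P : 'I_r -> {set 'I_n}) (hP : ordered_partition (codom P))
    (hA : typed (gpart hP (fun=> 1%g)) A) : simple_module A ->
  exists L x V, [/\ ordering L P x V, is_tensor_module (pr r) V (block_module hA) &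
    affords L A].
Proof.
move=> sA; have [V sV tV] := simple_is_tensor (block_simple hA sA).
have [L [x ord]] := ordering_of hP sV.
by exists L, x, V; split=> //; exact: affordsI ord tV.
Qed.

Lemma simple_affords A : simple_module A -> exists L, affords L A.
Proof.
move=> sA; have [e hA] := simple_typed sA.
have [r [P [hP eE]]] := hsiao_gpart (typed_triv hA); rewrite {}eE in hA.
by have [L [x [V [_ _ aL]]]] := affords_via hA sA; exists L.
Qed.

Lemma block_iso A B r (P : 'I_r -> {set 'I_n}) (hP : ordered_partition (codom P))
    (hA : typed (gpart hP (fun=> 1%g)) A) (hB : typed (gpart hP (fun=> 1%g)) B) :
  module_isomorphic (block_module hA) (block_module hB) -> module_isomorphic A B.
Proof.
move=> [f [g fK gK]]; have [h hE] := linear_bundle (block_linear f).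
by exists h; exists g => y; rewrite hE.
Qed.

(** The module can be read along any enumeration of L: decomposing it along the given one produces a
    labelled partition that is L by uniqueness. *)
Lemma affords_reorder L A r (P : 'I_r -> {set 'I_n}) (hP : ordered_partition (codom P)) x V :
    simple_module A -> affords L A -> ordering L P x V ->
  exists hA : typed (gpart hP (fun=> 1%g)) A, is_tensor_module (pr r) V (block_module hA).
Proof.
move=> sA aL ord; have [r' [P' [hP' [x' [V' [hA' [ord' _]]]]]]] := affordsE sA aL.
have [LP xV] := ord; have [LP' _] := ord'.
have PP' i : exists i', P i = P' i'.
  by have /LP'[i' [-> _]] : sval L (P i) (x i) by [apply/LP; exists i]; exists i'.
have P'P i : exists i', P' i = P i'.
  by have /LP[i' [-> _]] : sval L (P' i) (x' i) by [apply/LP'; exists i]; exists i'.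
have hA : typed (gpart hP (fun=> 1%g)) A.
  apply: (typed_eqv hA' (htriv_gpart1 G hP)).
    exact: gpart_hge.
  exact: gpart_hge.
exists hA; have [L2 [x2 [V2 [ord2 t2 aL2]]]] := affords_via hA sA.
have LL2 := affords_unique sA aL aL2; subst L2.
apply: tensor_module_isol t2 => i; apply: (irr_iso (x := x i)) (xV i).
have [LP2 xV2] := ord2.
suff -> : x i = x2 i by exact: xV2.
have /LP2[j [ij ->]] : sval L (P i) (x i) by apply/LP; exists i.
by rewrite (gpart_inj hP ij).
Qed.

Lemma affords_iso L A B : simple_module A -> simple_module B ->
  affords L A -> affords L B -> module_isomorphic A B.
Proof.
move=> sA sB aA aB; have [r [P [hP [x [V [hA [ord tA]]]]]]] := affordsE sA aA.
have [hB tB] := affords_reorder hP sB aB ord.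
apply: (block_iso (hA := hA) (hB := hB)); exact: tensor_module_unique tA tB.
Qed.

Lemma affords_closed L A B : simple_module A -> module_isomorphic A B ->
  affords L A -> affords L B.
Proof.
move=> sA AB aA; have sB := simple_iso AB sA.
have [r [P [hP [x [V [hA [ord tA]]]]]]] := affordsE sA aA.
have hB : typed (gpart hP (fun=> 1%g)) B.
  have [f [g fK gK]] := AB; have [te hA2] := hA; split=> // s y.
  have [h1 h2] := hA2 s (g y); split=> [se ts|se].
    by rewrite -(gK y) -linearZ h1.
  by rewrite -(gK y) -linearZ h2 // linear0.
apply: (affordsI (hA := hB) ord); apply: tensor_module_isor tA.
have [f fb] := AB.
have /linear_bundle[f' fE] : linear (f : block_module hA -> block_module hB).
  apply: ma_linear => [a u v|g v]; first by rewrite !block_moduleZ; exact: (restr_linear f).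
  by rewrite -[ma_elt k g]/(group_elt k g) !block_moduleE linearZ.
by exists f'; case: fb => g fK gK; exists g => y; rewrite fE.
Qed.

Lemma ordering_ex L : exists r (P : 'I_r -> {set 'I_n}) (hP : ordered_partition (codom P)) x V,
  ordering L P x V.
Proof.
have [pL uL] := svalP L.
set D := [set P | _]%SET in pL.
pose P (i : 'I_#|D|) : {set 'I_n} := enum_val i.
have hP : ordered_partition (codom P).
  rewrite /ordered_partition; have -> : uniq (codom P).
    by rewrite map_inj_uniq ?enum_uniq //; exact: enum_val_inj.
  rewrite (_ : [set:: codom P]%SET = D) //; apply/finset.setP => Q; rewrite !inE.
  apply/codomP/idP => [[i ->]|QD]; first by have := enum_valP i; rewrite inE.
  have QD' : Q \in D by rewrite inE.
  by exists (enum_rank_in QD' Q); rewrite /P enum_rankK_in.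
have /fin_all_exists[x xP] : forall i, exists x, sval L (P i) x.
  by move=> i; have := enum_valP i; rewrite inE => /asboolP.
have /fin_all_exists[V xV] : forall i, exists V, sval (x i) V.
  by move=> i; exact: irr_ex.
exists _, P, hP, x, V; split=> // Q y; split=> [LQ|[i [-> ->]]] //.
have QD : Q \in D by rewrite inE; apply/asboolP; exists y.
exists (enum_rank_in QD Q); rewrite /P enum_rankK_in //; split=> //.
apply: (uL Q) => //; have := xP (enum_rank_in QD Q).
by rewrite /P enum_rankK_in.
Qed.

Lemma affords_ex L : exists2 A, simple_module A & affords L A.
Proof.
have [r [P [hP [x [V ord]]]]] := ordering_ex L.
have [T tT sT] := tensor_module_simple_ex (ordering_simple ord).
exists (inflate hP T); first exact: inflate_simple.
by apply: (affordsI (hA := inflate_typed hP T) ord); apply: tensor_module_isor tT;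
  exact: inflate_block.
Qed.

Lemma corresponds_bij1 L : exists! x : Irr kS, corresponds L x.
Proof.
have [A sA aA] := affords_ex L; have [x xA] := irr_of sA; exists x; split.
  by move=> B xB; apply: affords_closed aA => //; exact: irr_iso xA xB.
move=> y cy; have [B yB] := irr_ex y; have sB := irr_simple yB.
have iso := affords_iso sA sB aA (cy B yB).
exact: irr_eq (irr_closed xA iso) yB.
Qed.

Lemma corresponds_bij2 (x : Irr kS) : exists! L : LP, corresponds L x.
Proof.
have [A xA] := irr_ex x; have sA := irr_simple xA; have [L aL] := simple_affords sA.
exists L; split=> [B xB|M cM].
  by apply: affords_closed aL => //; exact: irr_iso xA xB.
exact: affords_unique aL (cM A xA).
Qed.

End Affords.

(** * Ext and derivations *)

(** c induces an isomorphism from Z / B to Z', along which representatives of a basis are pulled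
    back. *)
Lemma subquot_dim_transfer (k : fieldType) (V W : lmodType k) (Z B : set V)
    (Z' : set W) (c : V -> W) d :
    (forall a z z', Z z -> Z z' -> Z (a *: z + z') /\ c (a *: z + z') = a *: c z + c z') ->
    (forall z, Z z -> Z' (c z)) ->
    (forall w, Z' w -> exists2 z, Z z & c z = w) ->
    (forall z, Z z -> (B z <-> c z = 0)) ->
  subquot_dim Z' (fun w => w = 0) d -> subquot_dim Z B d.
Proof.
move=> Zl cZ conto cB [e' [e'Z e'P]].
have /choice[e eP] : forall i, exists z, Z z /\ c z = e' i.
  by move=> i; have [z Zz cz] := conto _ (e'Z i); exists z.
exists e; split=> [i|z Zz]; first by case: (eP i).
have key (r : 'rV[k]_d) : Z (z - \sum_i r 0 i *: e i) /\
    c (z - \sum_i r 0 i *: e i) = c z - \sum_i r 0 i *: e' i.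
  elim: (index_enum _) => [|i s [Zs cs]]; first by rewrite !big_nil !subr0.
  have E (U : lmodType k) (x y u : U) : x - (r 0 i *: y + u) = - r 0 i *: y + (x - u).
    by rewrite opprD addrCA scaleNr.
  have [Zi ci] := eP i; have [Z1 c1] := Zl (- r 0 i) _ _ Zi Zs.
  by rewrite !big_cons !E c1 cs ci.
have [r [r0 ru]] := e'P _ (cZ _ Zz); exists r; split=> [|r'].
  by have [Zr cr] := key r; apply/(cB _ Zr); rewrite cr.
by have [Zr cr] := key r' => /(cB _ Zr); rewrite cr; exact: ru.
Qed.

Section Derivations.
Variables (k : fieldType) (S : finType) (e : S) (op : Monoid.law e).
Local Notation kS := (malg k op).
Local Notation elt s := (ma_elt k s : kS).
Variables (M N : lmodType kS).
Implicit Types (D : S -> M -> restr N).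

(** A derivation with values in the bimodule Hom_k(M, N), where S acts on the left through N and on
    the right through M. *)
Definition derivation D := (forall s, linear (D s : restr M -> restr N)) /\
  forall s t m, D (op s t) m = elt s *: (D t m : N) + D s (elt t *: m).

Definition inner_derivation (phi : restr M -> restr N) : S -> M -> restr N :=
  fun s m => elt s *: (phi m : N) - phi (elt s *: m).

Definition inner D := exists2 phi, linear phi & D = inner_derivation phi.

Lemma inner_derivationP phi : linear phi -> derivation (inner_derivation phi).
Proof.
move=> lp; have [p pE] := linear_bundle lp; split=> [s a x y|s t m]; rewrite /inner_derivation.
  by rewrite !actP !lp actP scalerBr opprD addrACA.
by rewrite scalerBr !ma_elt_act addrA subrK.
Qed.

Section Ext.
Variables (d' : nat) (b : 'I_d' -> restr M) (cb : 'I_d' -> restr M -> k).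
Hypothesis bc : is_basis b cb.

(** c stands for an isomorphism from derivations modulo inner ones to Z'. The basis of M provides a
    k-linear section of the augmentation. *)
Lemma ext1_of_derivations (W : lmodType k) (Z' : set W) (c : (S -> M -> restr N) -> W) d :
    (forall a D D', derivation D -> derivation D' -> c (a *: D + D') = a *: c D + c D') ->
    (forall D, derivation D -> Z' (c D)) ->
    (forall w, Z' w -> exists2 D, derivation D & c D = w) ->
    (forall D, derivation D -> (inner D <-> c D = 0)) ->
    subquot_dim Z' (fun w => w = 0) d ->
  ext1_dim M N d.
Proof.
move=> cl cZ conto cin dZ' R.
pose P0 := res_mod R 0; pose P1 := res_mod R 1.
pose d0 : {linear P1 -> P0} := res_diff R 0; pose aug : {linear P0 -> M} := res_aug R.
have [cl' bE _] := bc.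
have /choice[p pE] : forall i, exists p : P0, aug p = b i by move=> i; exact: res_aug_surj.
have [cb' cbE] := is_basis_lin bc.
have [sg sgE] : exists sg : {linear restr M -> restr P0}, forall m, aug (sg m) = m.
  have /linear_bundle[sg sgE] : linear (fun m : restr M => \sum_i cb i m *: (p i : restr P0)).
    move=> a x y; rewrite scaler_sumr -big_split; apply: eq_bigr => i _ /=.
    by rewrite cl' scalerDl scalerA.
  have /linear_bundle[aug' augE] := restr_linear aug.
  exists sg => m; rewrite sgE -augE linear_sum [RHS]bE; apply: eq_bigr => i _.
  by rewrite linearZ /= augE pE.
have augL a (x y : restr P0) : aug (a *: x + y) = a *: (aug x : restr M) + aug y :> restr M.
  exact: (restr_linear aug).
have d0L a (x y : restr P1) : d0 (a *: x + y) = a *: (d0 x : restr P0) + d0 y :> restr P0.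
  exact: (restr_linear d0).
(* [lift] picks preimages under [d0] on ker aug and is arbitrary elsewhere. By exactness, for a
   cocycle f the value [f (lift q)] does not depend on the choice, and so is linear in q on ker
   aug. *)
have /choice[lift liftE] : forall q : P0, exists y, aug q = 0 -> d0 y = q.
  move=> q; case: (pselect (aug q = 0)) => [/res_exact0[y yq]|nq]; first by exists y.
  by exists 0.
pose cocycle := @ext1_cocycle k kS M N R.
have fl f y q : cocycle f -> d0 y = q -> f (lift q) = f y.
  move=> [lf f1] yq; have [f' fE] := linear_bundle lf.
  have q0 : aug q = 0 by apply/res_exact0; exists y.
  apply/eqP; rewrite -subr_eq0 -!fE -linearB fE.
  have /res_exact[z <-] : d0 (lift q - y) = 0 by rewrite linearB liftE // yq subrr.
  by rewrite f1.
have fl_lin f a (x y : restr P0) : cocycle f -> aug x = 0 -> aug y = 0 ->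
    f (lift (a *: x + y)) = a *: f (lift x) + f (lift y).
  move=> cf x0 y0; have [lf _] := cf; have [f' fE] := linear_bundle lf.
  rewrite (fl f (a *: (lift x : restr P1) + lift y)) //; last by rewrite d0L !liftE.
  by rewrite -!fE; exact: (restr_linear f').
have fl_add f (x y : restr P0) : cocycle f -> aug x = 0 -> aug y = 0 ->
    f (lift (x + y)) = f (lift x) + f (lift y).
  by move=> cf x0 y0; have := fl_lin f 1 x y cf x0 y0; rewrite !scale1r.
have fl_act f s (x : P0) : cocycle f -> aug x = 0 ->
    f (lift (elt s *: x)) = elt s *: (f (lift x) : N).
  move=> cf x0; have [lf _] := cf; have [f' fE] := linear_bundle lf.
  rewrite (fl f (elt s *: lift x)) //; last by rewrite linearZ /= liftE.
  by rewrite -!fE linearZ.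
(* The derivation attached to a cocycle f through the k-linear section sg of aug. *)
pose Df f : S -> M -> restr N := fun s m => f (lift (elt s *: (sg m : P0) - sg (elt s *: m))).
have aug_sg s m : aug (elt s *: (sg m : P0) - sg (elt s *: m)) = 0.
  by rewrite linearB linearZ /= !sgE subrr.
have Dder f : cocycle f -> derivation (Df f).
  move=> cf; split=> [s a x y|s t m]; rewrite /Df.
    rewrite -fl_lin //; congr (f (lift _)).
    by rewrite actP !(linearP sg) actP scalerBr opprD addrACA.
  rewrite -fl_act // -fl_add //; last by rewrite linearZ /= aug_sg scaler0.
  by congr (f (lift _)); rewrite scalerBr !ma_elt_act addrA subrK.
apply: (@subquot_dim_transfer _ _ _ _ _ Z' (fun f => c (Df f))) dZ'.
- move=> a f g cf cg; have [[lf f1] [lg g1]] := (cf, cg); split.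
    split=> [r x y|y]; last by rewrite -[LHS]/(a *: f _ + g _) f1 g1 scaler0 addr0.
    rewrite -[LHS]/(a *: (f (r *: x + y) : restr N) + g (r *: x + y)) lf lg.
    rewrite -[X in _ = r *: X + _]/(a *: (f x : restr N) + g x).
    rewrite -[X in _ = _ + X]/(a *: (f y : restr N) + g y).
    rewrite !scalerDr -restrZC addrACA; congr (_ + _).
  rewrite -cl; try exact: Dder.
  by [].
- by move=> f cf; apply: cZ; exact: Dder.
- move=> w /conto[D dD cD]; have [lD mD] := dD.
  (* The extension of M by N defined by D; a lift of aug to it gives the cocycle. *)
  pose We : lmodType k := (restr N * restr M)%type.
  pose act s (x : We) : We := (elt s *: (x.1 : N) + D s x.2, elt s *: (x.2 : M)).
  have al s : linear (act s).
    move=> a x y; congr pair => /=.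
      rewrite lD (_ : elt s *: _ = a *: (elt s *: x.1 : restr N) + elt s *: y.1);
        last exact: act_linear.
      by rewrite scalerDr addrACA.
    exact: act_linear.
  have D1 m : D e m = 0.
    have := mD e e m; rewrite Monoid.mulm1 !ma_elt1_act => /eqP.
    by rewrite -subr_eq0 opprD addNKr oppr_eq0 => /eqP.
  have a1 x : act e x = x.
    by case: x => x y; rewrite /act /= D1 !ma_elt1_act addr0.
  have aM s t x : act (op s t) x = act s (act t x).
    by case: x => x y; rewrite /act /= mD -!ma_elt_act scalerDr !addrA.
  pose E : lmodType kS := actmod (MAction al a1 aM).
  have EZ (a : k) (x : restr E) : a *: x = a *: (x : We) by exact: actmod_restrZ.
  have /linear_bundle[q qE] : linear ((fun x => x.2) : E -> M).
    apply: ma_linear => [a x y|s x]; first by rewrite EZ.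
    by rewrite actmod_elt.
  have [|g gE] := @res_proj _ _ _ R 0 E M q aug.
    by move=> y; exists (0, y); rewrite qE.
  pose ga (x : P0) : restr N := (g x : We).1.
  have gaS s x : ga (elt s *: x) = elt s *: (ga x : N) + D s (aug x).
    by rewrite /ga linearZ /= actmod_elt /= -[in RHS]gE qE.
  have gaL : linear (ga : restr P0 -> restr N).
    by move=> a x y; rewrite /ga (restr_linear g a x y) EZ.
  have [ga' gaE] := linear_bundle gaL.
  have D0 s : D s 0 = 0 by have [l lE] := linear_bundle (lD s); rewrite -lE linear0.
  have augd0 y : aug (d0 y) = 0 by apply/res_exact0; exists y.
  have cf : cocycle (fun y => ga (d0 y)).
    split=> [|y]; last first.
      have -> : d0 (res_diff R 1 y) = 0 by apply/res_exact; exists y.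
      by rewrite -gaE linear0.
    apply: ma_linear => [a x y|s x]; first by rewrite d0L gaL.
    by rewrite linearZ /= gaS augd0 D0 addr0.
  exists (fun y => ga (d0 y)) => //.
  (* The cocycle gives back D up to the inner derivation of the composite of [ga] and [sg], which c
     sends to 0. *)
  have DfE : Df (fun y => ga (d0 y)) = 1 *: inner_derivation (fun m => ga (sg m)) + D.
    apply/funext => s; apply/funext => m.
    rewrite -[RHS]/(1 *: inner_derivation (fun m => ga (sg m)) s m + D s m) scale1r.
    rewrite /Df /inner_derivation liftE ?aug_sg // -!gaE linearB !gaE gaS sgE.
    by rewrite addrAC.
  have lphi : linear (fun m => ga (sg m)) by move=> a x y; rewrite linearP gaL.
  rewrite DfE cl //; last exact: inner_derivationP.
  have /cin[h _] := inner_derivationP lphi.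
  by rewrite h ?scaler0 ?add0r //; exists (fun m => ga (sg m)).
- move=> f cf; rewrite -cin; last exact: Dder.
  have [lf f1] := cf; split=> [[g lg fE]|[phi lphi DE]].
    have [g' gE] := linear_bundle lg.
    exists (fun m => g (sg m)).
      by move=> a x y; rewrite linearP -!gE; exact: (restr_linear g').
    apply/funext => s; apply/funext => m.
    rewrite /Df /inner_derivation fE liftE ?aug_sg //.
    by rewrite -!gE linearB linearZ.
  have [phi' phiE] := linear_bundle lphi.
  (* P0 is the direct sum of ker aug and the image of [sg]; g is given by f, through [lift], on the
     first summand and by phi on the second. *)
  pose g (x : P0) : restr N := f (lift (x - sg (aug x))) + phi (aug x).
  have aug0 x : aug (x - sg (aug x)) = 0 by rewrite linearB /= sgE subrr.
  have Dfs s m : Df f s m = elt s *: (phi m : N) - phi (elt s *: m) by rewrite DE.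
  have lg : linear (g : P0 -> N).
    apply: ma_linear => [a x y|s x].
      rewrite /g augL lphi linearP.
      have -> : a *: x + y - (a *: sg (aug x) + sg (aug y)) = a *: (x - sg (aug x) :
        restr P0) + (y - sg (aug y)).
        by rewrite scalerBr opprD addrACA.
      by rewrite fl_lin // scalerDr addrACA.
    rewrite /g linearZ /=.
    have -> : elt s *: x - sg (elt s *: aug x) = elt s *: (x - sg (aug x)) +
        (elt s *: (sg (aug x) : P0) - sg (elt s *: aug x)).
      by rewrite scalerBr addrA subrK.
    rewrite fl_add //; last by rewrite linearZ /= aug0 scaler0.
    rewrite fl_act // -[X in _ + X + _]/(Df f s (aug x)) Dfs scalerDr.
    by rewrite -addrA subrK.
  exists g => //; apply/funext => y.
  have augd0 : aug (d0 y) = 0 by apply/res_exact0; exists y.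
  rewrite /g augd0 -phiE !linear0 !addr0.
  by rewrite (fl f y).
Qed.

End Ext.
End Derivations.

(** * Derivations of Hsiao's monoid *)

Section HsiaoDerivations.
Variables (k : fieldType) (n : nat) (G : finGroupType).
Local Notation S := (hsiao n G).
Local Notation kS := (hsiao_alg k n G).
Local Notation "s @@ x" := (hsiao_elt k s *: x) (at level 40).
Variables (A B : lmodType kS).
Local Notation deriv := (@derivation k S (1%g : S) (@mulg S) A B).
Local Notation inner := (@inner k S (1%g : S) (@mulg S) A B).
Implicit Types (D : S -> A -> restr B) (e f s t u : S).

(** The condition is restricted to t coarser than f: when B has apex f, the other t act as 0 on B
    but not always on A. *)
Definition equivariant f (Delta : A -> restr B) :=
  linear (Delta : restr A -> restr B) /\
  forall t (x : A), hge t f -> t @@ (Delta x : B) = Delta (t @@ x).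

Lemma derivM D s t x : deriv D -> D (s * t)%g x = s @@ (D t x : B) + D s (t @@ x).
Proof. by case=> _; apply. Qed.

Lemma deriv0 D s : deriv D -> D s 0 = 0.
Proof. by case=> /(_ s)/linear_bundle[d dE] _; rewrite -dE linear0. Qed.

Lemma deriv_notin e f D s x : deriv D -> typed e A -> typed f B ->
  ~~ hge s e -> ~~ hge s f -> D s x = 0.
Proof.
move=> dD hA hB se sf; rewrite -{1}[s]hidem_mull derivM //.
by rewrite (typed_0 _ hB) ?hge_hidem // (typed_0 _ hA se) add0r deriv0.
Qed.

Lemma inner_same_apex D e : (forall p : nat, p \in [pchar k] -> ~~ (p %| #|G|)%N) ->
  typed e A -> typed e B -> deriv D -> inner D.
Proof.
move=> hk hA hB dD; have [r [P [hP eE]]] := hsiao_gpart (typed_triv hA); subst e.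
set e := gpart hP _ in hA hB.
pose H := {dffun forall _ : 'I_r, G}.
have H0 : (#|{: H}|%:R : k) != 0.
  have -> : #|{: H}| = (#|G| ^ r)%N by rewrite card_ffun card_ord.
  by rewrite natrX expf_neq0 // card_neq0.
have De x : D e x = 0.
  have := derivM e e x dD; rewrite (triv_idem (typed_triv hA)) (typed_e _ hA) (typed_e _ hB).
  by move=> /eqP; rewrite -subr_eq0 opprD addNKr oppr_eq0 => /eqP.
(* Summing the derivation rule for h g, applied to g^-1 x, over all g gives |G^r| D h x = Psi (h x)
   - h Psi x. *)
pose Psi (x : restr A) : restr B := \sum_(h : H) D (gpart hP h) (gpart hP (fun a => (h
  a)^-1)%g @@ (x : A)).
have lPsi : linear Psi.
  move=> a x y; rewrite scaler_sumr -big_split; apply: eq_bigr => h _ /=.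
  by rewrite actP; case: dD => lD _; rewrite lD.
have key (h : H) x : (#|{: H}|%:R : k) *: D (gpart hP h) x =
    Psi (gpart hP h @@ x) - (gpart hP h @@ (Psi x : B)).
  have -> : Psi (gpart hP h @@ x) = \sum_(g : H) D (gpart hP h * gpart hP g)%g (gpart hP
    (fun a => (g a)^-1)%g @@ x).
    rewrite /Psi (reindex_inj (mulgI h)) /=; apply: eq_bigr => g _.
    rewrite gpartM hsiao_actM gpartM; congr (D (gpart hP _) (hsiao_elt k (gpart hP _) *: x)).
      by apply/funext => a; rewrite ffunE.
    by apply/funext => a; rewrite ffunE invMg mulgKV.
  rewrite (eq_bigr _ (fun g _ => derivM _ _ _ dD)) big_split /=.
  have /linear_bundle[l lE] := @act_linear k _ B (hsiao_elt k (gpart hP h)).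
  rewrite (eq_bigr _ (fun g _ => esym (lE _))) -linear_sum lE -/(Psi x).
  rewrite addrAC subrr add0r.
  rewrite (eq_bigr (fun=> D (gpart hP h) x)) => [|g _]; last first.
    rewrite hsiao_actM gpartM; congr (D _ _); rewrite -[RHS](typed_e _ hA).
    by congr (hsiao_elt k (gpart hP _) *: x); apply/funext => a; rewrite mulgV.
  by rewrite sumr_const scaler_nat.
pose phi (x : restr A) : restr B := - (#|{: H}|%:R^-1 : k) *: Psi x.
exists phi.
  by move=> a x y; rewrite /phi lPsi scalerDr !scalerA mulrC.
apply/funext => s; apply/funext => x; rewrite /inner_derivation -![ma_elt k s]/(hsiao_elt k s).
case: (boolP (hge s e)) => se; last first.
  rewrite (deriv_notin _ dD hA hB) // (typed_0 _ hB se) (typed_0 _ hA se) /phi.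
  by have [p pE] := linear_bundle lPsi; rewrite -pE linear0 scaler0 subr0.
have [h hE] : exists h : H, forall a i, i \in P a -> hlab s i = h a.
  exists [ffun a => inflate_lab P s a] => a i ia.
  by rewrite ffunE; exact: (inflate_labE (hP := hP)).
have -> : D s x = D (gpart hP h) x.
  have := derivM e s x dD; rewrite De addr0 (typed_e _ hB) (gpart_mulr _ se hE).
  by move=> <-; congr (D (gpart hP _) x); apply/funext => c; rewrite mul1g.
rewrite !(typed_gpart _ _ se hE) //.
apply: (scalerI H0); rewrite key scalerBr /phi -[X in _ = _ *: X - _]restrZC !scalerA.
by rewrite mulrN mulfV // !scaleN1r opprK addrC.
Qed.

(** As f acts as 0 on A and as 1 on B, expanding D on f s f = f s in two ways gives D s = s (D f) -
    (D f) s. *)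
Lemma inner_not_ge D e f : typed e A -> typed f B -> ~~ hge f e -> deriv D -> inner D.
Proof.
move=> hA hB fe dD; exists (D f); first by case: dD => lD _; exact: lD.
apply/funext => s; apply/funext => x; rewrite /inner_derivation -![ma_elt k s]/(hsiao_elt k s).
have := derivM (f * s)%g f x dD.
rewrite (triv_mulK s (typed_triv hB)) (typed_0 x hA fe) deriv0 // addr0 derivM //.
rewrite -hsiao_actM !(typed_e _ hB) => <-.
by rewrite addrK.
Qed.

(** * Derivations into a module whose apex is coarser *)

Section Coarser.
Variables (D : S -> A -> restr B) (e f : S).
Hypotheses (dD : deriv D) (hA : typed e A) (hB : typed f B) (fe : hge f e).
Local Notation cut1 X := (cut X (1%g : G)).
Local Notation Db i := (D (cut1 (hblock e i))).

Lemma typed_cut X x : hge (cut1 X) e -> cut1 X @@ (x : A) = x.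
Proof. by move=> h; exact: (typed_id _ hA h (htriv_cut G X)). Qed.

(** Cuts at nested sets commute. When D is expanded on the two products, the left actions vanish on
    B and the right actions are trivial on A. *)
Lemma deriv_nested (X Y : {set 'I_n}) : X \subset Y -> hge (cut1 X) e -> hge (cut1 Y) e ->
  ~~ hge (cut1 X) f -> ~~ hge (cut1 Y) f -> D (cut1 X) = D (cut1 Y).
Proof.
move=> /fintype.subsetP XY Xe Ye Xf Yf; apply/funext => x.
have com : (cut1 X * cut1 Y)%g = (cut1 Y * cut1 X)%g.
  apply: hsiao_ext => [i j|i]; last by rewrite !hlabM !hlab_cut !if_same.
  have XYb l : (l \in X) ==> (l \in Y) by apply/implyP; exact: XY.
  rewrite !hleM !hle_cut; move: (XYb i) (XYb j).
  by case: (i \in X); case: (i \in Y); case: (j \in X); case: (j \in Y).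
have := derivM (cut1 X) (cut1 Y) x dD; rewrite com derivM //.
by rewrite (typed_0 _ hB Xf) (typed_0 _ hB Yf) !add0r !typed_cut.
Qed.

Lemma hge_cut_block i : hge (cut1 (hblock e i)) e.
Proof.
apply/hge_cut => a b ab; rewrite !inE.
by apply/idP/idP => h; apply: heq_trans h _; rewrite // heq_sym.
Qed.

Lemma not_hge_cut (X : {set 'I_n}) i j : heq f i j -> i \in X -> j \notin X ->
  ~~ hge (cut1 X) f.
Proof.
by move=> ij iX jX; apply/negP => /hge_cut/(_ i j ij); rewrite iX (negPf jX).
Qed.

(* u = cut X * u, where X is the union of the blocks of u up to that of i. *)
Lemma deriv_separating u i j x : hge u e -> heq f i j -> ~~ heq u i j -> hle u i j ->
  D u x = Db i (u @@ x).
Proof.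
move=> ue fij uij lij; pose X := [set l | hle u l i]%SET.
have nji : ~~ hle u j i by move: uij; rewrite /heq lij.
have Xu : (cut1 X * u)%g = u.
  apply: hsiao_ext => [a b|a]; last by rewrite hlabM hlab_cut if_same mul1g.
  rewrite hleM !hle_cut !inE.
  case ai : (hle u a i) => /=; case bi : (hle u b i) => //=.
    apply/esym; apply: hle_trans ai _.
    by have := hle_total u b i; rewrite bi.
  apply/esym/negP => ab; move/negP: ai; apply.
  exact: hle_trans ab bi.
have Xe : hge (cut1 X) e.
  apply/hge_cut => a b /(hgeP _ _ ue) ab; rewrite !inE.
  exact: hle_eql.
have iX : i \in X by rewrite inE hle_refl.
have jX : j \notin X by rewrite inE.
have := derivM (cut1 X) u x dD; rewrite Xu (typed_0 _ hB (not_hge_cut fij iX jX)) add0r => ->.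
suff -> : Db i = D (cut1 X) by [].
apply: deriv_nested => //.
- apply/fintype.subsetP => a; rewrite !inE => /(hgeP _ _ ue).
  by rewrite heq_sym => /andP[].
- exact: hge_cut_block.
- apply: (not_hge_cut fij); first by rewrite inE heq_refl.
  by rewrite inE; apply: contra uij => /(hgeP _ _ ue).
- exact: not_hge_cut fij iX jX.
Qed.

Lemma not_hgeP s t : ~~ hge s t -> exists i j, [/\ heq t i j, ~~ heq s i j & hle s i j].
Proof.
rewrite negb_forall => /existsP[i]; rewrite negb_forall => /existsP[j].
rewrite negb_imply => /andP[ij nij]; case: (boolP (hle s i j)) => sij.
  by exists i, j.
exists j, i; split; [by rewrite heq_sym | by rewrite heq_sym |].
by have := hle_total s i j; rewrite (negPf sij).
Qed.

Definition nontrivial i := exists2 j, heq f i j & ~~ heq e i j.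

Lemma nontrivial_cut i : nontrivial i -> ~~ hge (cut1 (hblock e i)) f.
Proof.
by move=> [j fij eij]; apply: (not_hge_cut fij); rewrite inE ?heq_refl.
Qed.

Lemma inner_of_constant i0 : nontrivial i0 ->
  (forall i, nontrivial i -> Db i = Db i0) -> inner D.
Proof.
move=> n0 Dc; pose Phi := Db i0.
have [lD _] := dD.
have sep s x : hge s e -> ~~ hge s f -> D s x = Phi (s @@ x).
  move=> se /not_hgeP[i [j [fij sij lij]]].
  rewrite (deriv_separating _ se fij sij lij) Dc //.
  by exists j => //; apply: contra sij => /(hgeP _ _ se).
exists (fun x => - Phi x).
  by move=> a x y; rewrite /Phi lD opprD scalerN.
apply/funext => s; apply/funext => x; rewrite /inner_derivation -![ma_elt k s]/(hsiao_elt k s).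
rewrite opprK scalerN addrC.
case: (boolP (hge s e)) => se; last first.
  have sf : ~~ hge s f by apply: contra se => sf; exact: hge_trans sf fe.
  rewrite (deriv_notin _ dD hA hB) // (typed_0 _ hB sf) (typed_0 _ hA se) subr0.
  by rewrite /Phi deriv0.
case: (boolP (hge s f)) => sf; last by rewrite sep // (typed_0 _ hB sf) subr0.
(* For s coarser than f, the product of s with the cut at [i0] is no longer coarser than f, so [sep]
   applies to it; the derivation rule for this product then determines D s. *)
have te := hge_cut_block i0; have tf := nontrivial_cut n0.
have := sep (s * cut1 (hblock e i0))%g x; rewrite !hgeM se te (negPf tf) andbF.
move=> /(_ isT isT); rewrite derivM // -hsiao_actM typed_cut // => <-.
by rewrite addrC addKr.
Qed.

(* f is obtained from e by merging the blocks of p and q. *)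
Definition merges p q := [/\ ~~ heq e p q, heq f p q & forall i j, heq f i j ->
  [\/ heq e i j, heq e p i /\ heq e q j | heq e q i /\ heq e p j]].

(** Two nontrivial blocks are compared through the cut at their union, unless this union is a union
    of blocks of f. In that case any third nontrivial block serves as an intermediary, and if there
    is none, f merges exactly the two. *)
Lemma constant_of_not_merge : (forall p q, ~ merges p q) ->
  forall p q, nontrivial p -> nontrivial q -> Db p = Db q.
Proof.
move=> nm p q np nq; case: (boolP (heq e p q)) => [epq|epq].
  congr (D (cut _ _)); apply/finset.setP => i; rewrite !inE.
  apply/idP/idP; last exact: heq_trans.
  by apply: heq_trans; rewrite heq_sym.
have two i j : nontrivial i -> nontrivial j ->
    ~~ hge (cut1 (hblock e i :|: hblock e j)) f -> Db i = Db j.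
  move=> ni nj nij; have ije : hge (cut1 (hblock e i :|: hblock e j)) e.
    apply/hge_cut => a b ab; have /hge_cut/(_ a b ab) ia := hge_cut_block i.
    by have /hge_cut/(_ a b ab) ja := hge_cut_block j; rewrite !finset.in_setU ia ja.
  transitivity (D (cut1 (hblock e i :|: hblock e j))).
    by apply: deriv_nested => //; rewrite ?finset.subsetUl ?hge_cut_block ?nontrivial_cut.
  by symmetry; apply: deriv_nested => //; rewrite ?finset.subsetUr ?hge_cut_block
    ?nontrivial_cut.
case: (boolP (hge (cut1 (hblock e p :|: hblock e q)) f)) => [/hge_cut sat|]; last exact: two.
have fpq : heq f p q.
  have [j fpj epj] := np; have := sat _ _ fpj; rewrite !inE heq_refl (negPf epj) /=.
  by move=> /esym /(hgeP _ _ fe) qj; apply: heq_trans fpj _; rewrite heq_sym.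
case: (pselect (exists l, [/\ nontrivial l, ~~ heq e p l & ~~ heq e q l])) => [[l [nl pl
  ql]]|nl].
  rewrite (two p l) //; first (rewrite (two q l) //).
    apply: (not_hge_cut (i := q) (j := p)); rewrite ?inE ?heq_refl 1?heq_sym //.
    by rewrite negb_or ![heq e _ p]heq_sym epq pl.
  apply: (not_hge_cut fpq); rewrite ?inE ?heq_refl //.
  by rewrite negb_or [heq e l q]heq_sym ql andbT.
case: (nm p q); split=> // i j fij; case: (boolP (heq e i j)) => [|eij]; first by constructor.
have inpq a : nontrivial a -> heq e p a || heq e q a.
  by move=> na; apply: contrapT => /negP; rewrite negb_or => /andP[pa qa]; apply: nl; exists a.
have /orP hi : heq e p i || heq e q i by apply: inpq; exists j.
have /orP hj : heq e p j || heq e q j.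
  by apply: inpq; exists i; rewrite heq_sym.
case: hi => hi; case: hj => hj.
- by case/negP: eij; apply: heq_trans hj; rewrite heq_sym.
- by constructor 2.
- by constructor 3.
- by case/negP: eij; apply: heq_trans hj; rewrite heq_sym.
Qed.

Lemma inner_not_merge : ~~ hge e f -> (forall p q, ~ merges p q) -> inner D.
Proof.
move=> /not_hgeP[i [j [fij eij _]]] nm; have ni : nontrivial i by exists j.
by apply: (inner_of_constant ni) => l nl; exact: constant_of_not_merge.
Qed.

Variables p q : 'I_n.
Hypothesis pq : merges p q.

Lemma merges_nontrivial : nontrivial p /\ nontrivial q.
Proof.
have [epq fpq _] := pq; split; first by exists q.
by exists p; rewrite heq_sym.
Qed.

(** Neither [Db p] nor [Db q] need commute with t, but both fail to by the same amount D t x, which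
    cancels in the difference. *)
Lemma merges_equivariant t x : hge t f ->
  t @@ ((Db p x - Db q x) : B) = Db p (t @@ x) - Db q (t @@ x).
Proof.
move=> tf; have [epq fpq _] := pq; have [np nq] := merges_nontrivial.
have te := hge_trans tf fe.
have one a b : heq f a b -> ~~ heq e a b -> t @@ (Db a x : B) = Db a (t @@ x) - D t x.
  move=> fab eab; have := derivM t (cut1 (hblock e a)) x dD.
  rewrite (@deriv_separating _ a b) //.
  - rewrite -hsiao_actM !typed_cut ?hge_cut_block // => ->.
    by rewrite addrK.
  - by rewrite hgeM te hge_cut_block.
  - by rewrite heqM (hgeP _ _ tf) //= heq_cut !inE heq_refl (negPf eab).
  - have /andP[tab _] := hgeP _ _ tf _ _ fab.
    by rewrite hleM tab /= hle_cut !inE heq_refl implybT.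
rewrite scalerBr (one p q) // (one q p) 1?heq_sym //.
by rewrite opprB addrA subrK.
Qed.

Lemma merges_inner : (inner D <-> Db p = Db q).
Proof.
have [np nq] := merges_nontrivial; have [epq fpq mpq] := pq.
split=> [[phi lphi ->]|pqE].
  apply/funext => x; rewrite /inner_derivation.
  have E i : nontrivial i -> ma_elt k (cut1 (hblock e i)) *: (phi x : B) = 0.
    by move=> ni; apply: (typed_0 _ hB); exact: nontrivial_cut.
  have E' i : ma_elt k (cut1 (hblock e i)) *: x = x by apply: typed_cut; exact: hge_cut_block.
  by rewrite !E // !E'.
apply: (inner_of_constant np) => i [j fij eij].
have same a b : heq e a b -> Db a = Db b.
  move=> ab; congr (D (cut _ _)); apply/finset.setP => l; rewrite !inE.
  by apply/idP/idP; apply: heq_trans; rewrite // heq_sym.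
case: (mpq i j fij) => [|[pi _]|[qi _]]; first by rewrite (negPf eij).
  by rewrite (same p i).
by rewrite pqE (same q i).
Qed.

End Coarser.

(** If s is coarser than e but not than f, it separates p and q, so s t inherits their order from s,
    and s acts as 0 on B: the rule becomes D (s t) = (D s) t. If s is coarser than f, then D s = 0,
    the order comes from t, and the rule is the equivariance of Delta. *)
Lemma merges_deriv e f p q (Delta : restr A -> restr B) :
    typed e A -> typed f B -> hge f e -> merges e f p q -> equivariant f Delta ->
  exists2 D, deriv D & D (cut (hblock e p) (1%g : G)) - D (cut (hblock e q) (1%g : G)) = Delta.
Proof.
move=> hA hB fe [epq fpq mpq] [lD eD]; have [dl dE] := linear_bundle lD.
have D0 : Delta 0 = 0 by rewrite -dE linear0.
(* D s = Delta s if s puts p strictly before q, and 0 otherwise. *)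
pose D s (x : A) : restr B := if hle s q p then 0 else Delta (s @@ x).
exists D; last first.
  apply/funext => x; rewrite -[LHS]/(D _ x - D _ x) /D.
  rewrite !hle_cut !inE !heq_refl /= (negPf epq) subr0.
  congr (Delta _); apply: (typed_id _ hA _ (htriv_cut G _)).
  exact: hge_cut_block.
split=> [s a x y|s t x]; rewrite /D.
  by case: ifP => _; rewrite ?scaler0 ?addr0 // actP lD.
rewrite -![ma_elt k _]/(hsiao_elt k _).
have fin u : ~~ hge u e -> ~~ hge u f by apply: contra => sf; exact: hge_trans sf fe.
rewrite -hsiao_actM; case: (boolP (hge s e)) => se; last first.
  rewrite (typed_0 _ hB (fin _ se)) !(typed_0 _ hA se) D0 !if_same.
  by rewrite addr0.
case: (boolP (hge t e)) => te; last first.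
  by rewrite (typed_0 _ hA te) !scaler0 D0 !if_same scaler0 addr0.
rewrite hleM; case: (boolP (hge s f)) => sf.
  have /andP[spq sqp] := hgeP _ _ sf _ _ fpq; rewrite spq sqp /= addr0.
  by case: ifP => _; rewrite ?scaler0 ?eD.
have spq : ~~ heq s p q.
  apply: contra sf => spq; apply/hgeP => i j /mpq[||].
  - exact: (hgeP _ _ se).
  - case=> /(hgeP _ _ se) pi /(hgeP _ _ se) qj.
    by apply: heq_trans (heq_trans spq qj); rewrite heq_sym.
  - case=> /(hgeP _ _ se) qi /(hgeP _ _ se) pj.
    rewrite heq_sym; apply: heq_trans (heq_trans spq qi).
    by rewrite heq_sym.
rewrite (typed_0 _ hB sf) add0r; move: spq; rewrite /heq.
case: (hle s p q) (hle_total s p q) => /= [_ /negPf -> //|-> _].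
by [].
Qed.

End HsiaoDerivations.

(** * Dimensions of spaces of intertwiners *)

Section Intertwiners.
Variables (k : fieldType) (G : finGroupType) (a b : nat).
Variables (T : G -> 'M[k]_b) (U : G -> 'M[k]_a).

Definition intertwiner (X : 'M[k]_(b, a)) := forall g, T g *m X = X *m U g.

Definition average (X : 'M[k]_(b, a)) : 'M[k]_(b, a) :=
  #|G|%:R^-1 *: \sum_g T g *m X *m U g^-1%g.

Lemma average_is_linear : linear average.
Proof.
move=> c X Y; rewrite /average scalerA [c * _]mulrC -scalerA -scalerDr; congr (_ *: _).
rewrite scaler_sumr -big_split; apply: eq_bigr => g _ /=.
by rewrite mulmxDr mulmxDl -scalemxAr -scalemxAl.
Qed.
HB.instance Definition _ := GRing.isLinear.Build k _ _ _ average average_is_linear.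

(** The intertwiners are the image of the averaging projector, whence the rank. T and U are mere
    families of matrices, so that transposed representations, which reverse products, are covered
    too. *)
Lemma intertwiner_dim :
  (forall X, intertwiner (average X)) -> (forall X, intertwiner X -> average X = X) ->
  subquot_dim (fun X => intertwiner X) (fun X => X = 0) (\rank (lin_mx average)).
Proof.
move=> avI avF; set E := row_base (lin_mx average).
have rowE_I i : intertwiner (vec_mx (row i E)).
  have /submxP[D ->] : (row i E <= lin_mx average)%MS.
    by apply: submx_trans (row_sub _ _) _; rewrite eq_row_base.
  by rewrite mul_rV_lin mxvecK; exact: avI.
exists (fun i => vec_mx (row i E)); split=> // X IX.
have sumE (c : 'rV[k]_(\rank (lin_mx average))) :
    \sum_i c 0 i *: vec_mx (row i E) = vec_mx (c *m E) :> 'M_(b, a).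
  by rewrite mulmx_sum_row linear_sum; apply: eq_bigr => i _; rewrite linearZ.
have /submxP[c cE] : (mxvec X <= E)%MS.
  by rewrite eq_row_base -[X in mxvec X](avF X IX) -[X in average X]mxvecK -mul_rV_lin submxMl.
exists c; split=> [|c' /eqP]; first by rewrite sumE -cE mxvecK subrr.
rewrite sumE subr_eq0 => /eqP XE; apply: (row_free_inj (row_base_free (lin_mx average))).
by rewrite -/E -cE XE vec_mxK.
Qed.

End Intertwiners.

(** By [entry], the coefficient at (i, j), (i', j') is a mean of products of an entry (i', i) and an
    entry (j, j'); transposing T and U exchanges the two index pairs. *)
Lemma average_tr (k : fieldType) (G : finGroupType) a b (T : G -> 'M[k]_b) (U : G -> 'M[k]_a) :
  lin_mx (average (fun g => (T g)^T) (fun g => (U g)^T)) = (lin_mx (average T U))^T.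
Proof.
have entry (T' : G -> 'M[k]_b) (U' : G -> 'M[k]_a) i j i' j' :
    lin_mx (average T' U') (mxvec_index i j) (mxvec_index i' j') =
    #|G|%:R^-1 * \sum_g T' g i' i * U' g^-1%g j j'.
  rewrite mxE /= mxvecE vec_mx_delta mxE summxE; congr (_ * _); apply: eq_bigr => g _.
  rewrite mxE (bigD1 j) //= big1 ?addr0 => [|l /negPf lj].
    rewrite mxE (bigD1 i) //= big1 ?addr0 => [|l /negPf li]; first by rewrite mxE !eqxx mulr1.
    by rewrite mxE li mulr0.
  rewrite mxE big1 ?mul0r // => m _.
  by rewrite mxE lj andbF mulr0.
apply/matrixP => x y; case/mxvec_indexP: x => i j; case/mxvec_indexP: y => i' j'.
rewrite [RHS]mxE !entry; congr (_ * _); apply: eq_bigr => g _.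
by rewrite !mxE.
Qed.

Section HomDim.
Variables (k : fieldType) (G : finGroupType).
Hypothesis hk : forall p : nat, p \in [pchar k] -> ~~ (p %| #|G|)%N.
Local Notation kG := (group_alg k G).

Section Rep.
Variables (M : lmodType kG) (d : nat) (b : 'I_d -> restr M) (c : 'I_d -> restr M -> k).
Hypothesis bc : is_basis b c.

(** Columns are the images of basis vectors, so this is multiplicative without the inverse used in
    [simple_matrix_units]. *)
Definition rep_mx (g : G) : 'M[k]_d := \matrix_(i, j) c i (group_elt k g *: (b j : M)).

Lemma rep_act g j : group_elt k g *: (b j : M) = \sum_i rep_mx g i j *: b i :> restr M.
Proof. by case: bc => _ bE _; rewrite [LHS]bE; apply: eq_bigr => i _; rewrite mxE. Qed.

Lemma rep_mx1 : rep_mx 1%g = 1%:M.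
Proof.
apply/matrixP => i j; rewrite !mxE (ma_elt1_act (b j : M)).
by case: bc => _ _ ->.
Qed.

Lemma rep_mxM g h : rep_mx (g * h)%g = rep_mx g *m rep_mx h.
Proof.
apply/matrixP => i j; rewrite !mxE.
have -> : group_elt k (g * h)%g *: (b j : M) = group_elt k g *: (group_elt k h *: (b j : M)).
  by symmetry; exact: ma_elt_act.
rewrite (rep_act h).
have [c' cE] := is_basis_lin bc.
have /linear_bundle[f fE] := @act_linear k _ M (group_elt k g).
rewrite -fE linear_sum -cE linear_sum; apply: eq_bigr => l _.
by rewrite !linearZ /= fE cE mulrC !mxE.
Qed.
End Rep.

Section Two.
Variables (M N : lmodType kG) (a b : nat).
Variables (bM : 'I_a -> restr M) (cM : 'I_a -> restr M -> k).
Variables (bN : 'I_b -> restr N) (cN : 'I_b -> restr N -> k).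
Hypotheses (hM : is_basis bM cM) (hN : is_basis bN cN).
Local Notation RM := (rep_mx bM cM).
Local Notation RN := (rep_mx bN cN).

Lemma hom_dim_intertwiner d :
  subquot_dim (fun X => intertwiner RN RM X) (fun X => X = 0) d -> hom_dim M N d.
Proof.
have [cN' cNE] := is_basis_lin hN; have [cM' cME] := is_basis_lin hM.
have [_ bME cbM] := hM; have [_ bNE cbN] := hN.
pose mx (f : M -> restr N) : 'M[k]_(b, a) := \matrix_(i, j) cN i (f (bM j)).
have lf (f : M -> restr N) : linear (f : M -> N) -> exists f' : {linear restr M ->
  restr N}, forall x, f' x = f x.
  by move=> h; apply: linear_bundle; have [f' fE] := linear_bundle h => a' x y;
    rewrite -!fE; exact: (restr_linear f').
have fE f j : f (bM j) = \sum_i mx f i j *: bN i.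
  by rewrite [LHS]bNE; apply: eq_bigr => i _; rewrite mxE.
apply: (@subquot_dim_transfer _ (M -> restr N) _ _ _ _ mx).
- move=> x f f' hf hf'; split.
    have E u : (x *: (f : M -> restr N) + f') u = x *: f u + f' u by [].
    move=> c u v; rewrite !E hf hf'.
    by rewrite scalerDr scalerDr -restrZC addrACA.
  apply/matrixP => i j; rewrite !mxE -!cNE -[X in cN' i X]/(x *: f (bM j) + f' (bM j)).
  by rewrite linearP.
- move=> f hf g; have [f' f'E] := lf f hf; have [f2 f2E] := linear_bundle hf.
  apply/matrixP => i j.
  have E : f (group_elt k g *: (bM j : M)) = group_elt k g *: (f (bM j) : N).
    by rewrite -!f2E linearZ.
  have [ca caE] : exists ca : {linear restr N -> restr N}, forall x, ca x =
    group_elt k g *: (x : N).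
    exact: linear_bundle (act_linear _).
  transitivity (cN i (f (group_elt k g *: (bM j : M)))).
    rewrite E (fE f j) -caE linear_sum -cNE linear_sum mxE; apply: eq_bigr => l _.
    by rewrite !linearZ /= caE mulrC cNE [rep_mx _ _ _ _ _]mxE.
  rewrite (rep_act hM) -f'E linear_sum -cNE linear_sum mxE; apply: eq_bigr => l _.
  by rewrite !linearZ /= f'E mulrC cNE [mx f _ _]mxE.
- move=> X IX.
  pose f (x : restr M) : restr N := \sum_j cM j x *: \sum_i X i j *: bN i.
  have fb j : f (bM j) = \sum_i X i j *: bN i.
    rewrite /f (bigD1 j) //= cbM eqxx scale1r [X in _ + X]big1 ?addr0 // => l lj.
    by rewrite cbM (negPf lj) scale0r.
  have fl : linear f.
    move=> c x y; rewrite scaler_sumr -big_split; apply: eq_bigr => j _ /=.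
    by rewrite -!cME linearP scalerDl scalerA.
  have [f' f'E] := linear_bundle fl.
  exists f.
    apply: ma_linear => // g x; rewrite -[ma_elt k g]/(group_elt k g).
    have [cam camE] := linear_bundle (@act_linear k _ M (group_elt k g)).
    have [can canE] := linear_bundle (@act_linear k _ N (group_elt k g)).
    rewrite -camE -canE -!f'E [x]bME !linear_sum; apply: eq_bigr => j _.
    rewrite !linearZ /=; congr (_ *: _); rewrite camE (rep_act hM) linear_sum f'E fb linear_sum.
    transitivity (\sum_i (X *m RM g) i j *: bN i).
      under eq_bigr => i _ do rewrite linearZ /= f'E fb scaler_sumr.
      rewrite exchange_big; apply: eq_bigr => i _ /=.
      by rewrite mxE scaler_suml; apply: eq_bigr => l _; rewrite scalerA mulrC.
    rewrite -IX.
    under [RHS]eq_bigr => i _ do rewrite linearZ /= canE (rep_act hN) scaler_sumr.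
    rewrite exchange_big; apply: eq_bigr => i _ /=.
    by rewrite mxE scaler_suml; apply: eq_bigr => l _; rewrite scalerA mulrC.
  apply/matrixP => i j; rewrite mxE fb -cNE linear_sum (bigD1 i) //= big1.
    by rewrite linearZ /= cNE cbN eqxx addr0 mulr1.
  by move=> l /negPf li; rewrite linearZ /= cNE cbN eq_sym li mulr0.
- move=> f hf; split=> [->|f0].
    by apply/matrixP => i j; rewrite !mxE -cNE linear0.
  apply/funext => x; have [f' f'E] := lf f hf; rewrite -f'E [x]bME linear_sum big1 // => j _.
  rewrite linearZ /= f'E fE big1 ?scaler0 // => i _.
  by rewrite f0 mxE scale0r.
Qed.

End Two.

(* The averaging projectors onto the two Hom spaces are transposes of each other. *)
Lemma hom_dim_sym (M N : lmodType kG) a b (bM : 'I_a -> restr M) cM (bN : 'I_b -> restr N) cN :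
  is_basis bM cM -> is_basis bN cN -> exists d, hom_dim M N d /\ hom_dim N M d.
Proof.
move=> hM hN; set RM := rep_mx bM cM; set RN := rep_mx bN cN.
have RMM := rep_mxM hM; have RNM := rep_mxM hN.
have RM1 := rep_mx1 hM; have RN1 := rep_mx1 hN.
have RMV g : RM g^-1%g *m RM g = 1%:M by rewrite -RMM mulVg.
have RNV g : RN g *m RN g^-1%g = 1%:M by rewrite -RNM mulgV.
have avc (X : 'M[k]_(b, a)) : #|G|%:R^-1 *: \sum_(g : G) X = X.
  by rewrite sumr_const -scaler_nat scalerA mulVf ?(card_neq0 hk) // scale1r.
exists (\rank (lin_mx (average RN RM))); split.
  apply: (hom_dim_intertwiner hM hN); apply: intertwiner_dim => [X h|X IX].
    rewrite /average -scalemxAr -scalemxAl; congr (_ *: _).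
    rewrite mulmx_sumr mulmx_suml (reindex_inj (mulgI h^-1%g)) /=; apply: eq_bigr => g _.
    rewrite !mulmxA -RNM mulKVg invMg invgK -!mulmxA; congr (_ *m (_ *m _)).
    exact: RMM.
  rewrite /average -[RHS](avc X); congr (_ *: _); apply: eq_bigr => g _.
  by rewrite IX -mulmxA -RMM mulgV RM1 mulmx1.
have -> : \rank (lin_mx (average RN RM)) = \rank (lin_mx (average (fun g => (RN g)^T)
  (fun g => (RM g)^T))).
  by rewrite average_tr mxrank_tr.
apply: (hom_dim_intertwiner hN hM).
(* Transposition carries the intertwiners for [RM] and [RN] to those for the transposed families. *)
apply: (@subquot_dim_transfer _ _ _ _ _ _ (fun Y : 'M[k]_(a, b) => Y^T)); last first.
- apply: (intertwiner_dim (T := fun g => (RN g)^T) (U := fun g => (RM g)^T)) => [X h|X IX].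
    rewrite /average -scalemxAr -scalemxAl; congr (_ *: _).
    rewrite mulmx_sumr mulmx_suml [LHS](reindex_inj (mulIg h^-1%g)) /=.
    apply: eq_bigr => g _; rewrite !mulmxA -trmx_mul -RNM mulgKV.
    by rewrite -[RHS]mulmxA -trmx_mul -RMM invMg invgK.
  rewrite /average -[RHS](avc X); congr (_ *: _); apply: eq_bigr => g _.
  by rewrite IX -mulmxA -trmx_mul -RMM mulVg RM1 trmx1 mulmx1.
- move=> Y _; split=> [->|Y0]; first by rewrite trmx0.
  by rewrite -[Y]trmxK Y0 trmx0.
- move=> X IX; exists X^T; last by rewrite trmxK.
  by move=> g; have := congr1 trmx (IX g); rewrite !trmx_mul !trmxK => ->.
- by move=> Y IY g; have := congr1 trmx (IY g); rewrite !trmx_mul => ->.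
- move=> c Y Y' IY IY'; split=> [g|]; last by rewrite linearP.
  by rewrite mulmxDr mulmxDl IY' -scalemxAr -scalemxAl IY.
Qed.

Lemma hom_dim_isol (M M' N : lmodType kG) d :
  module_isomorphic M M' -> hom_dim M N d -> hom_dim M' N d.
Proof.
case=> f [g fK gK].
have /linear_bundle[g' gE] : linear g by move=> a x y; apply: (can_inj fK); rewrite linearP !gK.
apply: (@subquot_dim_transfer _ (M' -> restr N) (M -> restr N) _ _ _ (fun h => h \o f)).
- move=> x h h' lh lh'; split=> // c u v.
  have E w : (x *: (h : M' -> restr N) + h') w = x *: h w + h' w by [].
  rewrite !E lh lh'.
  by rewrite scalerDr scalerDr -restrZC addrACA.
- by move=> h lh c u v; rewrite /= linearP lh.
- move=> h lh; exists (h \o g'); last by apply/funext => y /=; rewrite gE fK.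
  by move=> c u v; rewrite /= linearP lh.
- move=> h lh; split=> [->|h0]; first by apply/funext.
  by apply/funext => y; rewrite -(gK y); exact: (congr1 (fun F => F (g y)) h0).
Qed.

End HomDim.

(** * Tensor products indexed by blocks *)

(** Inverting P would require transporting [v i] along equalities of indices; overwriting a default
    family one index at a time avoids it. *)
Lemma family_ext (I : finType) (T : eqType) (X : T -> Type) (x0 : forall t, X t)
    (P : I -> T) (v : forall i, X (P i)) : injective P ->
  exists x : forall t, X t, forall i, x (P i) = v i.
Proof.
move=> iP; suff [x xE] : exists x : forall t, X t, forall i, i \in enum I -> x (P i) = v i.
  by exists x => i; apply: xE; rewrite mem_enum.
elim: (enum I) => [|i r [x xE]]; first by exists x0.
exists (dfwith x (v i)) => j; case: (eqVneq i j) => [<- _|ij]; first by rewrite dfwith_in.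
rewrite inE eq_sym (negPf ij) /= => jr.
by rewrite dfwith_out ?xE // (inj_eq iP).
Qed.

Section SetTensors.
Variables (k : fieldType) (n : nat) (G : finGroupType).
Local Notation S := (hsiao n G).
Local Notation kS := (hsiao_alg k n G).
Local Notation kG := (group_alg k G).
Local Notation "s @@ x" := (hsiao_elt k s *: x) (at level 40).
Variable X : {set 'I_n} -> lmodType kG.
Local Notation rX R := (restr (X R) : lmodType k).
Implicit Types (e f s t : S) (R C : {set 'I_n}).

(** Indexing families by all subsets gives those for A and those for B the same type, so a family
    can pass from the blocks of e to those of f without casts. *)
Definition slot_linear e (Z : lmodType k) (beta : (forall R, rX R) -> Z) :=
  (forall x y, (forall R, block e R -> x R = y R) -> beta x = beta y) /\
  (forall x R a (u w : rX R), block e R ->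
     beta (dfwith x (a *: u + w)) = a *: beta (dfwith x u) + beta (dfwith x w)).

(* A is the tensor product of the X R, for R ranging over the blocks of e; the
   components of a family of vectors at the other subsets are irrelevant. *)
Record set_tensor e (A : lmodType kS) (tau : (forall R, rX R) -> restr A) : Prop := SetTensor {
  st_slot : slot_linear e tau;
  st_lift : forall (Z : lmodType k) (beta : (forall R, rX R) -> Z), slot_linear e beta ->
    exists h : {linear restr A -> Z}, forall x, h (tau x) = beta x;
  st_ext : forall (Z : lmodType k) (h h' : restr A -> Z), linear h -> linear h' ->
    (forall x, h (tau x) = h' (tau x)) -> forall y, h y = h' y;
  st_act : forall s x, hge s e ->
    s @@ (tau x : A) = tau (fun R => group_elt k (blab s R) *: (x R : X R))
}.

Lemma set_tensor_of r (P : 'I_r -> {set 'I_n}) (hP : ordered_partition (codom P))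
    (A : lmodType kS) (hA : typed (gpart hP (fun=> 1%g)) A) :
    is_tensor_module (fun (i : 'I_r) (h : {dffun forall _ : 'I_r, G}) => h i)
      (fun i => X (P i)) (block_module hA) ->
  exists tau, set_tensor (gpart hP (fun=> 1%g)) (A := A) tau.
Proof.
set e := gpart hP _; move=> [tau [tT tE]].
have iP := gpart_inj hP.
have bP i : block e (P i).
  have [j ji] := gpart_nonempty G hP i; apply/blockP; exists j.
  exact: gpart_block.
have Pb R : block e R -> exists i, R = P i.
  case/blockP => j ->; have [i ji] := gpart_block_ex G hP j; exists i.
  by rewrite (gpart_block hP (fun=> 1%g : G) ji).
have x0 : forall R, rX R by move=> R; exact: 0.
have /choice[ext extE] : forall v : forall i, rX (P i), exists x :
  forall R, rX R, forall i, x (P i) = v i.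
  by move=> v; exact: family_ext.
have dfP (x : forall R, rX R) i (u : rX (P i)) :
    (fun j => dfwith x u (P j)) = dfwith (fun j => x (P j)) u.
  apply: functional_extensionality_dep => j; case: (eqVneq i j) => [<-|ij].
    by rewrite !dfwith_in.
  by rewrite !dfwith_out // (inj_eq iP).
exists (fun x => tau (fun i => x (P i))); split.
- split=> [x y xy|x R a u w bR].
    by congr (tau _); apply: functional_extensionality_dep => i; exact: xy.
  have [i iR] := Pb R bR; subst R.
  by rewrite !dfP tT.1 block_moduleZ.
- move=> Z beta [b1 b2].
  have mb : multilinear (fun v : forall i, rX (P i) => beta (ext v)).
    move=> v i a u w.
    have dfE (z : rX (P i)) : beta (ext (dfwith v z)) = beta (dfwith (ext v) z).
      apply: b1 => R /Pb[j ->]; rewrite extE.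
      case: (eqVneq i j) => [<-|ij]; first by rewrite !dfwith_in.
      by rewrite !dfwith_out ?(inj_eq iP).
    by rewrite !dfE b2.
  have [h hE] := tensor_lift tT mb.
  have /linear_bundle[h' hE'] : linear (h : restr A -> Z).
    by move=> a u w; rewrite -linearP block_moduleZ.
  exists h' => x; rewrite hE' hE; apply: b1 => R /Pb[i ->].
  by rewrite extE.
- move=> Z h h' lh lh' hh'; apply: (tensor_extf tT (h := h) (h' := h')).
  + by move=> a u w; rewrite block_moduleZ lh.
  + by move=> a u w; rewrite block_moduleZ lh'.
  move=> v; have := hh' (ext v).
  suff -> : (fun i => ext v (P i)) = v by [].
  by apply: functional_extensionality_dep => i; rewrite extE.
- move=> s x se.
  have hE a i : i \in P a -> hlab s i = [ffun a => blab s (P a)] a.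
    by move=> ia; rewrite ffunE (blabE se (bP a) ia).
  rewrite (typed_gpart _ hA se hE).
  have := tE [ffun a => blab s (P a)] (fun i => x (P i)).
  rewrite block_moduleE => ->; congr (tau _).
  by apply: functional_extensionality_dep => i; rewrite ffunE.
Qed.

Section Slots.
Variables (e : S) (Z : lmodType k) (beta : (forall R, rX R) -> Z).
Hypothesis sb : slot_linear e beta.

Lemma slot_lin x R : block e R -> linear (fun u : rX R => beta (dfwith x u)).
Proof. by move=> bR a u w; case: sb => _ ->. Qed.

Lemma slot_scale x R c (u : rX R) : block e R -> beta (dfwith x (c *: u)) =
  c *: beta (dfwith x u).
Proof. by move=> /(slot_lin x)/linear_bundle[h hE]; rewrite -!hE linearZ. Qed.

Lemma slot_eq0 x R : block e R -> x R = 0 -> beta x = 0.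
Proof.
move=> bR xR; rewrite -(dfwith_id x R) xR.
by have /linear_bundle[h <-] := slot_lin x bR; rewrite linear0.
Qed.

Lemma slot_prod (l : seq {set 'I_n}) (c : forall R, rX R -> k) (b x y : forall R, rX R) :
    uniq l -> (forall R, R \in l -> block e R) ->
  beta (fun R => if R \in l then c R (x R) *: b R else y R) =
  (\prod_(R <- l) c R (x R)) *: beta (fun R => if R \in l then b R else y R).
Proof.
elim: l y => [|C l IHl] y /=; first by rewrite big_nil scale1r.
move=> /andP[Cl ul] bl; rewrite big_cons mulrC -scalerA.
have bC : block e C by apply: bl; rewrite inE eqxx.
have E (F : forall R, rX R) (u : rX C) :
    (fun R => if R \in C :: l then dfwith F u R else y R) =
    dfwith (fun R => if R \in l then F R else y R) u.
  apply: functional_extensionality_dep => R; rewrite inE.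
  case: (eqVneq C R) => [<-|CR] /=; first by rewrite !dfwith_in.
  by rewrite !dfwith_out.
have -> : (fun R => if R \in C :: l then c R (x R) *: b R else y R) =
    dfwith (fun R => if R \in l then c R (x R) *: b R else y R) (c C (x C) *: b C).
  by rewrite -E; apply: functional_extensionality_dep => R; rewrite dfwith_id.
have -> : (fun R => if R \in C :: l then b R else y R) =
    dfwith (fun R => if R \in l then b R else y R) (b C).
  by rewrite -E; apply: functional_extensionality_dep => R; rewrite dfwith_id.
rewrite -slot_scale //.
have E2 (F : forall R, rX R) (u : rX C) : dfwith (fun R => if R \in l then F R else y R) u =
    fun R => if R \in l then F R else dfwith y u R.
  apply: functional_extensionality_dep => R; case: (eqVneq C R) => [<-|CR].
    by rewrite !dfwith_in (negPf Cl).
  by rewrite !dfwith_out.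
rewrite !E2 IHl // => R Rl; apply: bl; by rewrite inE Rl orbT.
Qed.
End Slots.

(** For a block C, the element of kS through which a in kG acts on the slot at C and on no other. *)
Definition at_block C (a : kG) : kS := \sum_g (a g : k) *: hsiao_elt k (cut C g).

Lemma at_block_act (A : lmodType kS) C a (y : A) :
  at_block C a *: y = \sum_g (a g : k) *: (cut C g @@ y : restr A) :> restr A.
Proof.
by rewrite /at_block scaler_suml; apply: eq_bigr => g _; rewrite restrZA.
Qed.

Lemma at_block_tensor e (A : lmodType kS) tau C a x : set_tensor e (A := A) tau ->
  block e C -> at_block C a *: (tau x : A) = tau (dfwith x (a *: (x C : X C))).
Proof.
move=> st bC; rewrite at_block_act.
have /linear_bundle[h hE] := slot_lin (st_slot st) x bC.
rewrite -hE (ma_act_sum a (x C : X C)) linear_sum; apply: eq_bigr => g _.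
rewrite linearZ /= hE; congr (_ *: _); rewrite (st_act st) ?hge_cut_of_block //.
apply: (st_slot st).1 => R bR; rewrite (blab_cut (hge_cut_of_block g bC) bR)
  (block_subset bC bR).
case: (eqVneq C R) => [<-|CR]; first by rewrite dfwith_in.
by rewrite dfwith_out //; exact: ma_elt1_act.
Qed.

Definition at_blocks (l : seq {set 'I_n}) (a : {set 'I_n} -> kG) : kS :=
  foldr (fun C z => at_block C (a C) * z) 1 l.

Lemma at_blocks_tensor e (A : lmodType kS) tau l a x : set_tensor e (A := A) tau ->
  uniq l -> (forall C, C \in l -> block e C) ->
  at_blocks l a *: (tau x : A) = tau (fun R => if R \in l then a R *: (x R : X R) else x R).
Proof.
move=> st; elim: l => [|C l IHl] /=; first by rewrite scale1r.
move=> /andP[Cl ul] bl; rewrite -scalerA IHl // => [|R Rl]; last by apply: bl;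
  rewrite inE Rl orbT.
rewrite (at_block_tensor _ _ st); last by apply: bl; rewrite inE eqxx.
congr (tau _); apply: functional_extensionality_dep => R; rewrite inE.
case: (eqVneq C R) => [<-|CR] /=; first by rewrite dfwith_in (negPf Cl).
by rewrite dfwith_out.
Qed.

(** The sets in l are blocks of f, so the cuts at them are coarser than f and Delta commutes with
    them. *)
Lemma at_blocks_comm f (A B : lmodType kS) (Delta : restr A -> restr B) l a (y : A) :
    linear Delta -> (forall t (x : A), hge t f -> t @@ (Delta x : B) = Delta (t @@ x)) ->
    (forall C, C \in l -> block f C) ->
  Delta (at_blocks l a *: y) = at_blocks l a *: (Delta y : B).
Proof.
move=> lD eD; have [d dE] := linear_bundle lD; elim: l y => [|C l IHl] y /= bl.
  by rewrite !scale1r.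
rewrite -!scalerA -IHl => [|R Rl]; last by apply: bl; rewrite inE Rl orbT.
rewrite !at_block_act -dE linear_sum; apply: eq_bigr => g _.
rewrite linearZ /= !dE eD //; apply: hge_cut_of_block; apply: bl.
by rewrite inE eqxx.
Qed.

End SetTensors.

(** * Merging two blocks *)

Section MergeBlocks.
Variables (n : nat) (G : finGroupType) (e f : hsiao n G) (p q : 'I_n).
Hypotheses (fe : hge f e) (pq : merges e f p q).
Local Notation Bp := (hblock e p).
Local Notation Bq := (hblock e q).
Local Notation R0 := (hblock f p).
Implicit Types R : {set 'I_n}.

Lemma merges_neq : Bp != Bq.
Proof.
have [epq _ _] := pq; apply: contra epq => /eqP E.
by have := mem_hblock e q; rewrite -E inE.
Qed.

Lemma merges_block_f R : block f R -> R != R0 -> [/\ block e R, R != Bp & R != Bq].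
Proof.
have [epq fpq mpq] := pq; case/blockP => i -> iR0.
have nfp : ~~ heq f p i by apply: contra iR0 => /hblock_eq ->.
have nep : ~~ heq e p i by apply: contra nfp; exact: (hgeP _ _ fe).
have neq : ~~ heq e q i.
  by apply: contra nfp => /(hgeP _ _ fe); apply: heq_trans.
have E : hblock f i = hblock e i.
  apply/finset.setP => j; rewrite !inE; apply/idP/idP; last exact: (hgeP _ _ fe).
  by case/mpq => // -[] h; [rewrite h in nep | rewrite h in neq].
rewrite E; split; first exact: block_hblock.
  by apply: contra nep => /eqP E'; have := mem_hblock e i; rewrite E' inE.
by apply: contra neq => /eqP E'; have := mem_hblock e i; rewrite E' inE.
Qed.

Lemma merges_block_e R : block e R -> R != Bp -> R != Bq -> block f R /\ R != R0.
Proof.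
have [epq fpq mpq] := pq; case/blockP => i -> ip iq.
have nep : ~~ heq e p i by apply: contra ip => /hblock_eq ->.
have neq : ~~ heq e q i by apply: contra iq => /hblock_eq ->.
have E : hblock f i = hblock e i.
  apply/finset.setP => j; rewrite !inE; apply/idP/idP; last exact: (hgeP _ _ fe).
  by case/mpq => // -[] h; [rewrite h in nep | rewrite h in neq].
rewrite -E; split; first exact: block_hblock.
apply: contra nep => /eqP E'; have := mem_hblock f p; rewrite -E' E inE.
by rewrite heq_sym.
Qed.

Lemma merges_not_block_e : ~~ block e R0.
Proof.
have [epq fpq _] := pq; apply: contra epq => h.
by have := fpq; rewrite -(finset.in_set) -/(hblock f p) (block_mem h (mem_hblock f p)) inE.
Qed.

Lemma merges_not_block_f R : R = Bp \/ R = Bq -> ~~ block f R.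
Proof.
move=> RE; apply/negP => h; have [R0R|nR] := eqVneq R R0.
  have := merges_not_block_e; rewrite -R0R.
  by case: RE => ->; rewrite block_hblock.
have [_ np nq] := merges_block_f h nR.
by case: RE => E; [rewrite E eqxx in np | rewrite E eqxx in nq].
Qed.

Lemma merges_sub : Bp \subset R0 /\ Bq \subset R0.
Proof.
have [_ fpq _] := pq; split; apply/fintype.subsetP => i; rewrite !inE => /(hgeP _ _ fe) //.
exact: heq_trans.
Qed.

Definition common := [seq R <- enum {: {set 'I_n}} | [&& block e R, R != Bp & R != Bq]].

Lemma common_uniq : uniq common.
Proof. by rewrite filter_uniq ?enum_uniq. Qed.

Lemma mem_common R : (R \in common) = [&& block e R, R != Bp & R != Bq].
Proof. by rewrite mem_filter mem_enum andbT. Qed.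

Lemma common_e R : R \in common -> block e R.
Proof. by rewrite mem_common => /and3P[]. Qed.

Lemma common_f R : R \in common -> block f R.
Proof. by rewrite mem_common => /and3P[bR Rp Rq]; have [] := merges_block_e bR Rp Rq. Qed.

Lemma common_R0 : R0 \notin common.
Proof. by rewrite mem_common (negPf merges_not_block_e). Qed.

Lemma block_f_common R : block f R -> R != R0 -> R \in common.
Proof. by move=> bR nR; rewrite mem_common; apply/and3P; exact: merges_block_f. Qed.

End MergeBlocks.

(** [eps] is a diagonal matrix unit: a projector onto the line of x that is realised inside kG, so
    that equivariant maps respect it. *)
Lemma rank_one_exists (k : closedFieldType) (G : finGroupType)
    (M : lmodType (group_alg k G)) : simple_module M ->
  exists (x : restr M) (eps : group_alg k G) (lam : restr M -> k),
    [/\ scalar lam, lam x = 1 & forall v : restr M, eps *: (v : M) = lam v *: x].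
Proof.
move=> sM; have [d [b [c bc]]] := simple_fd sM.
have d0 : (0 < d)%N by exact: simple_basis_gt0 bc.
have [E EE] := simple_matrix_units sM bc; pose o := Ordinal d0.
have [cl bE cb] := bc.
exists (b o), (E o o), (c o); split=> [||v]; first exact: cl.
  by rewrite cb eqxx.
have /linear_bundle[h hE] := @act_linear k _ M (E o o).
rewrite -hE [v in h v]bE linear_sum (bigD1 o) //= big1 => [|j jo].
  by rewrite linearZ /= hE EE eqxx addr0.
by rewrite linearZ /= hE EE eq_sym (negPf jo) scaler0.
Qed.

(** * Equivariant maps as intertwiners from the two merged factors to the new one *)

Section Merge.
Variables (k : closedFieldType) (n : nat) (G : finGroupType).
Local Notation S := (hsiao n G).
Local Notation kS := (hsiao_alg k n G).
Local Notation kG := (group_alg k G).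
Local Notation "s @@ x" := (hsiao_elt k s *: x) (at level 40).
Variable X : {set 'I_n} -> lmodType kG.
Local Notation rX R := (restr (X R) : lmodType k).
Hypothesis sX : forall R, simple_module (X R).
Variables (e f : S) (A B : lmodType kS).
Variables (tauA : (forall R, rX R) -> restr A) (tauB : (forall R, rX R) -> restr B).
Hypotheses (stA : set_tensor e tauA) (stB : set_tensor f tauB).
Hypothesis fe : hge f e.
Variables (p q : 'I_n).
Hypothesis pq : merges e f p q.
Local Notation Bp := (hblock e p).
Local Notation Bq := (hblock e q).
Local Notation R0 := (hblock f p).
Local Notation cs := (common e p q).

Implicit Types R C : {set 'I_n}.

Definition merged_pair (b : bool) : lmodType kG := if b then X Bp else X Bq.
Local Notation rV b := (restr (merged_pair b) : lmodType k).
Definition pair_family (v : rX Bp) (w : rX Bq) (b : bool) : rV b :=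
  if b as b' return rV b' then v else w.

Lemma pair_family_dfwith_l v v' w : pair_family v' w = dfwith (pair_family v w) (v' : rV true).
Proof. by apply: functional_extensionality_dep => -[]; rewrite ?dfwith_in ?dfwith_out. Qed.

Lemma pair_family_dfwith_r v w w' : pair_family v w' = dfwith (pair_family v w) (w' : rV false).
Proof. by apply: functional_extensionality_dep => -[]; rewrite ?dfwith_in ?dfwith_out. Qed.

Lemma pair_family_eta (v : forall b, rV b) : pair_family (v true) (v false) = v.
Proof. by apply: functional_extensionality_dep => -[]. Qed.

Variables (T : lmodType kG) (tau0 : (forall b, rV b) -> restr T).
Hypothesis tT : is_tensor tau0.
Hypothesis tE : forall (g : G) (v : forall b, rV b),
  group_elt k g *: (tau0 v : T) = tau0 (fun b => group_elt k g *: (v b : merged_pair b)).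

Lemma tau0_pairl a u v w :
  tau0 (pair_family (a *: u + v) w) = a *: tau0 (pair_family u w) + tau0 (pair_family v w).
Proof. by rewrite (pair_family_dfwith_l 0) tT.1 -!pair_family_dfwith_l. Qed.

Lemma tau0_pairr a u v w :
  tau0 (pair_family w (a *: u + v)) = a *: tau0 (pair_family w u) + tau0 (pair_family w v).
Proof. by rewrite (pair_family_dfwith_r _ 0) tT.1 -!pair_family_dfwith_r. Qed.

Variables (x0 : forall R, rX R) (eps : {set 'I_n} -> kG) (lam : forall R, rX R -> k).
Hypothesis lamL : forall R, scalar (@lam R).
Hypothesis lam1 : forall R, lam (x0 R) = 1.
Hypothesis epsE : forall R (v : rX R), eps R *: (v : X R) = lam v *: x0 R.

Definition fill_pair (x : forall R, rX R) (v : rX Bp) (w : rX Bq) : forall R, rX R :=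
  dfwith (dfwith x v) w.

Lemma fill_pair_p x v w : fill_pair x v w Bp = v.
Proof. by rewrite /fill_pair dfwith_out ?dfwith_in // eq_sym (merges_neq pq). Qed.

Lemma fill_pair_q x v w : fill_pair x v w Bq = w.
Proof. by rewrite /fill_pair dfwith_in. Qed.

Lemma fill_pair_out x v w R : R != Bp -> R != Bq -> fill_pair x v w R = x R.
Proof. by move=> Rp Rq; rewrite /fill_pair !dfwith_out // eq_sym. Qed.

(** T, the tensor product of the two merged factors, is mapped to A by placing the fixed vectors
    [x0] in the common slots. *)
Lemma slice_inclusion_exists : exists j : {linear restr T -> restr A}, forall v w,
  j (tau0 (pair_family v w)) = tauA (fill_pair x0 v w).
Proof.
have ml : multilinear (fun v : forall b, rV b => tauA (fill_pair x0 (v true) (v false))).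
  move=> v [] a x y; rewrite !dfwith_in !dfwith_out // /fill_pair.
    rewrite !(dfwith_comm _ _ (v false)) ?(merges_neq pq) //.
    by rewrite (slot_lin (st_slot stA)) // block_hblock.
  by rewrite (slot_lin (st_slot stA)) // block_hblock.
have [j jE] := tensor_lift tT ml; exists j => v w.
by rewrite jE.
Qed.

(** On the side of B the common slots are contracted against [lam], which leaves the factor at the
    merged block. *)
Lemma slice_projection_exists : exists h : {linear restr B -> rX R0}, forall x,
  h (tauB x) = (\prod_(C <- cs) lam (x C)) *: x R0.
Proof.
apply: (st_lift stB); split=> [x y xy|x R a u w bR].
  rewrite (xy R0) ?block_hblock //; congr (_ *: _).
  apply: eq_big_seq => C /(common_f fe pq) bC; by rewrite xy.
case: (eqVneq R R0) => [RE|nR].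
  subst R; rewrite !dfwith_in.
  have E (z : rX R0) : \prod_(C <- cs) lam (dfwith x z C) = \prod_(C <- cs) lam (x C).
    apply: eq_big_seq => C CC; rewrite dfwith_out //.
    by apply: contraNneq (common_R0 pq) => ->.
  by rewrite !E scalerDr !scalerA mulrC.
rewrite ![dfwith _ _ R0]dfwith_out //.
have E (z : rX R) : \prod_(C <- cs) lam (dfwith x z C) =
    lam z * \prod_(C <- cs | C != R) lam (x C).
  rewrite (bigD1_seq R) ?common_uniq ?(block_f_common fe pq) //= dfwith_in.
  by congr (_ * _); apply: eq_bigr => C CR; rewrite dfwith_out // eq_sym.
by rewrite !E lamL mulrDl scalerDl scalerA mulrA.
Qed.

Variables (jA : {linear restr T -> restr A}) (pB : {linear restr B -> rX R0}).
Hypothesis jE : forall v w, jA (tau0 (pair_family v w)) = tauA (fill_pair x0 v w).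
Hypothesis pE : forall x, pB (tauB x) = (\prod_(C <- cs) lam (x C)) *: x R0.

(** The source of the diagonal action: R0 contains both merged blocks, so the cut at R0 with label g
    puts g on both factors and 1 on the others. *)
Lemma blab_cut_R0 (g : G) R : block e R ->
  blab (cut R0 g) R = if (R == Bp) || (R == Bq) then g else 1%g.
Proof.
move=> bR; have ce : hge (cut R0 g) e.
  by apply: hge_trans fe; apply: hge_cut_of_block; exact: block_hblock.
have [sp sq] := merges_sub fe pq.
rewrite (blab_cut ce bR); case: eqVneq => [->|nRp] /=; first by rewrite sp.
case: eqVneq => [->|nRq] /=; first by rewrite sq.
case: ifP => // RR; have [bfR nR] := merges_block_e fe pq bR nRp nRq.
by move: RR; rewrite (block_subset (block_hblock f p) bfR) (negPf nR).
Qed.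

Lemma slice_inclusion_act (g : G) t : jA (group_elt k g *: (t : T)) = cut R0 g @@ (jA t : A).
Proof.
have [a aE] := linear_bundle (@act_linear k _ T (group_elt k g)).
have [b bE] := linear_bundle (@act_linear k _ A (hsiao_elt k (cut R0 g))).
rewrite -aE -bE; apply: (tensor_ext tT (h := jA \o a) (h' := b \o jA)) => v /=.
rewrite aE bE tE -(pair_family_eta v) jE.
rewrite (st_act stA); last first.
  by apply: hge_trans fe; apply: hge_cut_of_block; exact: block_hblock.
have -> : (fun b => group_elt k g *: (pair_family (v true) (v false) b : merged_pair b)) =
    pair_family (group_elt k g *: (v true : X Bp)) (group_elt k g *: (v false : X Bq)).
  by apply: functional_extensionality_dep => -[].
rewrite jE; apply: (st_slot stA).1 => R bR; rewrite (blab_cut_R0 g bR).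
case: (eqVneq R Bp) => [->|Rp] /=; first by rewrite !fill_pair_p.
case: (eqVneq R Bq) => [->|Rq] /=; first by rewrite !fill_pair_q.
by rewrite !fill_pair_out //; exact/esym/ma_elt1_act.
Qed.

Lemma slice_projection_act (g : G) z : pB (cut R0 g @@ (z :
  B)) = group_elt k g *: (pB z : X R0).
Proof.
have [a aE] := linear_bundle (@act_linear k _ (X R0) (group_elt k g)).
have [b bE] := linear_bundle (@act_linear k _ B (hsiao_elt k (cut R0 g))).
rewrite -aE -bE; apply: (st_ext stB (h := pB \o b) (h' := a \o pB)) => [||x /=].
- exact: linearP.
- exact: linearP.
have cf : hge (cut R0 g) f by apply: hge_cut_of_block; exact: block_hblock.
rewrite aE bE (st_act stB) // !pE -restrZC; congr (_ *: _).
  apply: eq_big_seq => C CC; congr (lam _).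
  have bC := common_f fe pq CC.
  rewrite (blab_cut cf bC) (block_subset (block_hblock f p) bC).
  rewrite (negPf (_ : C != R0)); first exact: ma_elt1_act.
  by apply: contraNneq (common_R0 pq) => <-.
by rewrite (blab_cut cf (block_hblock f p)) subxx.
Qed.

(* By Schur's lemma on the blocks common to e and f, an equivariant Delta is
   determined by its effect on the two merged factors. *)
Definition slice (Delta : A -> restr B) (t : T) : restr (X R0) := pB (Delta (jA t)).

Lemma slice_linear Delta : equivariant f Delta -> linear (slice Delta : T -> X R0).
Proof.
move=> [lD eD]; apply: ma_linear => [a x y|g t].
  by rewrite /slice linearP lD linearP.
rewrite -[ma_elt k g]/(group_elt k g) /slice slice_inclusion_act -eD ?slice_projection_act //.
by apply: hge_cut_of_block; exact: block_hblock.
Qed.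

Lemma eps_fixes v w : at_blocks cs eps *: (tauA (fill_pair x0 v w) :
  A) = tauA (fill_pair x0 v w).
Proof.
rewrite (at_blocks_tensor _ _ stA) ?common_uniq //; last by move=> C; exact: common_e.
congr (tauA _); apply: functional_extensionality_dep => R; case: ifP => //.
rewrite mem_common => /and3P[_ Rp Rq]; rewrite !fill_pair_out //.
by rewrite epsE lam1 scale1r.
Qed.

(** [eps] turns each common factor into a multiple of [x0], so that only the contraction [pB z] of z
    survives. Together with [eps_fixes] this shows that Delta, which commutes with [eps], maps the
    slice of A to that of B. *)
Lemma eps_project z : at_blocks cs eps *: (z : B) = tauB (dfwith x0 (pB z)).
Proof.
have bR0 := block_hblock f p.
have [a aE] := linear_bundle (@act_linear k _ B (at_blocks cs eps)).
have [s sE] := linear_bundle (slot_lin (st_slot stB) x0 bR0).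
rewrite -aE -sE; apply: (st_ext stB (h := a) (h' := s \o pB)) => [||x /=].
- exact: linearP.
- exact: linearP.
rewrite aE sE pE (at_blocks_tensor _ _ stB) ?common_uniq //; last first.
  by move=> C; exact: (common_f fe pq).
have -> : (fun R => if R \in cs then eps R *: (x R : X R) else x R) =
    fun R => if R \in cs then lam (x R) *: x0 R else x R.
  by apply: functional_extensionality_dep => R; rewrite epsE.
rewrite (slot_prod (st_slot stB)) ?common_uniq //; last first.
  by move=> C; exact: (common_f fe pq).
rewrite (slot_scale (st_slot stB)) //; congr (_ *: _).
apply: (st_slot stB).1 => R bR; case: (eqVneq R R0) => [->|nR].
  by rewrite dfwith_in (negPf (common_R0 pq)).
by rewrite (block_f_common fe pq bR nR) dfwith_out // eq_sym.
Qed.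

(** The common factors are generated by the [x0], so letting kG act at the common blocks carries the
    slice to every pure tensor of A, and Delta commutes with this action. *)
Lemma slice_inj Delta : equivariant f Delta -> slice Delta = (fun=> 0) -> Delta = (fun=> 0).
Proof.
move=> [lD eD] s0; have bR0 := block_hblock f p.
suff D0 x : Delta (tauA x) = 0.
  apply/funext => y; apply: (st_ext stA (h := Delta) (h' := fun=> 0)) => // a u w.
  by rewrite scaler0 addr0.
have /choice[a aE] : forall R, exists a : kG, a *: (x0 R : X R) = x R.
  move=> R; have x00 : x0 R != 0 :> X R.
    apply/eqP => x00; have := lamL (R := R) 1 0 0; rewrite scaler0 addr0 mul1r.
    rewrite -{1}[lam _]addr0 => /addrI /esym; rewrite -[0]x00 lam1 => /eqP.
    by rewrite oner_eq0.
  by have [a ->] := simple_cyclic (x R : X R) (sX R) x00; exists a.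
have -> : tauA x = at_blocks cs a *: (tauA (fill_pair x0 (x Bp) (x Bq)) : A).
  rewrite (at_blocks_tensor _ _ stA) ?common_uniq //; last by move=> C; exact: common_e.
  apply: (st_slot stA).1 => R bR.
  case: (eqVneq R Bp) => [->|Rp]; first by rewrite mem_common eqxx andbF fill_pair_p.
  case: (eqVneq R Bq) => [->|Rq]; first by rewrite mem_common eqxx !andbF fill_pair_q.
  by rewrite mem_common bR Rp Rq /= fill_pair_out // aE.
have cf : forall C, C \in cs -> block f C by move=> C; exact: (common_f fe pq).
rewrite (at_blocks_comm _ _ lD eD) // -eps_fixes (at_blocks_comm _ _ lD eD) // eps_project.
have -> : pB (Delta (tauA (fill_pair x0 (x Bp) (x Bq)))) = 0.
  by rewrite -jE; exact: (congr1 (fun F => F (tau0 (pair_family (x Bp) (x Bq)))) s0).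
by rewrite (slot_eq0 (st_slot stB) bR0) ?dfwith_in ?scaler0.
Qed.

Lemma slice_onto (h : T -> restr (X R0)) : linear (h : T -> X R0) ->
  exists2 Delta, equivariant f Delta & slice Delta = h.
Proof.
move=> lh; have bR0 := block_hblock f p.
have [h' hE] := linear_bundle lh.
have lhr : linear (h : restr T -> rX R0).
  by move=> a u w; rewrite -!hE; exact: (restr_linear h').
(* Delta applies h to the two merged factors and leaves the common ones unchanged; by [irrel],
   [tauB] ignores the components of x at the two merged blocks. *)
pose beta (x : forall R, rX R) : restr B := tauB (dfwith x (h (tau0 (pair_family (x Bp)
  (x Bq))))).
have irrel (R : {set 'I_n}) (x : forall R, rX R) (u : rX R) z : ~~ block f R ->
    tauB (dfwith (dfwith x u) (z : rX R0)) = tauB (dfwith x z).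
  move=> nR; apply: (st_slot stB).1 => R' bR'; case: (eqVneq R0 R') => [<-|n0].
    by rewrite !dfwith_in.
  rewrite !(dfwith_out _ _ n0) dfwith_out //.
  by apply: contraNneq nR => ->.
have sb : slot_linear e beta.
  split=> [x y xy|x R a u w bR].
    rewrite /beta (xy Bp) ?block_hblock // (xy Bq) ?block_hblock //.
    apply: (st_slot stB).1 => R bR; case: (eqVneq R R0) => [->|nR].
      by rewrite !dfwith_in.
    rewrite !dfwith_out 1?eq_sym //.
    by have [bR' _ _] := merges_block_f fe pq bR nR; exact: xy.
  rewrite /beta; case: (eqVneq R Bp) => [RE|Rp].
    subst R; rewrite !dfwith_in ![dfwith x _ Bq]dfwith_out ?(merges_neq pq) //.
    rewrite !irrel; try by apply: (merges_not_block_f fe pq); left.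
    rewrite -(slot_lin (st_slot stB)) //; congr (tauB (dfwith _ _)).
    by rewrite tau0_pairl lhr.
  case: (eqVneq R Bq) => [RE|Rq].
    subst R; rewrite !dfwith_in ![dfwith x _ Bp]dfwith_out //.
    rewrite !irrel; try by apply: (merges_not_block_f fe pq); right.
    rewrite -(slot_lin (st_slot stB)) //; congr (tauB (dfwith _ _)).
    by rewrite tau0_pairr lhr.
  rewrite ![dfwith x _ Bp]dfwith_out // ![dfwith x _ Bq]dfwith_out //.
  have [bfR nR] := merges_block_e fe pq bR Rp Rq.
  rewrite !(dfwith_comm _ _ (h _)) //.
  by rewrite (slot_lin (st_slot stB)).
have [Delta DE] := st_lift stA sb.
exists Delta; first split.
- exact: linearP.
- move=> t y tf; have te := hge_trans tf fe.
  have [a aE] := linear_bundle (@act_linear k _ A (hsiao_elt k t)).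
  have [b bE] := linear_bundle (@act_linear k _ B (hsiao_elt k t)).
  rewrite -aE -bE; apply: (st_ext stA (h := b \o Delta) (h' := Delta \o a)) => [||x /=].
  + exact: linearP.
  + exact: linearP.
  rewrite aE bE (st_act stA) // !DE /beta (st_act stB) //.
  have pR0 : p \in R0 := mem_hblock f p.
  have lp : blab t Bp = blab t R0.
    by rewrite (blabE te (block_hblock e p) (mem_hblock e p)) (blabE tf bR0 pR0).
  have lq : blab t Bq = blab t R0.
    have [_ fpq _] := pq.
    rewrite (blabE te (block_hblock e q) (mem_hblock e q)) (blabE tf bR0 pR0).
    by apply/esym/hlab_heq; exact: (hgeP _ _ tf).
  apply: (st_slot stB).1 => R bR; case: (eqVneq R R0) => [->|nR].
    rewrite !dfwith_in lp lq -hE -linearZ hE tE; congr (h (tau0 _)).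
    by apply: functional_extensionality_dep => -[].
  by rewrite !dfwith_out // eq_sym.
apply/funext => t; apply: (tensor_extf tT (h := slice Delta) (h' := h)) => // [|v].
  by move=> a u w; rewrite /slice !linearP.
rewrite -(pair_family_eta v) /slice jE DE /beta fill_pair_p fill_pair_q pE dfwith_in.
rewrite big_seq big1 ?scale1r // => C CC; rewrite dfwith_out; last first.
  by apply: contraNneq (common_R0 pq) => ->.
by have := CC; rewrite mem_common => /and3P[_ Cp Cq]; rewrite fill_pair_out.
Qed.

Lemma equivariant_dim d : hom_dim T (X R0) d ->
  subquot_dim (fun D => equivariant f D) (fun D : A -> restr B => D = 0) d.
Proof.
apply: (@subquot_dim_transfer k (A -> restr B) (T -> restr (X R0)) _ _ _ slice).
- move=> a D D' [lD eD] [lD' eD'].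
  have E y : (a *: D + D') y = a *: D y + D' y by [].
  split; last by apply/funext => t; rewrite /slice E linearP.
  split=> [c u w|t y tf]; rewrite !E; first by rewrite lD lD' !scalerDr !scalerA [c *
    a]mulrC addrACA.
  by rewrite actP eD // eD'.
- by move=> D eD; exact: slice_linear.
- by move=> h /slice_onto.
- move=> D eD; split=> [->|/(slice_inj eD) ->]; last by [].
  by apply/funext => t; rewrite /slice linear0.
Qed.

End Merge.

(** * Arrows of the quiver *)

Lemma subquot_dim0 (k : fieldType) (V : lmodType k) (Z : set V) :
  (forall z, Z z -> z = 0) -> subquot_dim Z (fun z => z = 0) 0.
Proof.
move=> Z0; exists (fun=> 0); split=> [[]//|z Zz]; exists 0; split=> [|c _].
  by rewrite big_ord0 subr0; exact: Z0.
by rewrite [c]thinmx0.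
Qed.

Section HsiaoExt.
Variables (k : fieldType) (n : nat) (G : finGroupType).
Local Notation S := (hsiao n G).
Local Notation kS := (hsiao_alg k n G).
Variables (A B : lmodType kS) (m : nat) (b : 'I_m -> restr A) (c : 'I_m -> restr A -> k).
Hypothesis bc : is_basis b c.
Local Notation deriv := (@derivation k S (1%g : S) (@mulg S) A B).
Local Notation inner := (@inner k S (1%g : S) (@mulg S) A B).

Lemma ext1_dim0 : (forall D, deriv D -> inner D) -> ext1_dim A B 0.
Proof.
move=> inn.
apply: (ext1_of_derivations bc (W := k^o) (Z' := fun w => w = 0) (c := fun=> 0)) => //.
- by move=> a D D' _ _; rewrite scaler0 addr0.
- move=> w ->; exists 0 => //; split=> [s a x y|s t x]; last first.
    by rewrite -[RHS]/(_ *: 0 + 0) scaler0 addr0.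
  by rewrite -[RHS]/(_ *: 0 + 0) scaler0 addr0.
- by move=> D dD; split=> // _; exact: inn.
- exact: subquot_dim0.
Qed.

Lemma ext1_dim_merges e f p q d : typed e A -> typed f B -> hge f e -> merges e f p q ->
    subquot_dim (fun D => equivariant f D) (fun D : A -> restr B => D = 0) d ->
  ext1_dim A B d.
Proof.
move=> hA hB fe pq.
pose jump (D : S -> A -> restr B) : A -> restr B :=
  D (cut (hblock e p) (1%g : G)) - D (cut (hblock e q) (1%g : G)).
apply: (ext1_of_derivations bc (c := jump)).
- move=> a D D' _ _; apply/funext => x.
  rewrite -[LHS]/(a *: D _ x + D' _ x - (a *: D _ x + D' _ x)).
  rewrite -[RHS]/(a *: (D _ x - D _ x) + (D' _ x - D' _ x)).
  by rewrite scalerBr opprD addrACA.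
- move=> D dD; split=> [a x y|t x tf].
    have [lD _] := dD; rewrite -[LHS]/(D _ _ - D _ _) !lD.
    rewrite -[RHS]/(a *: (D _ x - D _ x) + (D _ y - D _ y)).
    by rewrite scalerBr opprD addrACA.
  exact: (merges_equivariant dD hA hB fe pq).
- move=> Delta eD; have [D dD DE] := merges_deriv hA hB fe pq eD.
  by exists D.
- move=> D dD; rewrite (merges_inner dD hA hB fe pq).
  by split=> [E|/eqP]; [rewrite /jump E subrr | rewrite subr_eq0 => /eqP].
Qed.

End HsiaoExt.

Section Arrows.
Variables (k : closedFieldType) (n : nat) (G : finGroupType).
Hypothesis hk : forall p : nat, p \in [pchar k] -> ~~ (p %| #|G|)%N.
Local Notation S := (hsiao n G).
Local Notation kS := (hsiao_alg k n G).
Local Notation kG := (group_alg k G).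
Local Notation LP := (labelled_partition n (Irr kG)).
Implicit Types (A B : lmodType kS) (L M : LP) (R P Q : {set 'I_n}).

Lemma ordering_block L r (P : 'I_r -> {set 'I_n}) (hP : ordered_partition (codom P)) x V R :
  ordering L P x V ->
  (block (gpart hP (fun=> 1%g : G)) R <-> exists y, sval L R y).
Proof.
move=> [LP _]; split=> [/blockP[i ->]|[y /LP[a [-> _]]]].
  have [a ia] := gpart_block_ex G hP i; exists (x a); apply/LP; exists a.
  by rewrite (gpart_block hP (fun=> 1%g : G) ia).
have [i ia] := gpart_nonempty G hP a; apply/blockP; exists i.
exact: gpart_block.
Qed.

Lemma labelled_uniq L R y z : sval L R y -> sval L R z -> y = z.
Proof. by have [_ h] := svalP L; exact: h. Qed.

Lemma simple_dim0 A B : simple_module A ->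
  (forall D, @derivation k S (1%g : S) (@mulg S) A B D ->
    @inner k S (1%g : S) (@mulg S) A B D) ->
  ext1_dim A B 0.
Proof. by move=> sA; have [m [b [c bc]]] := simple_fd sA; exact: (ext1_dim0 bc). Qed.

Lemma ext1_no_merge L M A B : simple_module A -> simple_module B ->
    affords L A -> affords M B ->
    (forall P Q v w u, sval L P v -> sval L Q w -> P != Q ->
       sval M <> merge_blocks (sval L) P v Q w u) ->
  ext1_dim A B 0.
Proof.
move=> sA sB aA aB nLM.
have [r [P [hP [x [V [hA [ordL tA]]]]]]] := affordsE sA aA.
have [r' [P' [hP' [x' [V' [hB [ordM tB]]]]]]] := affordsE sB aB.
set e := gpart hP _ in hA tA; set f := gpart hP' _ in hB tB.
case: (boolP (hge f e)) => [fe|nfe]; last first.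
  by apply: simple_dim0 => // D dD; exact: inner_not_ge hA hB nfe dD.
case: (boolP (hge e f)) => [ef|nef].
  apply: simple_dim0 => // D dD; apply: (inner_same_apex hk hA _ dD).
  exact: typed_eqv hB (typed_triv hA) fe ef.
case: (pselect (exists p q, merges e f p q)) => [[p [q pq]]|npq]; last first.
  apply: simple_dim0 => // D dD; apply: (inner_not_merge dD hA hB fe nef) => p q pq.
  by apply: npq; exists p, q.
have Lb R : block e R <-> exists y, sval L R y by exact: ordering_block ordL.
have Mb R : block f R <-> exists y, sval M R y by exact: ordering_block ordM.
have [v Lv] := (Lb (hblock e p)).1 (block_hblock e p).
have [w Lw] := (Lb (hblock e q)).1 (block_hblock e q).
have [u Mu] := (Mb (hblock f p)).1 (block_hblock f p).
have R0E : hblock f p = hblock e p :|: hblock e q.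
  have [sp sq] := merges_sub fe pq; apply/eqP; rewrite finset.eqEsubset finset.subUset sp
    sq !andbT.
  apply/fintype.subsetP => i; rewrite !inE => fpi; have [epq fpq mpq] := pq.
  by case: (mpq p i fpi) => [->//|[_ ->]|[_ ->]//]; rewrite orbT.
(* The label u of the merged block is unconstrained, so M can fail to be a merge of L only through
   the label of a common block C. There [label_iso] excludes nonzero equivariant maps. *)
have [C [y [y' [LC MC yy']]]] : exists C y y', [/\ sval L C y, sval M C y' & y <> y'].
  apply: contrapT => same; have {}same C y y' : sval L C y -> sval M C y' -> y = y'.
    by move=> LC MC; apply: contrapT => yy'; apply: same; exists C, y, y'.
  apply: (nLM _ _ _ _ u Lv Lw (merges_neq pq)).
  apply/funext => R; apply/funext => z; apply/propext; rewrite /merge_blocks -R0E.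
  split=> [MR|[[-> ->]//|[LR [nv nw]]]].
    have bR : block f R by apply/Mb; exists z.
    case: (eqVneq R (hblock f p)) => [RE|nR].
      by left; split=> //; rewrite RE in MR; exact: labelled_uniq MR Mu.
    right; have [bR' Rp Rq] := merges_block_f fe pq bR nR.
    have [z' LR] := (Lb R).1 bR'; rewrite -(same R z' z LR MR); split=> //.
    by split=> -[E _]; [rewrite E eqxx in Rp | rewrite E eqxx in Rq].
  have bR : block e R by apply/Lb; exists z.
  have Rp : R != hblock e p.
    apply/eqP => E; apply: nv; split=> //; rewrite E in LR.
    exact: labelled_uniq LR Lv.
  have Rq : R != hblock e q.
    apply/eqP => E; apply: nw; split=> //; rewrite E in LR.
    exact: labelled_uniq LR Lw.
  have [bfR _] := merges_block_e fe pq bR Rp Rq.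
  by have [z' MR] := (Mb R).1 bfR; rewrite (same R z z' LR MR).
have [m [b [c bc]]] := simple_fd sA.
apply: (ext1_dim_merges bc hA hB fe pq); apply: subquot_dim0 => Delta [lD eD].
apply/funext => z; apply: contrapT => /eqP Dz.
have [LP xV] := ordL; have [MP xV'] := ordM.
have /LP[a [CP ya]] := LC; have /MP[a' [CP' ya']] := MC.
have bC : block f C by apply/Mb; exists y'.
apply: yy'; rewrite ya ya'.
have iso : module_isomorphic (V a) (V' a').
  apply: (label_iso (ordering_simple ordL) (ordering_simple ordM) tA tB _ lD _ Dz).
    by rewrite -CP -CP'.
  by move=> g t; rewrite -CP eD //; exact: hge_cut_of_block.
exact: irr_eq (irr_closed (xV a) iso) (xV' a').
Qed.

Lemma tensor_basis (I : finType) (W : I -> lmodType k) (T : lmodType k)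
    (tau : (forall i, W i) -> T) (d : I -> nat) (b : forall i, 'I_(d i) -> W i) c :
    is_tensor tau -> (forall i, is_basis (@b i) (@c i)) ->
  exists d' (b' : 'I_d' -> T) c', is_basis b' c'.
Proof.
move=> tT bc; have [g _ gT] := tensor_coords tT bc.
apply: (spanned_basis (u := fun x : {dffun forall i, 'I_(d i)} => tau (fun i => b i (x i)))).
by move=> t; exists (fun x => g x t).
Qed.

(** d has to be found before A and B are given, so the orderings, the representatives X and the
    tensor product T are fixed from L and M alone; A and B are then read along them by
    [affords_reorder]. *)
Lemma ext1_merge L M P Q v w u :
    sval L P v -> sval L Q w -> P != Q -> sval M = merge_blocks (sval L) P v Q w u ->
  exists d, hom_tensor_dim u v w d /\
    forall A B, simple_module A -> simple_module B -> affords L A -> affords M B ->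
      ext1_dim A B d.
Proof.
move=> LPv LQw PQ ME.
have [r [PL [hL [xL [VL [LP _]]]]]] := ordering_ex L.
have [r' [PM [hM [xM [VM [MP _]]]]]] := ordering_ex M.
set e := gpart hL (fun=> 1%g : G); set f := gpart hM (fun=> 1%g : G).
have blockL R y i : sval L R y -> i \in R -> R = hblock e i.
  by case/LP => a [-> _] ia; exact: gpart_block.
have blockM R y i : sval M R y -> i \in R -> R = hblock f i.
  by case/MP => a [-> _] ia; exact: gpart_block.
have neL R y : sval L R y -> exists i, i \in R.
  by case/LP => a [-> _]; exact: (gpart_nonempty G hL).
have [p pP] := neL _ _ LPv; have [q qQ] := neL _ _ LQw.
have PE := blockL _ _ _ LPv pP; have QE := blockL _ _ _ LQw qQ.
have MPQ : sval M (P :|: Q) u by rewrite ME; left.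
have R0E : P :|: Q = hblock f p by apply: blockM MPQ _; rewrite inE pP.
have epq : ~~ heq e p q by apply: contra PQ => pq; rewrite PE QE (hblock_eq pq).
have nL : forall y, ~ sval L (P :|: Q) y.
  move=> y /blockL PQE; case/negP: epq; have := PQE p; rewrite inE pP => /(_ isT) E.
  have : q \in hblock e p by rewrite -E finset.in_setU qQ orbT.
  by rewrite inE.
have toM R y : sval L R y -> R != P -> R != Q -> sval M R y.
  move=> LR RP RQ; rewrite ME; right; split=> //.
  by split=> -[E _]; [rewrite E eqxx in RP | rewrite E eqxx in RQ].
have heqL i j : heq e i j <-> exists R y, [/\ sval L R y, i \in R & j \in R].
  split=> [ij|[R [y [LR iR jR]]]]; last by have := jR; rewrite (blockL _ _ _ LR iR) inE.
  have [a ia] := gpart_block_ex G hL i; exists (PL a), (xL a); split=> //.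
    by apply/LP; exists a.
  exact: gpart_heq_mem ia ij.
have heqM' i j : heq f i j <-> exists R y, [/\ sval M R y, i \in R & j \in R].
  split=> [ij|[R [y [MR iR jR]]]]; last by have := jR; rewrite (blockM _ _ _ MR iR) inE.
  have [a ia] := gpart_block_ex G hM i; exists (PM a), (xM a); split=> //.
    by apply/MP; exists a.
  exact: gpart_heq_mem ia ij.
have fe : hge f e.
  apply/hgeP => i j /heqL[R [y [LR iR jR]]]; apply/heqM'.
  case: (eqVneq R P) => [RP|RP].
    by rewrite RP in iR jR; exists (P :|: Q), u; rewrite !finset.in_setU iR jR.
  case: (eqVneq R Q) => [RQ|RQ].
    by rewrite RQ in iR jR; exists (P :|: Q), u; rewrite !finset.in_setU iR jR !orbT.
  by exists R, y; split=> //; exact: toM.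
have pq : merges e f p q.
  split=> //; first by apply/heqM'; exists (P :|: Q), u; rewrite !finset.in_setU pP qQ orbT.
  move=> i j /heqM'[R [y []]]; rewrite ME => -[[-> _]|[LR _]] iR jR; last first.
    by constructor; apply/heqL; exists R, y.
  have inP l : l \in P -> heq e p l by rewrite PE inE.
  have inQ l : l \in Q -> heq e q l by rewrite QE inE.
  move: iR jR; rewrite !finset.in_setU => /orP[] i1 /orP[] j1.
  - by constructor; apply/heqL; exists P, v.
  - by constructor 2; split; [exact: inP | exact: inQ].
  - by constructor 3; split; [exact: inQ | exact: inP].
  - by constructor; apply/heqL; exists Q, w.
(* One label per subset serves both L and M, as they agree on the common blocks; v is a default at
   the subsets that are blocks of neither. *)
have /choice[lab labP] : forall R, exists y,
    (forall z, sval L R z -> y = z) /\ (forall z, sval M R z -> y = z).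
  move=> R; case: (pselect (exists y, sval L R y)) => [[y LR]|nLR].
    exists y; split=> z; first exact: labelled_uniq LR.
    rewrite ME => -[[RE _]|[LR' _]]; last exact: labelled_uniq LR LR'.
    by case: (nL y); rewrite -RE.
  case: (pselect (exists y, sval M R y)) => [[y MR]|nMR].
    by exists y; split=> z h; [case: nLR; exists z | exact: labelled_uniq MR h].
  by exists v; split=> z h; [case: nLR; exists z | case: nMR; exists z].
have /choice[X XP] : forall R, exists N, sval (lab R) N by move=> R; exact: irr_ex.
have sX R : simple_module (X R) by exact: irr_simple (XP R).
have XL R y : sval L R y -> sval y (X R).
  by move=> LR; have [h _] := labP R; rewrite -(h y LR).
have XM R y : sval M R y -> sval y (X R).
  by move=> MR; have [_ h] := labP R; rewrite -(h y MR).
have ordL : ordering L PL xL (fun i => X (PL i)).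
  by split=> // i; apply: XL; apply/LP; exists i.
have ordM : ordering M PM xM (fun i => X (PM i)).
  by split=> // i; apply: XM; apply/MP; exists i.
have sPair b : simple_module (merged_pair X e p q b) by case: b; exact: sX.
have [dv [bv [cv bcv]]] := simple_bases sPair.
have [//|//|T [tau0 [tT tE]]] := tensor_module_ex (pr := fun (b : bool) (g : G) => g) _ _ bcv.
have [dT [bT [cT bcT]]] := tensor_basis tT bcv.
have [dU [bU [cU bcU]]] := simple_fd (sX (hblock f p)).
(* [dUT] is the number of arrows as stated, [dTU] the dimension found for the equivariant maps. *)
have [d [dUT dTU]] := hom_dim_sym hk bcU bcT.
exists d; split.
  move=> U V W uU vV wW; exists T.
    apply: (tensor_module_isol (V := merged_pair X e p q)); last by exists tau0.
    move=> [] /=; first by apply: (irr_iso (x := v)) => //; rewrite /merged_pair -PE; exact: XL.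
    by apply: (irr_iso (x := w)) => //; rewrite /merged_pair -QE; exact: XL.
  apply: hom_dim_isol dUT; apply: (irr_iso (x := u)) => //.
  by rewrite -R0E; exact: XM.
move=> A B sA sB aA aB.
have [hA tA] := affords_reorder hL sA aA ordL.
have [hB tB] := affords_reorder hM sB aB ordM.
have [tauA stA] := set_tensor_of tA; have [tauB stB] := set_tensor_of tB.
have [m [b [c bc]]] := simple_fd sA.
apply: (ext1_dim_merges bc hA hB fe pq).
have /fin_all_exists[x0 x0P] : forall R, exists x : restr (X R), exists (eps : kG) (lam :
  restr (X R) -> k),
    [/\ scalar lam, lam x = 1 & forall v : restr (X R), eps *: (v : X R) = lam v *: x].
  by move=> R; exact: rank_one_exists.
have /fin_all_exists[eps epsP] := x0P; have /fin_all_exists[lam lamP] := epsP.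
have [jA jE] := slice_inclusion_exists stA pq tT x0.
have [pB pE] := slice_projection_exists stB fe pq (fun R => let: And3 h _ _ := lamP R in h).
by apply: (equivariant_dim sX stA stB fe pq tT tE _ _ _ jE pE dTU) => R; case: (lamP R).
Qed.

End Arrows.

Theorem theorem6p3 (G : finGroupType) (k : closedFieldType) (n : nat)
    (hk : forall p : nat, p \in [pchar k] -> ~~ (p %| #|G|)%N)
    (hn : (0 < n)%N) :
  [/\ (forall L : labelled_partition n (Irr (group_alg k G)),
         exists! x : Irr (hsiao_alg k n G), corresponds L x),
      (forall x : Irr (hsiao_alg k n G),
         exists! L : labelled_partition n (Irr (group_alg k G)),
           corresponds L x)
    & forall (L M : labelled_partition n (Irr (group_alg k G)))
        (x y : Irr (hsiao_alg k n G)),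
        corresponds L x -> corresponds M y ->
        (forall (P Q : {set 'I_n}) (v w u : Irr (group_alg k G)),
           sval L P v -> sval L Q w -> P != Q ->
           sval M = merge_blocks (sval L) P v Q w u ->
           exists d : nat, hom_tensor_dim u v w d /\ arrows x y d) /\
        ((forall (P Q : {set 'I_n}) (v w u : Irr (group_alg k G)),
            sval L P v -> sval L Q w -> P != Q ->
            sval M <> merge_blocks (sval L) P v Q w u) ->
         arrows x y 0)].
Proof.
split=> [L|x|L M x y Lx My]; [exact: corresponds_bij1 | exact: corresponds_bij2 |].
split=> [P Q v w u LP LQ PQ ME|nLM A B xA yB].
  have [d [hd ext]] := ext1_merge hk LP LQ PQ ME; exists d; split=> // A B xA yB.
  by apply: ext; [exact: irr_simple xA | exact: irr_simple yB | exact: Lx | exact: My].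
apply: (ext1_no_merge hk (irr_simple xA) (irr_simple yB) (Lx A xA) (My B yB)).
exact: nLM.
Qed.
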